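(* Let $1\le k\le n$, $s\in(-1,\infty)$, $\delta\in(0,1)$, and let $\Omega\subset\mathbb{R}^n$ be a strictly $(k-1)$-convex bounded domain containing the origin with boundary $\partial\Omega\in C^3$. Let $f$ be a nonnegative Lipschitz continuous function on $\overline\Omega\times\mathbb{R}$, and let $u\in C^3(\Omega)\cap C^1(\overline\Omega)$ be a $k$-admissible solution of $$S_k(D^2u)=\big[(|x|^2+\delta^2)^sf(x,u)\big]^k\quad\text{in }\Omega$$ with $u=\varphi$ on $\partial\Omega$, where $\varphi\in C^{1,1}(\partial\Omega)$. Suppose $K$ is a constant with $\sup_\Omega|x||Du(x)|\le K$. Then there exists $\alpha\in(0,1)$ independent of $\delta$ such that $$\|u\|_{C^{\alpha}(\overline\Omega)}\le C,$$ where $C$ depends on $n,k,s,\Omega,\|u\|_{L^\infty(\Omega)},f$ and $K$.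
   Context: For a symmetric matrix $A$ with eigenvalues $\lambda(A)$, $S_k(A)=\sigma_k(\lambda(A))$, $\sigma_k(\lambda)=\sum_{i_1<\cdots<i_k}\lambda_{i_1}\cdots\lambda_{i_k}$. $\Gamma_k=\{\lambda\in\mathbb{R}^n:\sigma_j(\lambda)>0,\ j=1,\dots,k\}$. A function $u\in C^2(\Omega)\cap C^0(\overline\Omega)$ is $k$-admissible if $\lambda(D^2u(x))\in\overline{\Gamma}_k$ for all $x\in\Omega$. A bounded $C^2$ domain is strictly $(k-1)$-convex if there is $K_0>0$ with $(\kappa_1(x),\dots,\kappa_{n-1}(x),K_0)\in\Gamma_k$ for all $x\in\partial\Omega$, $\kappa_i$ the principal curvatures of $\partial\Omega$ with respect to the inner normal. *)

(* Defs.v *)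
From HB Require Import structures.
From mathcomp Require Import all_boot all_order all_algebra.
From mathcomp Require Import all_classical all_reals all_analysis.
Set Implicit Arguments. Unset Strict Implicit. Unset Printing Implicit Defensive.
Import Order.TTheory GRing.Theory Num.Theory.
Import numFieldNormedType.Exports.
Local Open Scope classical_set_scope.
Local Open Scope ring_scope.

Section Defs.
Variable R : realType.

Definition enorm (m : nat) (x : 'rV[R]_m) : R := Num.sqrt (\sum_i x 0 i ^+ 2).

Definition partial (n : nat) (i : 'I_n) (f : 'rV[R]_n -> R) : 'rV[R]_n -> R :=
  fun x => derive f x (delta_mx 0 i : 'rV[R]_n).

Definition grad (n : nat) (f : 'rV[R]_n -> R) (x : 'rV[R]_n) : 'rV[R]_n :=
  \row_i partial i f x.

Definition hess (n : nat) (f : 'rV[R]_n -> R) (x : 'rV[R]_n) : 'M[R]_n :=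
  \matrix_(i, j) partial i (partial j f) x.

Fixpoint isCk (n : nat) (m : nat) (A : set 'rV[R]_n) (f : 'rV[R]_n -> R) : Prop :=
  match m with
  | 0 => forall x, A x -> {for x, continuous f}
  | m'.+1 => (forall x, A x -> differentiable f x) /\
             forall i : 'I_n, isCk m' A (partial i f)
  end.

Definition isC1_closure (n : nat) (A : set 'rV[R]_n) (u : 'rV[R]_n -> R) : Prop :=
  isCk 1 A u /\ {within closure A, continuous u} /\
  forall i : 'I_n, exists g : 'rV[R]_n -> R,
    {within closure A, continuous g} /\ forall x, A x -> g x = partial i u x.

Definition sigma (m : nat) (k : nat) (lam : 'rV[R]_m) : R :=
  \sum_(S : {set 'I_m} | #|S| == k) \prod_(i in S) lam 0 i.

Definition Gamma (m : nat) (k : nat) : set 'rV[R]_m :=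
  [set lam | forall j, (1 <= j <= k)%N -> 0 < sigma j lam].

Definition eigs_spec (m : nat) (A : 'M[R]_m) (lam : 'rV[R]_m) : Prop :=
  exists P : 'M[R]_m, P *m P^T = 1%:M /\ A = P^T *m diag_mx lam *m P.

Definition boundary (n : nat) (A : set 'rV[R]_n) : set 'rV[R]_n :=
  closure A `\` A.

Definition bounded_domain (n : nat) (A : set 'rV[R]_n) : Prop :=
  open A /\ connected A /\ A !=set0 /\ exists M : R, forall x, A x -> enorm x <= M.

Definition defining_fun3 (n : nat) (A : set 'rV[R]_n) (psi : 'rV[R]_n -> R) : Prop :=
  isCk 3 setT psi /\ (forall x, A x <-> psi x < 0) /\
  (forall x, boundary A x <-> psi x = 0) /\
  (forall x, boundary A x -> grad psi x != 0).

Definition tangent_frame (n : nat) (psi : 'rV[R]_n -> R) (x : 'rV[R]_n)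
  (E : 'M[R]_(n.-1, n)) : Prop :=
  E *m E^T = 1%:M /\ E *m (grad psi x)^T = 0.

(* matrix of the second fundamental form (w.r.t. the inner normal) in frame E;
   its eigenvalues are the principal curvatures kappa_1..kappa_{n-1} *)
Definition curv_matrix (n : nat) (psi : 'rV[R]_n -> R) (x : 'rV[R]_n)
  (E : 'M[R]_(n.-1, n)) : 'M[R]_(n.-1) :=
  (enorm (grad psi x))^-1 *: (E *m hess psi x *m E^T).

(* bounded domain with C^3 boundary which is strictly (k-1)-convex:
   (kappa_1,...,kappa_{n-1},K0) in Gamma_k on the boundary *)
Definition C3_strictly_k1_convex (n k : nat) (A : set 'rV[R]_n) : Prop :=
  bounded_domain A /\
  exists psi, defining_fun3 A psi /\
  exists K0 : R, 0 < K0 /\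
  forall x E, boundary A x -> tangent_frame psi x E ->
  forall lam : 'rV[R]_(n.-1 + 1),
    eigs_spec (block_mx (curv_matrix psi x E) 0 0 (K0%:M : 'M[R]_1)) lam ->
    Gamma k lam.

Definition k_admissible (n k : nat) (A : set 'rV[R]_n) (u : 'rV[R]_n -> R) : Prop :=
  forall x, A x -> forall lam, eigs_spec (hess u x) lam -> closure (Gamma k) lam.

Definition C11_on_boundary (n : nat) (A : set 'rV[R]_n) (phi : 'rV[R]_n -> R) : Prop :=
  exists Phi : 'rV[R]_n -> R, isCk 1 setT Phi /\
    (exists L : R, forall x y, enorm (grad Phi x - grad Phi y) <= L * enorm (x - y)) /\
    forall x, boundary A x -> Phi x = phi x.

Definition nonneg_lipschitz (n : nat) (A : set 'rV[R]_n) (f : 'rV[R]_n -> R -> R) : Prop :=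
  (forall x z, closure A x -> 0 <= f x z) /\
  exists L : R, forall x y z w, closure A x -> closure A y ->
    `|f x z - f y w| <= L * (enorm (x - y) + `|z - w|).

End Defs.

(* Main.v *)
(* The radial barrier [w = (|x|^2 + d2)^b] satisfies [S_k(D^2 w) >= const * |x|^(2(b-1)k)] when
   [2 k <= n], so for small [b > 0] a multiple of [w] beats the right hand side, uniformly in
   [d2 = delta^2].

   If [2 k <= n], one doubles variables: at a maximum of
   [u x - u y - L |x-y| + B |x-y|^2 + A w y - c |y|^2] the second order conditions, tested with
   the reflection exchanging [x - y] and its opposite, say that [D^2 u y] dominates a reflected
   copy of [D^2 u x], plus a large rank one term, minus a small multiple of the identity, plus
   [A D^2 w y]. The large negative eigenvalue of [D^2 u x] along [x - y] makes the rank one term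
   strong enough to stay in the cone (this uses Newton's inequalities), hence
   [S_k(D^2 u y)] exceeds the right hand side, a contradiction. So the oscillation decays
   geometrically on shrinking balls, which is a Hoelder bound at the origin. If [2 k > n], then
   [u x - u c <= C |x - c|^(2 b)] for [0 < 2 b < 2 - n / k] because no Hessian in the closed
   cone lies below that of [|x - c|^(2 b)].

   Away from the origin [|x| |Du| <= K] is a Lipschitz bound; interpolating it with the bound at
   the origin, pushing points inwards near the boundary, and using compactness gives the global
   estimate. *)
Require Import Defs.
From HB Require Import structures.
From mathcomp Require Import all_boot all_order all_algebra.
From mathcomp Require Import all_classical all_reals all_analysis.
From mathcomp Require Import ring lra zify.
Set Implicit Arguments. Unset Strict Implicit. Unset Printing Implicit Defensive.
Import Order.TTheory GRing.Theory Num.Theory.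
Import numFieldNormedType.Exports.
Local Open Scope classical_set_scope.
Local Open Scope ring_scope.

(** * The spectral theorem *)

(** The gradient hypothesis degenerates at the origin, and for negative [s] the right hand side
    blows up there as [delta] tends to 0, so continuity at the origin uniformly in [delta] must come
    from the equation itself. That equation has no ellipticity constants: [D^2 u] is only known to
    lie in the closed cone, and the available tool is the monotonicity of [S_k] on it. The
    reflection is chosen because it moves every test direction by a multiple of [x - y]: along such
    lines [|x - y|] is affine, so the norm contributes no second derivative and [B |x-y|^2]
    contributes a pure square. The penalty [c |y|^2], needed to localise the maximum, costs [2 c]
    times the identity, which a point of the closed cone cannot absorb in general. Negative
    curvature [- 2 B] along [x - y] pays for it, provided [B] is [c] divided by a small dimensional
    constant. The Hessian of the barrier has the form [q (1 - th y^T y)] with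
    [th |y|^2 <= 2 (1 - b)]. Its rank one part removes at most the share [th |y|^2 k / n] of [S_k];
    comparing [2 (1 - b) k] with [n] is what separates the two regimes. *)

Definition dot (R : pzRingType) (n : nat) (x y : 'rV[R]_n) : R := \sum_i x 0 i * y 0 i.

Section Dot.
Context (R : realType) (n : nat).
Implicit Types x y z : 'rV[R]_n.

Lemma dotE x y : (x *m y^T) 0 0 = dot x y.
Proof. by rewrite mxE; apply: eq_bigr => i _; rewrite mxE. Qed.

Lemma mulmx_tr x y : x *m y^T = (dot x y)%:M.
Proof. by rewrite [LHS]mx11_scalar dotE. Qed.

Lemma dotC x y : dot x y = dot y x.
Proof. by apply: eq_bigr => i _; rewrite mulrC. Qed.

Lemma dotDl x y z : dot (x + y) z = dot x z + dot y z.
Proof. by rewrite -big_split; apply: eq_bigr => i _; rewrite !mxE mulrDl. Qed.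

Lemma dotDr x y z : dot x (y + z) = dot x y + dot x z.
Proof. by rewrite dotC dotDl !(dotC x). Qed.

Lemma dotZl a x y : dot (a *: x) y = a * dot x y.
Proof. by rewrite /dot mulr_sumr; apply: eq_bigr => i _; rewrite !mxE mulrA. Qed.

Lemma dotZr a x y : dot x (a *: y) = a * dot x y.
Proof. by rewrite dotC dotZl dotC. Qed.

Lemma dotNl x y : dot (- x) y = - dot x y.
Proof. by rewrite -scaleN1r dotZl mulN1r. Qed.

Lemma dotNr x y : dot x (- y) = - dot x y.
Proof. by rewrite dotC dotNl dotC. Qed.

Lemma dotBl x y z : dot (x - y) z = dot x z - dot y z.
Proof. by rewrite dotDl dotNl. Qed.

Lemma dotBr x y z : dot x (y - z) = dot x y - dot x z.
Proof. by rewrite dotDr dotNr. Qed.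

Lemma dot0r x : dot x 0 = 0.
Proof. by rewrite /dot big1 // => i _; rewrite mxE mulr0. Qed.

Lemma dot_ge0 x : 0 <= dot x x.
Proof. by apply: sumr_ge0 => i _; rewrite -expr2 sqr_ge0. Qed.

Lemma dot_eq0 x : dot x x = 0 -> x = 0.
Proof.
move=> /eqP; rewrite psumr_eq0 => [/allP h|i _]; last by rewrite -expr2 sqr_ge0.
apply/rowP => i; rewrite mxE.
by have := h i (mem_index_enum i); rewrite mulf_eq0 orbb => /eqP.
Qed.

Lemma dot_gt0 x : x != 0 -> 0 < dot x x.
Proof. by move=> x0; rewrite lt0r dot_ge0 andbT; apply: contra x0 => /eqP/dot_eq0->. Qed.

End Dot.

Section Rayleigh.
Context (R : realType).

Lemma continuous_sumM (T : topologicalType) n (f g : 'I_n -> T -> R) :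
  (forall i, continuous (f i)) -> (forall i, continuous (g i)) ->
  continuous (fun x => \sum_i f i x * g i x).
Proof.
move=> cf cg; apply: continuous_big => [|i _ x]; first exact: add_continuous.
by apply: cvgM; [exact: cf|exact: cg].
Qed.

Lemma dot_continuous n : continuous (fun x : 'rV[R]_n => dot x x).
Proof.
by apply: (@continuous_sumM _ _ (fun i (x : 'rV_n) => x 0 i) (fun i (x : 'rV_n) => x 0 i)) => i;
  exact: coord_continuous.
Qed.

Lemma quad_continuous n (A : 'M[R]_n) : continuous (fun x : 'rV[R]_n => dot (x *m A) x).
Proof.
have cA i : continuous (fun x : 'rV[R]_n => \sum_j x 0 j * A j i).
  apply: (@continuous_sumM _ _ (fun j (x : 'rV[R]_n) => x 0 j) (fun j _ => A j i)) => j.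
    exact: (@coord_continuous R 1 n 0 j).
  exact: cst_continuous.
rewrite (_ : (fun _ => _) = fun x : 'rV[R]_n => \sum_i (\sum_j x 0 j * A j i) * x 0 i).
  apply: (@continuous_sumM _ _ (fun i (x : 'rV[R]_n) => \sum_j x 0 j * A j i)
    (fun i (x : 'rV[R]_n) => x 0 i)) => i; [exact: cA|exact: (@coord_continuous R 1 n 0 i)].
by apply/funext => x; apply: eq_bigr => i _; rewrite mxE.
Qed.

Lemma coord_le_dot n (x : 'rV[R]_n) i : x 0 i ^+ 2 <= dot x x.
Proof.
rewrite /dot (bigD1 i) //= -expr2 lerDl; apply: sumr_ge0 => j _.
by rewrite -expr2 sqr_ge0.
Qed.

Lemma compact_dot_le n (r : R) : compact [set x : 'rV[R]_n | dot x x <= r].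
Proof.
apply: bounded_closed_compact.
  exists (r + 1); split; first exact: num_real.
  move=> M rM x /= xr; have r0 : 0 <= r by exact: le_trans (dot_ge0 x) xr.
  rewrite /Num.norm /= mx_normrE; apply: bigmax_le => [|[i j] _ /=]; first lra.
  rewrite ord1; have := coord_le_dot x j.
  rewrite ler_norml => h; nra.
apply: (preimage_closed (f := fun x : 'rV[R]_n => dot x x) (D := [set y | y <= r])).
  by move=> x _; exact: dot_continuous.
exact: closed_le.
Qed.

(** Expanding the form at [v + t *: w] with [w = v *m B] leaves [2 t |w|^2 + t^2 <w B, w>], negative
    for small negative [t] unless [w = 0]. The value [- |w|^2 / (<w B, w> + 1)] of [t] avoids
    dividing by zero. *)
Lemma psd_ker n (B : 'M[R]_n) (v : 'rV[R]_n) : B^T = B ->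
  (forall x, 0 <= dot (x *m B) x) -> dot (v *m B) v = 0 -> v *m B = 0.
Proof.
move=> symB B0 vBv; apply: dot_eq0.
set w := v *m B; have H t : 0 <= 2 * t * dot w w + t ^+ 2 * dot (w *m B) w.
  have := B0 (v + t *: w).
  rewrite mulmxDl -scalemxAl !dotDl !dotDr !dotZl !dotZr vBv -/w.
  have -> : dot (w *m B) v = dot w w.
    by rewrite -dotE -mulmxA -{1}symB -trmx_mul dotE.
  by move=> h; rewrite (_ : _ + _ = 0 + t * dot w w + (t * dot w w + t * (t * dot (w *m B) w))) //; ring.
have b0 := B0 w; have := dot_ge0 w; set d := dot w w in H *; set b := dot _ _ in H b0 => d0.
have b1 : 0 < b + 1 by lra.
have /= := H (- d / (b + 1)).
have -> : 2 * (- d / (b + 1)) * d + (- d / (b + 1)) ^+ 2 * b = - d ^+ 2 * (b + 2) / (b + 1) ^+ 2.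
  by field; rewrite gt_eqF.
rewrite pmulr_lge0 ?invr_gt0 ?exprn_gt0 //; nra.
Qed.

(** If [c] maximises the quadratic form on the unit sphere with value [a], then [a%:M - A] is
    positive semidefinite and its form vanishes at [c], so [psd_ker] makes [c] an eigenvector
    without any differentiation. *)
Lemma rayleigh n (A : 'M[R]_n.+1) : A^T = A ->
  exists (v : 'rV[R]_n.+1) (a : R), dot v v = 1 /\ v *m A = a *: v.
Proof.
move=> symA.
have [|||c /set_mem c1 cmax] := @EVT_max_rV R _ (fun x => dot (x *m A) x) [set x | dot x x = 1].
- exists (delta_mx 0 0); rewrite /= /dot (bigD1 0) //= mxE !eqxx mulr1 big1 ?addr0 // => i i0.
  by rewrite mxE (negbTE i0) andbF mulr0.
- apply: (subclosed_compact _ (@compact_dot_le n.+1 1)); last by move=> x /= ->.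
  apply: (preimage_closed (f := fun x : 'rV[R]_n.+1 => dot x x) (D := [set y | y = 1])).
    by move=> x _; exact: dot_continuous.
  exact: closed_eq.
- by apply: continuous_subspaceT; exact: quad_continuous.
rewrite /= in c1; exists c; exists (dot (c *m A) c); split => //.
set a := dot _ _; apply/eqP; rewrite eq_sym -subr_eq0 -mul_mx_scalar -mulmxBr; apply/eqP.
have quadE x : dot (x *m (a%:M - A)) x = a * dot x x - dot (x *m A) x.
  by rewrite mulmxBr mul_mx_scalar dotBl dotZl.
apply: psd_ker; first by rewrite linearB /= tr_scalar_mx symA.
- move=> x; rewrite quadE; have [->|x0] := eqVneq x 0; first by rewrite !dot0r mulr0 subr0.
  have d0 := dot_gt0 x0; set d := dot x x in d0 *.
  pose t := (Num.sqrt d)^-1; have tt : t * t = d^-1.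
    by rewrite -invfM -expr2 sqr_sqrtr // ltW.
  have : dot (t *: x) (t *: x) = 1 by rewrite dotZl dotZr mulrA tt mulVf ?gt_eqF.
  move=> /mem_set/(cmax (t *: x)); rewrite -scalemxAl dotZl dotZr mulrA tt -/a.
  by rewrite mulrC ler_pdivrMr // subr_ge0.
- by rewrite quadE c1 mulr1 subrr.
Qed.

(** [Q] is the Householder reflection exchanging [v] and the first basis vector; it degenerates when
    the two coincide, hence the case distinction. *)
Lemma orth_complete n (v : 'rV[R]_(1 + n)) : dot v v = 1 ->
  exists Q : 'M[R]_(1 + n), Q *m Q^T = 1%:M /\ row 0 Q = v.
Proof.
move=> v1; pose e0 : 'rV[R]_(1 + n) := delta_mx 0 0.
have e01 : dot e0 e0 = 1.
  rewrite /dot (bigD1 0) //= mxE !eqxx mulr1 big1 ?addr0 // => i i0.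
  by rewrite mxE (negbTE i0) andbF mulr0.
have [->|ve] := eqVneq v e0; first by exists 1%:M; rewrite trmx1 mulmx1 row1.
pose w := v - e0; have d0 : 0 < dot w w by apply: dot_gt0; rewrite subr_eq0.
pose c := 2 / dot w w; exists (1%:M - c *: (w^T *m w)).
have symQ : (1%:M - c *: (w^T *m w))^T = 1%:M - c *: (w^T *m w).
  by rewrite linearB /= trmx1 linearZ /= trmx_mul trmxK.
split.
  rewrite symQ; set W := w^T *m w.
  have WW : W *m W = dot w w *: W.
    by rewrite /W -mulmxA [w *m (_ *m _)]mulmxA mulmx_tr mul_scalar_mx -scalemxAr.
  rewrite mulmxBl mul1mx mulmxBr mulmx1 -!scalemxAl -!scalemxAr WW !scalerA.
  have -> : c * c * dot w w = c + c by rewrite /c; field; rewrite gt_eqF.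
  by rewrite scalerDl opprB addrK subrK.
rewrite rowE mulmxBr mulmx1 -scalemxAr mulmxA mulmx_tr mul_scalar_mx scalerA -/e0.
suff -> : c * dot e0 w = - 1 by rewrite scaleN1r opprK /w addrC subrK.
have dww : dot w w = 2 - 2 * dot e0 v.
  by rewrite /w dotBl !dotBr v1 e01 (dotC v e0); ring.
rewrite /c dww dotBr e01; field; rewrite -dww gt_eqF //.
Qed.

Lemma spectral n (A : 'M[R]_n) : A^T = A -> exists lam, eigs_spec A lam.
Proof.
elim: n A => [|n IH] A symA.
  by exists 0; exists 1%:M; split; [rewrite trmx1 mulmx1|apply/matrixP; case].
have [v [a [v1 va]]] := rayleigh symA.
have [Q [QQ Qv]] := @orth_complete n v v1.
have QtQ : Q^T *m Q = 1%:M by apply: mulmx1C.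
pose A' : 'M[R]_(1 + n) := Q *m A *m Q^T.
have symA' : A'^T = A' by rewrite /A' !trmx_mul trmxK symA mulmxA.
have row0 j : A' 0 j = a *+ (j == 0).
  have : row 0 A' = a *: delta_mx 0 0.
    rewrite /A' -mulmxA row_mul Qv mulmxA va -scalemxAl -Qv -row_mul QQ row1 //.
  by move/rowP/(_ j); rewrite !mxE eqxx /= => ->; rewrite mulr_natr.
have symd : (drsubmx A')^T = drsubmx A' by rewrite trmx_drsub symA'.
have [lam [P [PP PA]]] := IH _ symd.
pose Z : 'M[R]_(1 + n) := block_mx 1%:M 0 0 P.
have ZZ : Z *m Z^T = 1%:M.
  rewrite /Z tr_block_mx !trmx0 trmx1 mulmx_block.
  by rewrite !(mulmx0, mul0mx, mulmx1, addr0, add0r) PP -scalar_mx_block.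
exists (row_mx a%:M lam : 'rV_(1 + n)); exists (Z *m Q); split.
  by rewrite trmx_mul mulmxA -(mulmxA Z) QQ mulmx1 ZZ.
have -> : A = Q^T *m A' *m Q.
  by rewrite /A' !mulmxA QtQ mul1mx -mulmxA QtQ mulmx1.
suff {1}-> : A' = Z^T *m diag_mx (row_mx a%:M lam : 'rV_(1 + n)) *m Z by rewrite trmx_mul !mulmxA.
clearbody A'.
rewrite /Z diag_mx_row tr_block_mx !trmx0 trmx1 -[LHS](@submxK _ 1 n 1 n).
have -> : ulsubmx A' = a%:M.
  by apply/matrixP => i j; rewrite !ord1 !mxE lshift0 row0 eqxx.
have -> : ursubmx A' = 0.
  by apply/matrixP => i j; rewrite !ord1 !mxE lshift0 row0; case: eqP.
have -> : dlsubmx A' = 0.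
  apply/matrixP => i j; rewrite !ord1 !mxE lshift0 -symA' mxE row0; by case: eqP.
have -> : diag_mx (a%:M : 'rV_1) = a%:M by apply/matrixP=> i j; rewrite !mxE !ord1 eqxx.
by rewrite !mulmx_block !(mulmx0, mul0mx, mulmx1, mul1mx, addr0, add0r) -PA.
Qed.

End Rayleigh.

(** * Elementary symmetric functions and Newton's inequalities *)

Section RankOne.
Context (T : comNzRingType).

(** Linearity in row 0, which is [d0] times the first basis vector plus [c * u0] times [u]: the
    first part ([B]) gives the induction step, the second ([C]) becomes triangular once multiples of
    its row 0 are removed from the others. No division occurs, so the entries may be polynomials. *)
Lemma det_diag_rank1 n (d u : 'rV[T]_n) (c : T) :
  \det (diag_mx d + c *: (u^T *m u)) =
  \prod_i d 0 i + c * \sum_i u 0 i ^+ 2 * \prod_(j | j != i) d 0 j.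
Proof.
elim: n d u => [|n IH] d u; first by rewrite det_mx00 !big_ord0 mulr0 addr0.
pose u0 := u 0 0; pose d0 := d 0 0.
pose u' : 'rV_n := \row_i u 0 (lift 0 i); pose d' : 'rV_n := \row_i d 0 (lift 0 i).
set M := _ + _; pose E := diag_mx d' + c *: (u'^T *m u').
pose V : 'M[T]_(n, 1) := (c * u0) *: u'^T.
pose B : 'M[T]_(1 + n) := block_mx 1%:M 0 V E.
pose C : 'M[T]_(1 + n) := block_mx u0%:M u' V E.
have lE (i : 'I_n) : lift 0 i = rshift 1 i :> 'I_(1 + n) by apply: val_inj.
have l0 : (0 : 'I_(1 + n)) = lshift n (0 : 'I_1) by apply: val_inj.
have ME (i j : 'I_n.+1) : M i j = d 0 i *+ (i == j) + c * (u 0 i * u 0 j).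
  by rewrite !mxE big_ord_recl big_ord0 addr0 !mxE.
have EE (i j : 'I_n) : E i j = d 0 (lift 0 i) *+ (i == j) + c * (u 0 (lift 0 i) * u 0 (lift 0 j)).
  by rewrite !mxE big_ord_recl big_ord0 addr0 !mxE.
have row'E (X : 'M[T]_(1 + n)) (a : 'M[T]_1) (b : 'rV[T]_n) : X = block_mx a b V E ->
    row' 0 X = row' 0 M.
  move=> ->; apply/matrixP => i j; rewrite ![row' _ _ _ _]mxE ME.
  case: (unliftP 0 j) => [k ->|->].
    by rewrite 2!lE (block_mxEdr a b V E) EE -2!lE (inj_eq lift_inj).
  rewrite lE {1}l0 (block_mxEdl a b V E) -lE eq_sym (negbTE (neq_lift _ _)) mulr0n add0r !mxE.
  by rewrite mulrAC mulrA.
have rowlin (X Y Z : 'M[T]_n.+1) (b f : T) : (forall j, X 0 j = b * Y 0 j + f * Z 0 j) ->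
    row 0 X = b *: row 0 Y + f *: row 0 Z.
  by move=> h; apply/rowP => j; rewrite !mxE.
rewrite (@determinant_multilinear _ _ M B C 0 d0 (c * u0)); first last.
- by apply: row'E; reflexivity.
- by apply: row'E; reflexivity.
- apply: rowlin => j; rewrite ME; case: (unliftP 0 j) => [k ->|->].
    rewrite (negbTE (neq_lift _ _)) mulr0n add0r [in RHS]lE [in B _ _]l0 [in C _ _]l0.
    by rewrite (block_mxEur _ _ V E) (block_mxEur _ _ V E) !mxE mulr0 add0r mulrA.
  rewrite eqxx [in B _ _]l0 [in C _ _]l0.
  by rewrite (block_mxEul _ _ V E) (block_mxEul _ _ V E) !mxE mulr1 mulrA.
have -> : \det B = \det E by rewrite /B det_lblock det1 mul1r.
have -> : \det C = u0 * \prod_i d' 0 i.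
  have -> : C = block_mx 1%:M 0 (c *: u'^T) 1%:M *m block_mx u0%:M u' 0 (diag_mx d').
    rewrite mulmx_block !mul1mx !mul0mx !addr0 mul_mx_scalar scalerA.
    by rewrite -scalemxAl mulrC addrC.
  by rewrite det_mulmx det_lblock det_ublock !det1 det_scalar1 det_diag !mul1r.
have p0 : \prod_(j < n.+1 | j != ord0) d 0 j = \prod_j d' 0 j.
  by rewrite big_mkcond big_ord_recl /= mul1r; apply: eq_bigr => i _; rewrite mxE.
have pl i : \prod_(j < n.+1 | j != lift ord0 i) d 0 j = d0 * \prod_(j | j != i) d' 0 j.
  rewrite [LHS]big_mkcond big_ord_recl /= [in RHS]big_mkcond.
  by congr (_ * _); apply: eq_bigr => k _; rewrite (inj_eq lift_inj) mxE.
rewrite IH !big_ord_recl p0.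
have -> : \prod_(i < n) d 0 (lift ord0 i) = \prod_j d' 0 j.
  by apply: eq_bigr => i _; rewrite mxE.
have -> : \sum_(i < n) u 0 (lift ord0 i) ^+ 2 * \prod_(j | j != lift ord0 i) d 0 j =
          d0 * \sum_i u' 0 i ^+ 2 * \prod_(j | j != i) d' 0 j.
  by rewrite mulr_sumr; apply: eq_bigr => i _; rewrite [u' _ _]mxE pl mulrCA.
rewrite -[d 0 ord0]/d0 -[u 0 ord0]/u0; ring.
Qed.

End RankOne.

(** * Elementary symmetric functions as coefficients, and [S_j] of a matrix *)

Section Esym.
Context (R : realType).
Implicit Types (s : seq R) (x q : R).

(** Sequences rather than row vectors, so that deleting or adding an eigenvalue does not change the
    type. *)
Definition epol s : {poly R} := \prod_(x <- s) (1 + x *: 'X).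
Definition elsym s (j : nat) : R := (epol s)`_j.

Lemma epol_cons x s : epol (x :: s) = (1 + x *: 'X) * epol s.
Proof. by rewrite /epol big_cons. Qed.

Lemma elsym0 s : elsym s 0 = 1.
Proof.
elim: s => [|x s IH]; first by rewrite /elsym /epol big_nil coef1.
rewrite /elsym epol_cons mulrDl mul1r -scalerAl coefD coefZ coefXM eqxx mulr0 addr0.
exact: IH.
Qed.

Lemma elsym_cons x s j : elsym (x :: s) j.+1 = elsym s j.+1 + x * elsym s j.
Proof.
by rewrite /elsym epol_cons mulrDl mul1r -scalerAl coefD coefZ coefXM.
Qed.

Lemma perm_elsym s1 s2 : perm_eq s1 s2 -> elsym s1 =1 elsym s2.
Proof. by move=> p j; rewrite /elsym /epol (perm_big _ p). Qed.

Lemma elsym_gt s j : (size s < j)%N -> elsym s j = 0.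
Proof.
elim: s j => [|x s IH] [|j] //=.
  by rewrite /elsym /epol big_nil coef1.
by rewrite ltnS => sj; rewrite elsym_cons !IH ?mulr0 ?addr0 // ltnW.
Qed.

Definition coords n (l : 'rV[R]_n) : seq R := [seq l 0 i | i <- enum 'I_n].
Definition coords' n (l : 'rV[R]_n) (i : 'I_n) : seq R :=
  [seq l 0 j | j <- enum 'I_n & j != i].

Lemma size_coords n (l : 'rV[R]_n) : size (coords l) = n.
Proof. by rewrite size_map size_enum_ord. Qed.

Lemma epol_coords n (l : 'rV[R]_n) : epol (coords l) = \prod_i (1 + l 0 i *: 'X).
Proof. by rewrite /epol big_map big_enum. Qed.

Lemma epol_coords' n (l : 'rV[R]_n) i :
  epol (coords' l i) = \prod_(j | j != i) (1 + l 0 j *: 'X).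
Proof. by rewrite /epol big_map big_filter big_enum_cond /=. Qed.

Lemma perm_coords n (l : 'rV[R]_n) i : perm_eq (coords l) (l 0 i :: coords' l i).
Proof.
rewrite /coords /coords' -(map_cons (fun i => l 0 i)); apply: perm_map.
rewrite -rem_filter ?enum_uniq // perm_sym.
by rewrite perm_sym perm_to_rem // mem_enum.
Qed.

Lemma size_coords' n (l : 'rV[R]_n) i : size (coords' l i) = n.-1.
Proof. by have := perm_size (perm_coords l i); rewrite size_coords => {2}->. Qed.

Lemma elsym_coords n (l : 'rV[R]_n) i j :
  elsym (coords l) j.+1 = elsym (coords' l i) j.+1 + l 0 i * elsym (coords' l i) j.
Proof. by rewrite (perm_elsym (perm_coords l i)) elsym_cons. Qed.

Lemma sigma_elsym n k (l : 'rV[R]_n) : sigma k l = elsym (coords l) k.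
Proof.
rewrite /elsym epol_coords.
under eq_bigr => i _ do rewrite addrC.
rewrite bigA_distr coef_sum /sigma [RHS](bigID (fun J : {set 'I_n} => #|J| == k)) /=.
have cE (J : {set 'I_n}) : (\prod_i (if i \in J then l 0 i *: 'X else 1))`_k =
    (\prod_(i in J) l 0 i) *+ (k == #|J|) :> R.
  rewrite -big_mkcond /= -[\prod_(i in J) _]mul1r.
  have -> : \prod_(i in J) (l 0 i *: 'X) = (\prod_(i in J) l 0 i) *: 'X^#|J| :> {poly R}.
    by rewrite scaler_prod prodr_const.
  by rewrite mul1r coefZ coefXn mulr_natr.
rewrite [X in _ = _ + X]big1 ?addr0; last first.
  move=> J kJ; by rewrite cE eq_sym (negbTE kJ).
by apply: eq_bigr => J /eqP kJ; rewrite cE kJ eqxx.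
Qed.

(* [S_j A] read off the characteristic polynomial, so that no choice of eigenvalues is involved. *)
Definition Smx n (j : nat) (A : 'M[R]_n) : R :=
  (\det (1%:M + 'X *: map_mx polyC A))`_j.

Lemma det_conj n (P A : 'M[R]_n) : P *m P^T = 1%:M ->
  \det (1%:M + 'X *: map_mx polyC (P^T *m A *m P)) = \det (1%:M + 'X *: map_mx polyC A).
Proof.
move=> PP; have PtP := mulmx1C PP.
have PtP' : map_mx polyC P^T *m map_mx polyC P = 1%:M by rewrite -map_mxM PtP map_mx1.
have -> : 1%:M + 'X *: map_mx polyC (P^T *m A *m P) =
    map_mx polyC P^T *m (1%:M + 'X *: map_mx polyC A) *m map_mx polyC P.
  by rewrite mulmxDr mulmxDl mulmx1 PtP' -scalemxAr -scalemxAl !map_mxM.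
by rewrite !det_mulmx mulrAC -det_mulmx PtP' det1 mul1r.
Qed.

(** Each [S_j] is affine along a rank one direction, and the slope of [S_(j+1)] is a weighted sum of
    the functions of degree [j] that omit one eigenvalue. The cone estimates for matrices are read
    off this identity. *)
Lemma det_diag_rank1_X n (l w : 'rV[R]_n) c :
  \det (1%:M + 'X *: map_mx polyC (diag_mx l + c *: (w^T *m w))) =
  epol (coords l) + c *: ('X * \sum_i w 0 i ^+ 2 *: epol (coords' l i)).
Proof.
pose d : 'rV[{poly R}]_n := \row_i (1 + l 0 i *: 'X).
have -> : 1%:M + 'X *: map_mx polyC (diag_mx l + c *: (w^T *m w)) =
    diag_mx d + (c *: 'X) *: ((map_mx polyC w)^T *m map_mx polyC w).
  apply/matrixP => i j; rewrite !mxE !big_ord_recl !big_ord0 !mxE !addr0.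
  rewrite rmorphD /= !rmorphM /= mulrDr addrA -[c *: _]mul_polyC; congr (_ + _).
    case: eqP => _; rewrite ?mulr1n ?mulr0n ?mulr0 ?addr0 //.
    by rewrite -[l 0 i *: _]mul_polyC mulrC.
  by rewrite mulrCA mulrA.
rewrite det_diag_rank1 epol_coords; congr (_ + _).
  by apply: eq_bigr => i _; rewrite mxE.
rewrite -scalerAl; congr (_ *: (_ * _)); apply: eq_bigr => i _.
rewrite epol_coords' mxE -mul_polyC rmorphXn; congr (_ * _).
by apply: eq_bigr => j _; rewrite mxE.
Qed.

Lemma Smx_eigs n (A : 'M[R]_n) lam j : eigs_spec A lam -> Smx j A = elsym (coords lam) j.
Proof.
move=> [P [PP ->]]; rewrite /Smx det_conj //.
have := det_diag_rank1_X lam 0 0; rewrite !scale0r !addr0 => ->.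
by [].
Qed.

Lemma Smx_rank1 n (P : 'M[R]_n) (lam v : 'rV[R]_n) c j : P *m P^T = 1%:M ->
  let w := v *m P^T in
  Smx j.+1 (P^T *m diag_mx lam *m P + c *: (v^T *m v)) =
  elsym (coords lam) j.+1 + c * \sum_i w 0 i ^+ 2 * elsym (coords' lam i) j.
Proof.
move=> PP w; have wP : w *m P = v by rewrite /w -mulmxA (mulmx1C PP) mulmx1.
have -> : P^T *m diag_mx lam *m P + c *: (v^T *m v) =
   P^T *m (diag_mx lam + c *: (w^T *m w)) *m P.
  rewrite mulmxDr mulmxDl -scalemxAr -scalemxAl -{1 2}wP trmx_mul !mulmxA //.
rewrite /Smx det_conj // det_diag_rank1_X coefD coefZ coefXM /= coef_sum.
congr (_ + _ * _); apply: eq_bigr => i _; by rewrite coefZ.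
Qed.

End Esym.

(** * Newton's inequalities *)

Section Newton.
Context (R : realType).
Implicit Types (s : seq R) (x q : R).

Lemma coords_nth s : coords (\row_(i < size s) s`_i) = s.
Proof.
rewrite /coords; apply: (@eq_from_nth _ 0) => [|i]; rewrite size_map size_enum_ord // => si.
by rewrite (nth_map (Ordinal si)) ?size_enum_ord // mxE nth_enum_ord.
Qed.

Lemma deriv_prod_seq (I : eqType) (r : seq I) (F : I -> {poly R}) : uniq r ->
  (\prod_(i <- r) F i)^`() = \sum_(i <- r) (F i)^`() * \prod_(j <- r | j != i) F j.
Proof.
elim: r => [|a r IH] /=; first by rewrite !big_nil derivC.
move=> /andP[ar ur]; rewrite !big_cons derivM IH // eqxx /=; congr (_ + _).
  congr (_ * _); rewrite [RHS]big_seq_cond [LHS]big_seq_cond; apply: eq_bigl => j.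
  by have [jr|//] := boolP (j \in r); rewrite /= (memPn ar).
rewrite mulr_sumr [LHS]big_seq_cond [RHS]big_seq_cond; apply: eq_bigr => j /andP[jr _].
by rewrite big_cons eq_sym (memPn ar) // mulrCA.
Qed.

(** The derivative of [epol] gives Euler's identity [key]; subtracting it from [n] copies of
    [elsym (coords l) j.+1] gives the claim. *)
Lemma sum_elsym_coords' n (l : 'rV[R]_n) j :
  \sum_i elsym (coords' l i) j = (n%:R - j%:R) * elsym (coords l) j.
Proof.
case: j => [|j].
  rewrite subr0 elsym0 mulr1 -[RHS]mulr_natl mulr1 -[in RHS](card_ord n) -sumr_const.
  by apply: eq_bigr => i _; rewrite elsym0.
have key : \sum_i l 0 i * elsym (coords' l i) j = j.+1%:R * elsym (coords l) j.+1.
  have := coef_deriv (epol (coords l)) j.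
  rewrite mulr_natl -/(elsym _ _) => <-.
  rewrite epol_coords (deriv_prod_seq _ (index_enum_uniq _)) coef_sum.
  apply: eq_bigr => i _; rewrite derivD derivZ derivX derivC add0r -scalerAl mul1r coefZ.
  by rewrite /elsym epol_coords'.
rewrite mulrBl -key -[n in n%:R](card_ord n) mulr_natl -sumr_const -sumrB.
by apply: eq_bigr => i _; rewrite (elsym_coords l i) addrK.
Qed.

(** The update touches row 0 only, where it adds ['X] times the first basis vector; by linearity in
    that row the extra term is the minor of the lower right block. *)
Lemma det_add_corner n (B : 'M[R]_(1 + n)) (e0 := delta_mx 0 0 : 'rV[R]_(1 + n)) :
  \det (1%:M + 'X *: map_mx polyC (B + e0^T *m e0)) =
  \det (1%:M + 'X *: map_mx polyC B) +
  'X * \det (1%:M + 'X *: map_mx polyC (drsubmx B)).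
Proof.
set M := 1%:M + _; set M0 := 1%:M + 'X *: map_mx polyC B.
pose D : 'M[{poly R}]_(1 + n) := block_mx 1%:M 0 ('X *: map_mx polyC (dlsubmx B))
  (1%:M + 'X *: map_mx polyC (drsubmx B)).
have ME i k : M i k = M0 i k + 'X * ((i == 0)%:R * (k == 0)%:R).
  rewrite !mxE big_ord_recl big_ord0 addr0 !mxE eqxx /= rmorphD mulrDr addrA.
  by rewrite rmorphM !rmorph_nat.
have DE (i : 'I_n) k : D (rshift 1 i) k = M0 (rshift 1 i) k.
  case: (split_ordP k) => a ->.
    by rewrite block_mxEdl !mxE eq_rlshift add0r.
  by rewrite block_mxEdr !mxE eq_rshift.
have D0 k : D 0 k = (k == 0)%:R.
  have -> : (0 : 'I_(1 + n)) = lshift n (0 : 'I_1) by apply: val_inj.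
  case: (split_ordP k) => a ->.
    by rewrite block_mxEul !mxE eq_lshift eq_sym.
  by rewrite block_mxEur !mxE eq_rlshift.
rewrite (@determinant_multilinear _ _ M M0 D 0 1 'X).
- by rewrite mul1r /D det_lblock det1 mul1r.
- have rowlin (X Y Z : 'M[{poly R}]_(1 + n)) (b f : {poly R}) :
      (forall j, X 0 j = b * Y 0 j + f * Z 0 j) -> row 0 X = b *: row 0 Y + f *: row 0 Z.
    by move=> h; apply/rowP => j; rewrite !mxE.
  by apply: rowlin => k; rewrite ME D0 eqxx !mul1r.
- apply/matrixP => i k; rewrite ![row' _ _ _ _]mxE ME.
  by rewrite eq_sym (negbTE (neq_lift _ _)) mul0r mulr0 addr0.
- apply/matrixP => i k; rewrite ![row' _ _ _ _]mxE ME.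
  have -> : lift 0 i = rshift 1 i :> 'I_(1 + n) by apply: val_inj.
  by rewrite DE mul0r mulr0 addr0.
Qed.

(** [s'] consists of the negated roots of the derivative of the product of the [t + x], [x] in [s].
    In place of Rolle's theorem with multiplicities, it is obtained as the spectrum of a
    compression: the diagonal matrix of [s] is restricted to the hyperplane orthogonal to the unit
    vector [v] with equal entries, and [S_j] of that restriction is the mean of [elsym] over all
    deletions of one entry. *)
Lemma derivative_real_rooted s : (0 < size s)%N ->
  exists s', size s' = (size s).-1 /\
    forall j, (size s)%:R * elsym s' j = ((size s)%:R - j%:R) * elsym s j.
Proof.
case sz: (size s) => [//|n] _; rewrite succnK.
have [l lE] : exists l : 'rV[R]_n.+1, s = coords l.
  by rewrite -sz; exists (\row_(i < size s) s`_i); rewrite coords_nth.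
pose a : R := (Num.sqrt n.+1%:R)^-1.
have aa : a * a = n.+1%:R^-1 by rewrite -invfM -expr2 sqr_sqrtr // ler0n.
pose v : 'rV[R]_(1 + n) := const_mx a.
have v1 : dot v v = 1.
  rewrite /dot (eq_bigr (fun=> n.+1%:R^-1)) => [|i _]; last by rewrite mxE aa.
  by rewrite sumr_const card_ord -[LHS]mulr_natl divff // pnatr_eq0.
have [Q [QQ Qv]] := orth_complete v1.
pose B : 'M[R]_(1 + n) := Q *m diag_mx l *m Q^T.
have symB : B^T = B by rewrite /B !trmx_mul trmxK tr_diag_mx mulmxA.
pose C := drsubmx B.
have [mu muC] : exists mu, eigs_spec C mu.
  by apply: spectral; rewrite /C trmx_drsub symB.
exists (coords mu); split; first by rewrite size_coords.
pose e0 : 'rV[R]_(1 + n) := delta_mx 0 0.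
have e0v : e0 *m Q = v by rewrite -Qv rowE.
move=> j.
have H1 := det_diag_rank1_X l v 1.
have detC : \det (1%:M + 'X *: map_mx polyC (B + e0^T *m e0)) =
  \det (1%:M + 'X *: map_mx polyC B) + 'X * \det (1%:M + 'X *: map_mx polyC C).
  exact: det_add_corner.
have QtQ := mulmx1C QQ.
have dB : \det (1%:M + 'X *: map_mx polyC B) = epol (coords l).
  have := @det_conj _ _ Q^T (diag_mx l); rewrite trmxK => -> //.
  by have := det_diag_rank1_X l 0 0; rewrite !scale0r !addr0.
have dBv : \det (1%:M + 'X *: map_mx polyC (B + e0^T *m e0)) =
    \det (1%:M + 'X *: map_mx polyC (diag_mx l + 1 *: (v^T *m v))).
  have <- : Q *m (diag_mx l + 1 *: (v^T *m v)) *m Q^T = B + e0^T *m e0.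
    rewrite scale1r mulmxDr mulmxDl -e0v trmx_mul !mulmxA QQ mul1mx.
    by rewrite -[_ *m Q *m Q^T]mulmxA QQ mulmx1.
  by have := @det_conj _ _ Q^T (diag_mx l + 1 *: (v^T *m v)); rewrite trmxK => ->.
(* The same determinant has been computed by the corner formula and by the rank one formula in the
   eigenbasis of [B]; the common term and then a factor ['X] cancel. *)
move: detC; rewrite dBv H1 dB scale1r => /addrI /(mulfI _) => /(_ (negbT (polyX_eq0 _))).
move=> /(congr1 (fun p : {poly R} => p`_j)); rewrite -[RHS]/(Smx j C) (Smx_eigs j muC) => <-.
rewrite coef_sum mulr_sumr lE -sum_elsym_coords'; apply: eq_bigr => i _.
by rewrite coefZ mxE expr2 aa mulrA divff ?mul1r // pnatr_eq0.
Qed.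

(** For nonzero entries this is the Cauchy-Schwarz inequality for their reciprocals. Entries may
    vanish here, so one is added at a time, and the cross term is absorbed by the square of
    [(m + 1 + 1) * a - x * b]. *)
Lemma newton_top s n : size s = n.+2 ->
  2 * n.+2%:R * (elsym s n.+2 * elsym s n) <= n.+1%:R * elsym s n.+1 ^+ 2.
Proof.
elim: s n => [//|x s IH] [|n] /= [sz].
  move: sz; case: s IH => [//|y [|//]] _ _.
  have nil1 j : elsym (Nil R) j.+1 = 0 by rewrite elsym_gt.
  have := sqr_ge0 (x - y); rewrite !elsym_cons !elsym0 !nil1; nra.
have top : elsym s n.+3 = 0 by rewrite elsym_gt // sz.
rewrite !elsym_cons top add0r.
have := IH n sz; set a := elsym s n.+2; set b := elsym s n.+1; set c := elsym s n.
have n0 : 0 <= n%:R :> R by rewrite ler0n.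
rewrite -(natr1 n.+2) -(natr1 n.+1) -(natr1 n); set m := n%:R in n0 *.
move=> H; have {}H : 2 * (a * c) <= (m + 1) / (m + 1 + 1) * b ^+ 2.
  by rewrite mulrAC ler_pdivlMr; [nra|lra].
have [_ e] : 0 < m + 1 + 1 /\ 0 <= ((m + 1 + 1) * a - x * b) ^+ 2 / (m + 1 + 1).
  by split; [lra|rewrite divr_ge0 ?sqr_ge0 //; lra].
move: e; have -> : ((m + 1 + 1) * a - x * b) ^+ 2 / (m + 1 + 1) =
  (m + 1 + 1) * a ^+ 2 - 2 * x * a * b + x ^+ 2 * b ^+ 2 * (1 - (m + 1) / (m + 1 + 1)).
  by field; apply: lt0r_neq0; lra.
move=> e; have X0 : 0 <= x ^+ 2 by rewrite sqr_ge0.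
set f := (m + 1) / (m + 1 + 1) in H e *.
have fE : f * (m + 1 + 1) = m + 1 by rewrite /f divfK //; apply: lt0r_neq0; lra.
have H2 := ler_wpM2l X0 H.
have H3 : (m + 1 + 1 + 1) * (x ^+ 2 * (2 * (a * c))) <= (m + 1 + 1 + 1) * (x ^+ 2 * (f * b ^+ 2)).
  by apply: ler_wpM2l => //; lra.
have -> : 2 * (m + 1 + 1 + 1) * (x * a * (b + x * c)) =
   2 * (m + 1 + 1 + 1) * x * a * b + (m + 1 + 1 + 1) * (x ^+ 2 * (2 * (a * c))) by ring.
have E4 : (m + 1 + 1 + 1) * (x ^+ 2 * (f * b ^+ 2)) = x ^+ 2 * b ^+ 2 * (f * (m + 1 + 1) + f) by ring.
rewrite {}E4 fE in H3.
lra.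
Qed.

(** Passing to the sequence of [derivative_real_rooted] lowers the size by one and multiplies the
    difference of the two sides by a positive factor; when the size reaches [k.+2], [newton_top]
    applies. *)
Lemma newton s k : (k.+2 <= size s)%N ->
  k.+2%:R * ((size s)%:R - k%:R) * (elsym s k.+2 * elsym s k) <=
  k.+1%:R * ((size s)%:R - k.+1%:R) * elsym s k.+1 ^+ 2.
Proof.
move: {2}(size s - k.+2)%N (erefl (size s - k.+2)%N) => d; elim: d s => [|d IH] s sd ks.
  have sz : size s = k.+2 by apply/eqP; rewrite eqn_leq ks andbT -subn_eq0 sd.
  have := newton_top sz; rewrite sz -(natr1 k.+1) -(natr1 k); set m := k%:R.
  have -> : (m + 1 + 1) * (m + 1 + 1 - m) = 2 * (m + 1 + 1) by ring.
  by have -> : (m + 1) * (m + 1 + 1 - (m + 1)) = m + 1 by ring.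
have sk : (k.+2 < size s)%N by rewrite -subn_gt0 sd.
have [s' [sz' H]] := derivative_real_rooted (leq_ltn_trans (leq0n _) sk).
have {IH} := IH s'; rewrite sz' => /(_ _ _).
have ks' : (k.+1 < (size s).-1)%N by rewrite -ltnS prednK // (leq_ltn_trans _ sk).
have sd' : ((size s).-1 - k.+2 = d)%N by rewrite -subn1 subnAC sd subn1.
move=> /(_ sd' ks').
have N1 : (size s).-1%:R = (size s)%:R - 1 :> R.
  by rewrite -subn1 natrB // (leq_ltn_trans _ sk).
rewrite N1; have := H k; have := H k.+1; have := H k.+2.
have kN : k%:R + 1 + 1 + 1 <= (size s)%:R :> R by rewrite !natr1 ler_nat.
have k0 : 0 <= k%:R :> R by rewrite ler0n.
rewrite -(natr1 k.+1) -(natr1 k); set N := (size s)%:R in kN *; set m := k%:R in kN k0 *.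
set a := elsym s' _; set b := elsym s' _; set c := elsym s' _.
set a' := elsym s _; set b' := elsym s _; set c' := elsym s _.
move=> Ha Hb Hc HN; have N0 : 0 < N by lra.
have {}Ha : a = (N - (m + 1 + 1)) * a' / N by rewrite -Ha mulrC mulKf // gt_eqF.
have {}Hb : b = (N - (m + 1)) * b' / N by rewrite -Hb mulrC mulKf // gt_eqF.
have {}Hc : c = (N - m) * c' / N by rewrite -Hc mulrC mulKf // gt_eqF.
move: HN; rewrite {}Ha {}Hb {}Hc -subr_ge0.
have -> : (m + 1) * (N - 1 - (m + 1)) * ((N - (m + 1)) * b' / N) ^+ 2 -
    (m + 1 + 1) * (N - 1 - m) * ((N - (m + 1 + 1)) * a' / N * ((N - m) * c' / N)) =
  ((N - m - 1 - 1) * (N - m - 1) / N ^+ 2) *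
  ((m + 1) * (N - (m + 1)) * b' ^+ 2 - (m + 1 + 1) * (N - m) * (a' * c')).
  by field; rewrite gt_eqF.
rewrite pmulr_rge0 ?subr_ge0 //.
by rewrite divr_gt0 ?exprn_gt0 // mulr_gt0 //; lra.
Qed.

Lemma newton_weak s k : elsym s k.+2 * elsym s k <= elsym s k.+1 ^+ 2.
Proof.
have [ks|ks] := leqP k.+2 (size s); last first.
  by rewrite (@elsym_gt _ s k.+2) // mul0r sqr_ge0.
have := newton ks.
have kN : k%:R + 1 + 1 <= (size s)%:R :> R by rewrite !natr1 ler_nat.
have k0 : 0 <= k%:R :> R by rewrite ler0n.
rewrite -(natr1 k.+1) -(natr1 k); set N := (size s)%:R in kN *; set m := k%:R in kN k0 *.
set A := _ * elsym s k; set B := _ ^+ 2; have B0 : 0 <= B by rewrite sqr_ge0.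
move=> H; rewrite leNgt; apply/negP => AB.
have A0 : 0 < A by exact: le_lt_trans AB.
have e1 : (m + 1) * (N - (m + 1)) * B <= (m + 1 + 1) * (N - m) * B.
  by apply: ler_wpM2r => //; nra.
have : (m + 1 + 1) * (N - m) * B < (m + 1 + 1) * (N - m) * A.
  by rewrite ltr_pM2l //; nra.
lra.
Qed.

End Newton.

(** * Garding cones *)

Section Cone.
Context (R : realType).
Implicit Types (s : seq R) (x q t : R).

Definition shift_seq s q : seq R := [seq x + q | x <- s].

(** The binomial is ['C(size s - (j - i), i)] without nested subtraction. Where [size s + i < j]
    truncates it, the factor [elsym s (j - i)] is zero. *)
Lemma elsym_shift s q j : elsym (shift_seq s q) j =
  \sum_(i < j.+1) 'C(size s + i - j, i)%:R * q ^+ i * elsym s (j - i).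
Proof.
elim: s j => [|x s IH] j.
  case: j => [|j]; first by rewrite big_ord1 !elsym0 expr0 !mulr1 bin0.
  rewrite elsym_gt // big1 // => i _; have [ij|ij] := ltnP i j.+1.
    by rewrite [elsym _ (_ - _)]elsym_gt ?mulr0 ?subn_gt0.
  by rewrite bin_small ?mul0r //= add0n ltn_subrL (leq_trans _ ij).
case: j => [|j]; first by rewrite big_ord1 !elsym0 expr0 !mulr1 bin0.
rewrite /shift_seq /= -/(shift_seq s q) elsym_cons !IH; set N := size s.
pose a (i : nat) : R := elsym s i.
have E1 : \sum_(i < j.+2) 'C(N + i - j.+1, i)%:R * q ^+ i * elsym s (j.+1 - i) =
    a j.+1 + \sum_(i < j.+1) 'C(N + i - j, i.+1)%:R * q ^+ i.+1 * a (j - i)%N.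
  rewrite big_ord_recl /= bin0 expr0 !mul1r subn0; congr (_ + _).
  by apply: eq_bigr => i _; rewrite /bump /= add1n addnS subSS.
have E2 : \sum_(i < j.+2) 'C(N.+1 + i - j.+1, i)%:R * q ^+ i * elsym (x :: s) (j.+1 - i) =
    a j.+1 + x * \sum_(i < j.+1) 'C(N + i - j, i)%:R * q ^+ i * a (j - i)%N +
    \sum_(i < j.+1) 'C(N + i.+1 - j, i.+1)%:R * q ^+ i.+1 * a (j - i)%N.
  have -> : \sum_(i < j.+2) 'C(N.+1 + i - j.+1, i)%:R * q ^+ i * elsym (x :: s) (j.+1 - i) =
      \sum_(i < j.+2) 'C(N + i - j, i)%:R * q ^+ i * a (j.+1 - i)%N +
      x * \sum_(i < j.+1) 'C(N + i - j, i)%:R * q ^+ i * a (j - i)%N.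
    rewrite big_ord_recr [in RHS]big_ord_recr /= subnn elsym0 /a elsym0 addSn subSS.
    rewrite [RHS]addrAC; congr (_ + _).
    rewrite mulr_sumr -big_split; apply: eq_bigr => i _ /=.
    rewrite addSn !subSS subSn; last by rewrite -ltnS.
    by rewrite elsym_cons /a; ring.
  rewrite [RHS]addrAC [in LHS]big_ord_recl /= bin0 expr0 !mul1r subn0; congr (_ + _ + _).
rewrite E1 E2 mulrDl -!addrA; congr (_ + _); rewrite addrCA; congr (_ + _).
rewrite mulr_sumr -big_split; apply: eq_bigr => i _ /=.
have [jN|jN] := leqP j (N + i).
  by rewrite addnS subSn // binS natrD exprS /a; ring.
have -> : a (j - i)%N = 0 by rewrite /a elsym_gt // ltn_subRL addnC.
have -> : elsym s (j - i) = 0 by rewrite elsym_gt // ltn_subRL addnC.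
by rewrite !mulr0 addr0.
Qed.

Lemma is_derive_elsym s t j : is_derive t 1 (fun t => elsym (shift_seq s t) j.+1)
   (((size s)%:R - j%:R) * elsym (shift_seq s t) j).
Proof.
elim: s j => [|x s IH] j.
  have -> : (fun t => elsym (shift_seq [::] t) j.+1) = cst 0.
    by apply/funext => u; rewrite elsym_gt.
  by case: j => [|j]; rewrite ?subrr ?mul0r ?(@elsym_gt _ [::]) ?mulr0 //; exact: is_derive_cst.
have -> : (fun t => elsym (shift_seq (x :: s) t) j.+1) =
  (fun t => elsym (shift_seq s t) j.+1) + (cst x + id) * (fun t => elsym (shift_seq s t) j).
  by apply/funext => u; rewrite /= elsym_cons.
have idx : is_derive t 1 (cst x + id) (0 + 1) by exact: is_deriveD.
case: j => [|j].
  have -> : (fun t => elsym (shift_seq s t) 0) = cst 1 by apply/funext => u; rewrite elsym0.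
  have d1 : is_derive t 1 (cst 1 : R -> R) 0 by exact: is_derive_cst.
  have d := is_deriveD (IH 0%N) (is_deriveM idx d1).
  apply: (is_derive_eq d).
  rewrite !elsym0 /= -natr1 /GRing.scale /=; ring.
apply: (is_derive_eq (is_deriveD (IH j.+1) (is_deriveM idx (IH j)))).
have -> : shift_seq (x :: s) t = (x + t) :: shift_seq s t by [].
have -> : (cst x + id) t = x + t by [].
by rewrite elsym_cons [size (_ :: _)]/= -(natr1 (size s)) -(natr1 j) /GRing.scale /=; ring.
Qed.

Lemma elsym_shift_continuous s j : continuous (fun t => elsym (shift_seq s t) j).
Proof.
case: j => [|j] t.
  have -> : (fun t => elsym (shift_seq s t) 0) = cst 1 by apply/funext => u; rewrite elsym0.
  exact: cst_continuous.
apply: differentiable_continuous; apply/derivable1_diffP.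
exact: (@ex_derive _ _ _ _ _ _ _ (is_derive_elsym s t j)).
Qed.

Lemma ge0_right_limit (f : R -> R) : {for 0, continuous f} ->
  (forall e, 0 < e -> 0 <= f e) -> 0 <= f 0.
Proof.
move=> cf f0; rewrite leNgt; apply/negP => f0n.
have : \forall t \near 0, f t < 0 by apply: (cf [set y | y < 0]); exact: lt_nbhsl.
move=> [e /= e0 H]; have e2 : 0 < e / 2 by rewrite divr_gt0.
have := f0 _ e2; rewrite leNgt => /negP; apply; apply: H.
by rewrite /= sub0r normrN gtr0_norm // ltr_pdivrMr // ltr_pMr // ltr1n.
Qed.

(** The closed and the open Garding cone, described by inequalities; index 0 is included for
    uniformity, since [elsym s 0] is 1. *)
Definition cone k s := forall j, (j <= k)%N -> 0 <= elsym s j.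
Definition scone k s := forall j, (j <= k)%N -> 0 < elsym s j.

Lemma size_shift s q : size (shift_seq s q) = size s.
Proof. exact: size_map. Qed.

Lemma elsym_shift_ge k s q j : cone k s -> 0 <= q -> (j <= k)%N ->
  elsym s j <= elsym (shift_seq s q) j.
Proof.
move=> ks q0 jk; rewrite elsym_shift big_ord_recl bin0 expr0 !mul1r subn0 lerDl.
apply: sumr_ge0 => i _; rewrite !mulr_ge0 ?exprn_ge0 //; apply: ks.
exact: leq_trans (leq_subr _ _) jk.
Qed.

Lemma cone_shift k s q : cone k s -> 0 <= q -> cone k (shift_seq s q).
Proof. by move=> ks q0 j jk; apply: le_trans (elsym_shift_ge ks q0 jk); exact: ks. Qed.

(** A positive shift moves the closed cone into the open one, so statements about [scone] pass to
    [cone] by letting the shift tend to 0. *)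
Lemma elsym_shift_gt k s q j : cone k s -> 0 <= q -> (j <= k)%N -> (j <= size s)%N ->
  q ^+ j <= elsym (shift_seq s q) j.
Proof.
move=> ks q0 jk js; rewrite elsym_shift big_ord_recr /= subnn elsym0 mulr1 addnK.
rewrite -[leLHS]add0r lerD //; last first.
  by rewrite ler_peMl ?exprn_ge0 // ler1n bin_gt0.
apply: sumr_ge0 => i _; rewrite !mulr_ge0 ?exprn_ge0 //; apply: ks.
exact: leq_trans (leq_subr _ _) jk.
Qed.

(** Suppose the top function [b] of [s] were nonpositive while the one below, [c], is positive.
    Positivity for [x :: s] forces [x * c > - b], and then [a * c <= b ^+ 2] makes [(a + x * b) * c]
    nonpositive, a contradiction. *)
Lemma scone_behead k x s : scone k.+1 (x :: s) -> scone k s.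
Proof.
elim: k => [|k IH] H; first by case=> // _; rewrite elsym0.
have {}IH : scone k s by apply: IH => j jk; apply: H; exact: leqW.
move=> j; rewrite leq_eqVlt => /orP[/eqP->|]; last by rewrite ltnS; exact: IH.
have := H _ (leqnn _); have := H _ (leqnSn _); have := IH _ (leqnn _).
have := newton_weak s k; rewrite !elsym_cons.
set a := elsym s k.+2; set b := elsym s k.+1; set c := elsym s k => nw c0 h1 h2.
rewrite ltNge; apply/negP => b0.
have : b ^+ 2 <= (x * c) * (- b) by rewrite expr2; nra.
have : 0 < (a + x * b) * c by exact: mulr_gt0.
nra.
Qed.

Lemma cone_behead k x s : (k <= size s)%N -> cone k.+1 (x :: s) -> cone k s.
Proof.
move=> ks H j jk.
have := @ge0_right_limit (fun t => elsym (shift_seq s t) j) (@elsym_shift_continuous s j 0).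
have -> : shift_seq s 0 = s by rewrite /shift_seq -[RHS]map_id; apply: eq_map => y; rewrite addr0.
apply => e e0; apply/ltW.
have : scone k.+1 (shift_seq (x :: s) e).
  move=> i ik; apply: lt_le_trans (elsym_shift_gt H (ltW e0) ik (leq_trans ik _)) => //.
  exact: exprn_gt0.
by move/scone_behead; exact.
Qed.

End Cone.

(** * The share of [S_(k+1)] carried by one eigenvalue *)

Section ConeRatio.
Context (R : realType).
Implicit Types (s : seq R) (x q t : R).

(** The left side contains [q] times the derivative of [elsym _ k.+1] in the entry [x], taken at the
    shifted point. The constant is the one for which equality holds in the limit case of zero
    entries, and [c] below is the slope of the quotient in that case. *)
Lemma scone_ratio k x s q : (k <= size s)%N -> scone k.+1 (x :: s) -> 0 <= q ->
  (size s).+1%:R * q * elsym (shift_seq s q) k <= k.+1%:R * elsym (shift_seq (x :: s) q) k.+1.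
Proof.
move=> ks H q0.
have Hc : cone k.+1 (x :: s) by move=> j /H/ltW.
case: k => [|k] in ks H Hc *.
  rewrite elsym0 mulr1 mul1r elsym_shift big_ord_recr /= big_ord1 !bin0 !expr0 !mul1r.
  rewrite elsym0 mulr1 addn1 subn1 /= bin1 expr1 lerDr subn0; exact: Hc.
have gpos t : 0 <= t -> 0 < elsym (shift_seq s t) k.+1.
  move=> t0; have Hs := scone_behead H.
  apply: lt_le_trans (@elsym_shift_ge _ k.+1 s t k.+1 _ t0 (leqnn _)); first exact: Hs.
  by move=> j /Hs/ltW.
set N := size s in ks *; pose c : R := N.+1%:R / k.+2%:R.
pose f t := elsym (shift_seq (x :: s) t) k.+2.
pose g t := elsym (shift_seq s t) k.+1.
pose h : R -> R := f * (fun t => (g t)^-1) - (fun t => c * t).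
pose f' t := (N.+1%:R - k.+1%:R) * elsym (shift_seq (x :: s) t) k.+1.
pose g' t := (N%:R - k%:R) * elsym (shift_seq s t) k.
have dh t : 0 <= t -> is_derive t 1 h ((f' t * g t - f t * g' t) / g t ^+ 2 - c).
  move=> t0; have gt0 := gpos t t0.
  have df : is_derive t 1 f (f' t) by exact: is_derive_elsym.
  have dg : is_derive t 1 g (g' t) by exact: is_derive_elsym.
  have dgv : is_derive t 1 (fun t => (g t)^-1) (- (g t) ^- 2 *: g' t).
    by apply: DeriveDef; [apply: derivableV; rewrite ?gt_eqF //|
       rewrite deriveV ?gt_eqF // derive_val].
  have dc : is_derive t 1 (fun t : R => c * t) (c *: 1) by exact: is_deriveZ.
  apply: is_derive_eq; rewrite /GRing.scale /=; field.
  by rewrite gt_eqF.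
(* Newton's inequality for [s + t] is what makes [f / g - c t] nondecreasing. *)
have h'0 t : 0 <= t -> 0 <= (f' t * g t - f t * g' t) / g t ^+ 2 - c.
  move=> t0; have gt0 := gpos t t0; rewrite subr_ge0 ler_pdivlMr ?exprn_gt0 //.
  rewrite /c mulrAC ler_pdivrMr ?ltr0n //.
  rewrite /f' /f /g' /g.
  have sh : shift_seq (x :: s) t = (x + t) :: shift_seq s t by [].
  rewrite sh !elsym_cons -(natr1 k.+1) -(natr1 k) -(natr1 N).
  set b := elsym _ k.+1; set b1 := elsym _ k.+2; set b0 := elsym _ k.
  have kN : k%:R + 1 <= N%:R :> R by rewrite natr1 ler_nat.
  have k0 : 0 <= k%:R :> R by rewrite ler0n.
  have nw : (k%:R + 1 + 1) * (N%:R - k%:R) * (b1 * b0) <=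
            (k%:R + 1) * (N%:R - (k%:R + 1)) * b ^+ 2.
    move: ks; rewrite leq_eqVlt => /orP[/eqP kN'|kN'].
      by rewrite /b1 elsym_gt ?size_shift -/N -?kN' // -natr1 subrr mulr0 !mul0r mulr0.
    by have := @newton _ (shift_seq s t) k; rewrite size_shift !natr1; apply.
  set m := k%:R in kN k0 nw *; set n := N%:R in kN nw *.
  nra.
have cont : {within `[0, q], continuous h}.
  apply: continuous_in_subspaceT => t; rewrite inE /= in_itv /= => /andP[t0 _].
  apply: differentiable_continuous; apply/derivable1_diffP.
  exact: (@ex_derive _ _ _ _ _ _ _ (dh t t0)).
have [||t tq hE] := @MVT_segment R h (fun t => (f' t * g t - f t * g' t) / g t ^+ 2 - c) 0 q q0.
- by move=> t; rewrite in_itv /= => /andP[/ltW t0 _]; exact: dh.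
- exact: cont.
have : 0 <= h q - h 0.
  by rewrite hE subr0 mulr_ge0 // h'0 //; move: tq; rewrite in_itv /= => /andP[].
have hE' t' : h t' = f t' / g t' - c * t' by [].
rewrite !hE' mulr0 subr0 => D.
have f0 : 0 <= f 0 / g 0.
  apply: divr_ge0; last exact/ltW/gpos.
  exact: (cone_shift Hc).
have {f0}D : c * q <= f q / g q by lra.
move: D; rewrite ler_pdivlMr ?gpos // /c mulrAC -mulrA mulrAC ler_pdivrMr ?ltr0n //.
by rewrite -/N -/(f q) -/(g q); lra.
Qed.

Lemma cone_ratio k x s q : (k <= size s)%N -> cone k.+1 (x :: s) -> 0 <= q ->
  (size s).+1%:R * q * elsym (shift_seq s q) k <= k.+1%:R * elsym (shift_seq (x :: s) q) k.+1.
Proof.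
move=> ks H q0; rewrite -subr_ge0.
pose F e := k.+1%:R * elsym (shift_seq (x :: s) (q + e)) k.+1
   - (size s).+1%:R * q * elsym (shift_seq s (q + e)) k.
have shE (s' : seq R) e : shift_seq (shift_seq s' e) q = shift_seq s' (q + e).
  by rewrite /shift_seq -map_comp; apply: eq_map => y /=; rewrite addrAC -addrA.
suff : 0 <= F 0 by rewrite /F !addr0.
apply: ge0_right_limit => [|e e0].
  have cE (s' : seq R) j : {for 0, continuous (fun e => elsym (shift_seq s' (q + e)) j)}.
    apply: (@continuous_comp _ _ _ (fun e => q + e) (fun t => elsym (shift_seq s' t) j)).
      by apply: cvgD; [exact: cvg_cst|exact: cvg_id].
    exact: elsym_shift_continuous.
  by apply: cvgB; apply: cvgM; [exact: cvg_cst|exact: cE|exact: cvg_cst|exact: cE].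
rewrite /F subr_ge0 -!shE -(size_shift s e); apply: scone_ratio => //; first by rewrite size_shift.
move=> i ik; apply: lt_le_trans (elsym_shift_gt H (ltW e0) ik (leq_trans ik _)) => //.
exact: exprn_gt0.
Qed.

End ConeRatio.

(** * Directions of negative curvature inside the cone *)

Section ConeVector.
Context (R : realType) (n : nat).
Implicit Types (l w : 'rV[R]_n).

(** For a unit vector [w] this is [S_j] of the compression of [diag_mx l] to the orthogonal
    complement of [w]; it is also the slope of [S_(j+1)] at [diag_mx l] in the direction [w^T w]. *)
Definition avg l w j : R := \sum_i w 0 i ^+ 2 * elsym (coords' l i) j.

Lemma cone_coords' k l i : (k < n)%N -> cone k.+1 (coords l) -> cone k (coords' l i).
Proof.
move=> kn H; apply: (@cone_behead _ _ (l 0 i)).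
  by rewrite size_coords' -ltnS prednK // (leq_ltn_trans _ kn).
by move=> j jk; rewrite -(perm_elsym (perm_coords l i)); exact: H.
Qed.

(** The difference of the two functions is [l 0 m - l 0 i] times the function with both entries
    deleted, and deleting two entries of a cone point costs only two degrees. *)
Lemma elsym_coords'_anti k l i m j : (k <= n)%N -> cone k (coords l) -> (j < k)%N ->
  (l 0 i - l 0 m) * (elsym (coords' l i) j - elsym (coords' l m) j) <= 0.
Proof.
move=> kn H; case: j => [|j] jk; first by rewrite !elsym0 subrr mulr0.
have [->|im] := eqVneq i m; first by rewrite subrr mul0r.
pose rest := [seq l 0 a | a <- enum 'I_n & (a != i) && (a != m)].
have pE a b : a != b -> [seq l 0 c | c <- enum 'I_n & (c != a) && (c != b)] = rest ->
    perm_eq (coords' l a) (l 0 b :: rest).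
  move=> ab <-; rewrite /coords' -(map_cons (fun i => l 0 i)); apply: perm_map.
  have -> : [seq c <- enum 'I_n | (c != a) && (c != b)] = rem b [seq c <- enum 'I_n | c != a].
    rewrite (rem_filter b (filter_uniq _ (enum_uniq _))) -filter_predI.
    by apply: eq_filter => c /=; rewrite andbC.
  by apply: perm_to_rem; rewrite mem_filter mem_enum eq_sym ab.
have pi : perm_eq (coords' l i) (l 0 m :: rest) by exact: pE.
have pm : perm_eq (coords' l m) (l 0 i :: rest).
  by apply: pE; rewrite 1?eq_sym //; congr map; apply: eq_filter => c; rewrite andbC.
rewrite (perm_elsym pi) (perm_elsym pm) !elsym_cons.
have -> : elsym rest j.+1 + l 0 m * elsym rest j - (elsym rest j.+1 + l 0 i * elsym rest j) =
  - ((l 0 i - l 0 m) * elsym rest j) by ring.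
rewrite mulrN mulrA -expr2 oppr_le0 mulr_ge0 ?sqr_ge0 //.
case: k => // k in kn H jk; case: k => // k in kn H jk.
have H1 : cone k.+1 (coords' l i) by exact: cone_coords'.
have : cone k rest.
  apply: (@cone_behead _ _ (l 0 m)).
    have := perm_size pi; rewrite size_coords' /= => e.
    by rewrite -ltnS -e -ltnS prednK // (leq_ltn_trans (leq0n _) kn).
  by move=> a ak; rewrite -(perm_elsym pi); exact: H1.
exact.
Qed.

(** Chebyshev's sum inequality with weights [w_i^2]: the eigenvalues and the functions omitting them
    are oppositely ordered. *)
Lemma avg_chebyshev k l w j : (k <= n)%N -> cone k (coords l) -> (j < k)%N -> dot w w = 1 ->
  \sum_i w 0 i ^+ 2 * (l 0 i * elsym (coords' l i) j) <=
  (\sum_i w 0 i ^+ 2 * l 0 i) * avg l w j.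
Proof.
move=> kn H jk w1; pose v i := w 0 i ^+ 2; pose e i := elsym (coords' l i) j.
have v1 : \sum_i v i = 1 by rewrite -w1; apply: eq_bigr => i _; rewrite /v expr2.
have : \sum_i \sum_m v i * v m * ((l 0 i - l 0 m) * (e i - e m)) <= 0.
  apply: sumr_le0 => i _; apply: sumr_le0 => m _; apply: mulr_ge0_le0.
    by rewrite mulr_ge0 ?sqr_ge0.
  exact: elsym_coords'_anti jk.
set A := \sum_i v i * (l 0 i * e i); set B := \sum_i v i * l 0 i; set C := avg l w j.
suff -> : \sum_i \sum_m v i * v m * ((l 0 i - l 0 m) * (e i - e m)) = 2 * (A - B * C) by lra.
have -> : \sum_i \sum_m v i * v m * ((l 0 i - l 0 m) * (e i - e m)) =
    \sum_i (v i * (l 0 i * e i) * 1 + v i * A - v i * l 0 i * C - v i * e i * B).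
  apply: eq_bigr => i _.
  rewrite -{1}v1 /C /avg /A /B !mulr_sumr -!big_split -!sumrB /=.
  by apply: eq_bigr => m _; rewrite -/(v m) -/(e m); ring.
rewrite !sumrB !big_split /= -!mulr_suml v1 -/A -/B.
have -> : \sum_i v i * e i = C by [].
ring.
Qed.

(** Splitting off each eigenvalue writes [elsym (coords l) j.+1] as [avg l w j.+1] plus a sum that
    Chebyshev's inequality bounds by [- p * avg l w j]. So curvature below [- p] makes the slopes
    dominate the values and grow at least by the factor [p] with each degree. *)
Lemma avg_step k l w p : (k <= n)%N -> cone k (coords l) -> dot w w = 1 ->
  0 <= p -> \sum_i w 0 i ^+ 2 * l 0 i <= - p ->
  (forall j, (j <= k)%N -> elsym (coords l) j <= avg l w j) /\
  (forall j, (j < k)%N -> p * avg l w j <= avg l w j.+1).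
Proof.
move=> kn H w1 p0 ap.
have avg0 j : (j < k)%N -> 0 <= avg l w j.
  move=> jk; apply: sumr_ge0 => i _; rewrite mulr_ge0 ?sqr_ge0 //.
  case: k => // k in kn H jk; exact: (@cone_coords' k).
have step j : (j < k)%N -> elsym (coords l) j.+1 + p * avg l w j <= avg l w j.+1.
  move=> jk; have v1 : \sum_i w 0 i ^+ 2 = 1.
    by rewrite -w1; apply: eq_bigr => i _; rewrite expr2.
  have E : elsym (coords l) j.+1 = avg l w j.+1 + \sum_i w 0 i ^+ 2 * (l 0 i * elsym (coords' l i) j).
    rewrite /avg -big_split -[LHS]mul1r -v1 mulr_suml; apply: eq_bigr => i _.
    by rewrite /= (elsym_coords l i) mulrDr.
  have := avg_chebyshev kn H jk w1; have := avg0 _ jk.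
  set a := \sum_i _ in ap *; set b := avg l w j => b0 ab.
  have : a * b <= - p * b by exact: ler_wpM2r.
  by rewrite E; lra.
split=> [[|j] jk|j jk].
- rewrite elsym0 /avg; under eq_bigr do rewrite elsym0 mulr1 expr2.
  by rewrite -/(dot w w) w1.
- have := step _ jk; have := avg0 _ jk => a b.
  by apply: le_trans b; rewrite lerDl mulr_ge0.
- by have := step _ jk; have := H _ jk; lra.
Qed.

End ConeVector.

(** * Absorbing a negative multiple of the identity *)

Section Perturb.
Context (R : realType).

Lemma bin_le_exp2 m i : ('C(m, i) <= 2 ^ m)%N.
Proof.
elim: m i => [|m IH] [|i]; rewrite ?bin0 ?bin0n ?expn_gt0 //.
by rewrite binS expnS mul2n -addnn leq_add.
Qed.

(** The growth condition gives [p^i t_(J-i) <= t_J], so each term of a tail in powers of [eps * p]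
    is at most a constant times [eps * p * t_J]. *)
Lemma tail_bound (K p eps : R) (c b t : nat -> R) J : 0 <= p -> 0 <= eps <= 1 ->
  (forall i, (i <= J)%N -> `|c i| <= K) -> (forall m, (m <= J)%N -> 0 <= b m <= t m) ->
  (forall m, (m < J)%N -> p * t m <= t m.+1) ->
  `| \sum_(i < J.+1) c i * (- (eps * p)) ^+ i.+1 * b (J - i)%N | <=
  J.+1%:R * (K * eps) * (p * t J).
Proof.
move=> p0 /andP[e0 e1] cK bt tp.
have K0 : 0 <= K by exact: le_trans (cK 0 _).
have t0 m : (m <= J)%N -> 0 <= t m by move=> /bt/andP[h1 h2]; exact: le_trans h2.
have pow i : (i <= J)%N -> p ^+ i * t (J - i)%N <= t J.
  elim: i => [|i IH] iJ; first by rewrite expr0 mul1r subn0.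
  apply: le_trans (IH (ltnW iJ)).
  rewrite exprSr -mulrA; apply: ler_wpM2l; first exact: exprn_ge0.
  by have := tp (J - i.+1)%N; rewrite subnSK //; apply; exact: leq_subr.
apply: le_trans (ler_norm_sum _ _ _) _.
have -> : J.+1%:R * (K * eps) * (p * t J) = \sum_(i < J.+1) K * (eps * (p * t J)).
  by rewrite sumr_const card_ord -[RHS]mulr_natl; ring.
apply: ler_sum => i _.
have iJ : (i <= J)%N by rewrite -ltnS.
have /andP[b0 bti] := bt (J - i)%N (leq_subr _ _).
rewrite !normrM normrX normrN normrM (ger0_norm b0) (ger0_norm e0) (ger0_norm p0).
rewrite -mulrA; apply: ler_pM; [exact: normr_ge0| |exact: cK|].
  by rewrite mulr_ge0 // exprn_ge0 // mulr_ge0.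
rewrite exprMn [eps ^+ _]exprS [p ^+ _]exprS.
have h1 : p ^+ i * b (J - i)%N <= t J.
  by apply: le_trans (pow _ iJ); apply: ler_wpM2l => //; exact: exprn_ge0.
have h2 : eps ^+ i <= 1 by exact: exprn_ile1.
have h3 : 0 <= p ^+ i * b (J - i)%N by rewrite mulr_ge0 // exprn_ge0.
have h4 : 0 <= eps ^+ i by exact: exprn_ge0.
have h5 : eps ^+ i * (p ^+ i * b (J - i)%N) <= t J.
  by apply: le_trans h1; rewrite ler_piMl.
have -> : eps * eps ^+ i * (p * p ^+ i) * b (J - i)%N =
  eps * (p * (eps ^+ i * (p ^+ i * b (J - i)%N))) by ring.
by rewrite !ler_wpM2l.
Qed.

Lemma elsym_shift_tail (s : seq R) q j : elsym (shift_seq s q) j.+1 =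
  elsym s j.+1 + \sum_(i < j.+1) 'C(size s + i.+1 - j.+1, i.+1)%:R * q ^+ i.+1 * elsym s (j - i).
Proof.
rewrite elsym_shift big_ord_recl bin0 expr0 !mul1r subn0; congr (_ + _).
Qed.

(* Small enough for the whole binomial tail of [elsym_shift_tail] to cost at most one half. *)
Definition perturb_eps n : R := (2 * n.+1%:R * (2 ^ n.+1)%:R)^-1.

(* [l] are the eigenvalues of a matrix [M] and [w] the coordinates of a unit vector [e] in the
   eigenbasis: [sum w_i^2 l_i = <M e, e>], and the sum in the conclusion is the contribution of the
   rank one matrix [e^T e] to [S_(j+1)]. *)
Lemma cone_perturb n k (l w : 'rV[R]_n) p : (k <= n)%N -> cone k (coords l) ->
  dot w w = 1 -> 0 <= p -> \sum_i w 0 i ^+ 2 * l 0 i <= - p ->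
  let g := - (perturb_eps n * p) in
  forall j, (j < k)%N -> 0 <= elsym (shift_seq (coords l) g) j.+1 +
    4 * p * \sum_i w 0 i ^+ 2 * elsym (shift_seq (coords' l i) g) j.
Proof.
move=> kn H w1 p0 ap g j jk.
have [le_avg step] := avg_step kn H w1 p0 ap.
set e := perturb_eps n in g *; pose K : R := (2 ^ n.+1)%:R.
have K0 : 0 < K by rewrite ltr0n expn_gt0.
have n0 : 0 < n.+1%:R :> R by rewrite ltr0n.
have eE : n.+1%:R * (K * e) = 1 / 2.
  by rewrite /e /perturb_eps -/K; field; rewrite !gt_eqF.
have e01 : 0 <= e <= 1.
  have h : 1 <= 2 * n.+1%:R * K by rewrite /K -!natrM ler1n !muln_gt0 expn_gt0.
  by rewrite /e /perturb_eps -/K invr_ge0 invf_le1 ?(lt_le_trans ltr01) // (le_trans ler01).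
have cK m i : (m <= n.+1)%N -> `|'C(m, i)%:R| <= K :> R.
  by move=> mn; rewrite ger0_norm // ler_nat (leq_trans (bin_le_exp2 _ _)) // leq_exp2l.
have avg0 m : (m <= k)%N -> 0 <= avg l w m.
  by move=> mk; apply: le_trans (le_avg _ mk); exact: H.
have jn : j.+1%:R <= n.+1%:R :> R by rewrite ler_nat ltnW // ltnS (leq_trans jk).
have Ke0 : 0 <= K * e by case/andP: e01 => e0 _; rewrite mulr_ge0 // ltW.
have small : j.+1%:R * (K * e) <= 1 / 2.
  by rewrite -eE ler_wpM2r.
have step' m : (m < k)%N -> p * avg l w m <= avg l w m.+1 by exact: step.
(* The shift by [g] changes [elsym (coords l) j.+1] by at most half of [p * avg l w j], and by [T2]
   it leaves at least half of the slope [avg l w j]; with the coefficient [4 * p] the gain is [2 p]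
   times that slope. *)
have T1 : `|\sum_(i < j.+1) 'C(n + i.+1 - j.+1, i.+1)%:R * g ^+ i.+1 * elsym (coords l) (j - i)|
    <= 1 / 2 * (p * avg l w j).
  apply: le_trans (ler_wpM2r _ small); last by rewrite mulr_ge0 // avg0 // ltnW.
  apply: (@tail_bound K p e (fun i => 'C(n + i.+1 - j.+1, i.+1)%:R)) => //.
  - by move=> i ij; apply: cK; rewrite leq_subLR addnC leq_add.
  - by move=> m mj; rewrite H ?le_avg // (leq_trans mj) // ltnW.
  - by move=> m mj; apply: step; exact: ltn_trans jk.
set T := \sum_(i < j.+1) _ in T1.
have T2 : 1 / 2 * avg l w j <= \sum_i w 0 i ^+ 2 * elsym (shift_seq (coords' l i) g) j.
  case: j jk jn small {T1 T} => [|j] jk jn small.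
    rewrite /avg mulr_sumr; apply: ler_sum => i _; rewrite !elsym0.
    by rewrite mulr1 ler_piMl ?sqr_ge0 //; lra.
  have -> : \sum_i w 0 i ^+ 2 * elsym (shift_seq (coords' l i) g) j.+1 =
     avg l w j.+1 + \sum_(i < j.+1) 'C(n.-1 + i.+1 - j.+1, i.+1)%:R * g ^+ i.+1 * avg l w (j - i).
    rewrite /avg; under [X in _ + X]eq_bigr do rewrite mulr_sumr.
    rewrite exchange_big -big_split; apply: eq_bigr => i _ /=.
    rewrite elsym_shift_tail size_coords' mulrDr; congr (_ + _).
    by rewrite mulr_sumr; apply: eq_bigr => m _; ring.
  have small' : j.+1%:R * (K * e) <= 1 / 2.
    apply: le_trans small; by rewrite ler_wpM2r ?ler_nat.
  have : `|\sum_(i < j.+1) 'C(n.-1 + i.+1 - j.+1, i.+1)%:R * g ^+ i.+1 * avg l w (j - i)|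
    <= 1 / 2 * (p * avg l w j).
    have jk' : (j < k)%N by exact: ltnW.
    apply: le_trans (ler_wpM2r _ small'); last by rewrite mulr_ge0 // avg0 // ltnW.
    apply: (@tail_bound K p e (fun i => 'C(n.-1 + i.+1 - j.+1, i.+1)%:R)) => //.
    - move=> i ij; apply: cK; rewrite leq_subLR addnC leq_add //.
      exact: leq_trans (leq_pred n) _.
    - by move=> m mj; rewrite lexx avg0 // (leq_trans mj) // ltnW.
    - by move=> m mj; apply: step; exact: ltn_trans jk'.
  set S := \sum_(i < j.+1) _ => /ler_normlP[S1 S2].
  by have := step _ (ltnW jk); lra.
rewrite elsym_shift_tail size_coords -/T.
have Hj := H _ jk; have /ler_normlP[S1 S2] := T1.
have : 4 * p * (1 / 2 * avg l w j) <= 4 * p * \sum_i w 0 i ^+ 2 * elsym (shift_seq (coords' l i) g) j.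
  by apply: ler_wpM2l => //; rewrite mulr_ge0.
have : 0 <= p * avg l w j by rewrite mulr_ge0 // avg0 // ltnW.
lra.
Qed.

End Perturb.

(** * The cone of symmetric matrices: monotonicity and the barrier Hessian *)

Section MatrixCone.
Context (R : realType) (n : nat).
Implicit Types (A M X Q N P : 'M[R]_n) (l v w e y : 'rV[R]_n).

Definition mcone k A := forall j, (j <= k)%N -> 0 <= Smx j A.

Lemma Smx0 A : Smx 0 A = 1.
Proof.
rewrite /Smx -horner_coef0 -horner_evalE -det_map_mx.
rewrite (_ : map_mx _ _ = 1%:M) ?det1 //.
apply/matrixP => i j; rewrite !mxE /= horner_evalE !hornerE /=.
by rewrite hornerMn hornerC.
Qed.

Lemma dot_orth P v : P *m P^T = 1%:M -> dot (v *m P^T) (v *m P^T) = dot v v.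
Proof.
by move=> PP; rewrite -!dotE trmx_mul trmxK mulmxA -(mulmxA v) (mulmx1C PP) mulmx1.
Qed.

Lemma mcone_add_rank1 k A v c : (k <= n)%N -> A^T = A -> mcone k A -> 0 <= c ->
  forall j, (j <= k)%N -> Smx j A <= Smx j (A + c *: (v^T *m v)).
Proof.
move=> kn symA Ak c0 [|j] jk; first by rewrite !Smx0.
have [l [P [PP AE]]] := spectral symA.
have lA i : Smx i A = elsym (coords l) i by apply: Smx_eigs; exists P.
rewrite {2}AE Smx_rank1 // lA lerDl mulr_ge0 //; apply: sumr_ge0 => i _.
rewrite mulr_ge0 ?sqr_ge0 //; case: k => // k in kn jk Ak *.
have Hc : cone k.+1 (coords l) by move=> m mk; rewrite -lA; exact: Ak.
exact: (cone_coords' i kn Hc).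
Qed.

Definition psd Q := forall x, 0 <= dot (x *m Q) x.

(** The spectral decomposition of [Q] is added one rank one term at a time; each inequality keeps
    the partial sum in the cone for the next. *)
Lemma mcone_add_psd k A Q : (k <= n)%N -> A^T = A -> mcone k A -> Q^T = Q -> psd Q ->
  forall j, (j <= k)%N -> Smx j A <= Smx j (A + Q).
Proof.
move=> kn symA Ak symQ psdQ.
have [d [P [PP QE]]] := spectral symQ.
have d0 i : 0 <= d 0 i.
  have := psdQ (row i P).
  have -> : row i P *m Q = d 0 i *: row i P.
    rewrite QE -row_mul !mulmxA PP mul1mx; apply/rowP => m; rewrite !mxE.
    rewrite (bigD1 i) //= !mxE eqxx mulr1n big1 ?addr0 // => o oi.
    by rewrite mxE eq_sym (negbTE oi) mulr0n mul0r.
  have rr : dot (row i P) (row i P) = 1.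
    have := congr1 (fun B : 'M[R]_n => B i i) PP; rewrite !mxE eqxx mulr1n => e1; rewrite -[RHS]e1.
    by apply: eq_bigr => m _; rewrite !mxE.
  by rewrite dotZl rr mulr1.
have QS : Q = \sum_i d 0 i *: ((row i P)^T *m row i P).
  rewrite QE; apply/matrixP => a b; rewrite summxE mxE; apply: eq_bigr => i _.
  rewrite mul_mx_diag !mxE big_ord_recl big_ord0 addr0 !mxE; ring.
rewrite QS.
have : forall s : seq 'I_n, [/\ (A + \sum_(i <- s) d 0 i *: ((row i P)^T *m row i P))^T =
     A + \sum_(i <- s) d 0 i *: ((row i P)^T *m row i P) &
   forall j, (j <= k)%N -> Smx j A <= Smx j (A + \sum_(i <- s) d 0 i *: ((row i P)^T *m row i P))].
  elim=> [|i s [sym IH]]; first by split; rewrite big_nil addr0.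
  rewrite big_cons [_ *: _ + _]addrC addrA; split.
    by rewrite linearD /= sym linearZ /= trmx_mul trmxK.
  have Ck : mcone k (A + \sum_(i <- s) d 0 i *: ((row i P)^T *m row i P)).
    by move=> m mk; apply: le_trans (IH _ mk); exact: Ak.
  move=> j jk; apply: le_trans (IH _ jk) _.
  exact: (mcone_add_rank1 (row i P) kn sym Ck (d0 i) jk).
by move=> /(_ (index_enum _))[].
Qed.

Lemma mcone_le k A N : (k <= n)%N -> A^T = A -> N^T = N -> mcone k A ->
  (forall x, dot (x *m A) x <= dot (x *m N) x) -> forall j, (j <= k)%N -> Smx j A <= Smx j N.
Proof.
move=> kn symA symN Ak le_AN j jk; rewrite -(subrK A N) [N - A + A]addrC.
apply: (mcone_add_psd kn) => //; first by rewrite linearB /= symA symN.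
by move=> x; rewrite mulmxBr dotBl subr_ge0.
Qed.

Lemma coords_shift l q : coords (l + const_mx q) = shift_seq (coords l) q.
Proof. by rewrite /coords /shift_seq -map_comp; apply: eq_map => i /=; rewrite !mxE. Qed.

Lemma coords'_shift l q i : coords' (l + const_mx q) i = shift_seq (coords' l i) q.
Proof. by rewrite /coords' /shift_seq -map_comp; apply: eq_map => m /=; rewrite !mxE. Qed.

Lemma Smx_shift_rank1 P l v q c j : P *m P^T = 1%:M -> let w := v *m P^T in
  Smx j.+1 (P^T *m diag_mx l *m P + q%:M + c *: (v^T *m v)) =
  elsym (shift_seq (coords l) q) j.+1 +
  c * \sum_i w 0 i ^+ 2 * elsym (shift_seq (coords' l i) q) j.
Proof.
move=> PP w; have -> : P^T *m diag_mx l *m P + q%:M = P^T *m diag_mx (l + const_mx q) *m P.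
  rewrite linearD /= mulmxDr mulmxDl; congr (_ + _).
  by rewrite diag_const_mx mul_mx_scalar -scalemxAl (mulmx1C PP) scalemx1.
rewrite Smx_rank1 // coords_shift; congr (_ + _ * _); apply: eq_bigr => i _.
by rewrite coords'_shift.
Qed.

Lemma quad_diag P l v : dot (v *m (P^T *m diag_mx l *m P)) v =
  \sum_i (v *m P^T) 0 i ^+ 2 * l 0 i.
Proof.
rewrite -dotE !mulmxA -mulmxA -[P *m v^T]trmxK trmx_mul trmxK mxE.
by apply: eq_bigr => i _; rewrite mul_mx_diag [in LHS]mxE [_^T _ _]mxE; ring.
Qed.

Lemma mcone_perturb k M e p : (k <= n)%N -> M^T = M -> mcone k M -> dot e e = 1 ->
  0 <= p -> dot (e *m M) e <= - p ->
  mcone k (M + (- (perturb_eps R n * p))%:M + (4 * p) *: (e^T *m e)).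
Proof.
move=> kn symM Mk e1 p0 eM [|j] jk; first by rewrite Smx0.
have [l [P [PP ME]]] := spectral symM.
rewrite {1}ME Smx_shift_rank1 //; apply: (cone_perturb kn) => //.
- by move=> i ik; rewrite -(Smx_eigs (A := M)) ?Mk //; exists P.
- by rewrite dot_orth.
- by rewrite -quad_diag -ME.
Qed.

(** By [cone_ratio], subtracting [q th y^T y] removes at most the share [th |y|^2 (j+1) / n] of
    [S_(j+1)] of [X + q%:M]. The hypothesis keeps this share below [1 - b], and [S_k] of [X + q%:M]
    is at least [q^k]. *)
Lemma mcone_add_barrier k X q th y b : (0 < k <= n)%N -> X^T = X -> mcone k X ->
  0 <= q -> 0 <= b -> 0 <= th -> th * dot y y * k%:R <= (1 - b) * n%:R ->
  mcone k (X + q%:M + (- (q * th)) *: (y^T *m y)) /\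
  b * q ^+ k <= Smx k (X + q%:M + (- (q * th)) *: (y^T *m y)).
Proof.
move=> /andP[k0 kn] symX Xk q0 b0 th0 thy.
have [l [P [PP XE]]] := spectral symX.
have Hl : cone k (coords l) by move=> i ik; rewrite -(Smx_eigs (A := X)) ?Xk //; exists P.
have n0 : (0 < n)%N by exact: leq_trans kn.
have step j : (j < k)%N ->
    b * elsym (shift_seq (coords l) q) j.+1 <= Smx j.+1 (X + q%:M + (- (q * th)) *: (y^T *m y)).
  move=> jk; rewrite {1}XE Smx_shift_rank1 //; set w := y *m P^T.
  set E := elsym _ j.+1.
  have E0 : 0 <= E by exact: (cone_shift Hl).
  have rat i : q * elsym (shift_seq (coords' l i) q) j * n%:R <= j.+1%:R * E.
    have := @cone_ratio _ j (l 0 i) (coords' l i) q; rewrite size_coords' prednK //.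
    have -> : elsym (shift_seq (l 0 i :: coords' l i) q) j.+1 = E.
      by apply/esym/perm_elsym/perm_map; exact: perm_coords.
    rewrite -ltnS prednK // => h.
    have : n%:R * q * elsym (shift_seq (coords' l i) q) j <= j.+1%:R * E.
      apply: h => //; first exact: leq_trans kn.
      move=> m mj; rewrite -(perm_elsym (perm_coords l i)); apply: Hl.
      exact: leq_trans jk.
    by congr (_ <= _); ring.
  have : n%:R * (q * th * \sum_i w 0 i ^+ 2 * elsym (shift_seq (coords' l i) q) j) <=
         n%:R * ((1 - b) * E).
    have -> : n%:R * (q * th * \sum_i w 0 i ^+ 2 * elsym (shift_seq (coords' l i) q) j) =
      th * \sum_i w 0 i ^+ 2 * (q * elsym (shift_seq (coords' l i) q) j * n%:R).
      by rewrite !mulr_sumr; apply: eq_bigr => i _; ring.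
    apply: (@le_trans _ _ (th * \sum_i w 0 i ^+ 2 * (j.+1%:R * E))).
      by apply: ler_wpM2l => //; apply: ler_sum => i _; rewrite ler_wpM2l ?sqr_ge0.
    have -> : \sum_i w 0 i ^+ 2 * (j.+1%:R * E) = dot y y * (j.+1%:R * E).
      have <- : \sum_i w 0 i ^+ 2 = dot y y.
        by rewrite -(dot_orth y PP); apply: eq_bigr => i _; rewrite expr2.
      by rewrite mulr_suml.
    rewrite !mulrA [n%:R * _]mulrC; apply: ler_wpM2r => //; apply: le_trans thy.
    by apply: ler_wpM2l; [rewrite mulr_ge0 // dot_ge0|rewrite ler_nat].
  rewrite ler_pM2l ?ltr0n //; lra.
split=> [[|j] jk|]; first by rewrite Smx0.
  by apply: le_trans (step _ jk); rewrite mulr_ge0 //; exact: (cone_shift Hl).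
case: k k0 kn Hl step {Xk thy} => // k _ kn Hl step.
apply: le_trans (step _ (leqnn _)); apply: ler_wpM2l => //.
by apply: (elsym_shift_gt Hl) => //; rewrite size_coords.
Qed.

Lemma elsym_nseq0 m q j : elsym (shift_seq (nseq m 0) q) j = 'C(m, j)%:R * q ^+ j :> R.
Proof.
have e0 i : elsym (nseq m (0 : R)) i.+1 = 0.
  elim: m => [|m IH]; first by rewrite elsym_gt.
  by rewrite elsym_cons IH mul0r addr0.
rewrite elsym_shift big_ord_recr /= subnn elsym0 mulr1 size_nseq addnK big1 ?add0r // => i _.
by rewrite -[(j - i)%N]prednK ?subn_gt0 // e0 mulr0.
Qed.

(** Monotonicity would give [S_k N >= 0] for [N = q (1 - th y^T y)]. This value is
    ['C(n, k) q^k - th |y|^2 'C(n-1, k-1) q^k], and [k 'C(n, k) = n 'C(n-1, k-1)]. *)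
Lemma barrier_not_above k M q th y : (0 < k <= n)%N -> M^T = M -> mcone k M -> 0 < q ->
  (forall x, dot (x *m M) x <= q * (dot x x - th * dot x y ^+ 2)) ->
  th * dot y y * k%:R <= n%:R.
Proof.
move=> /andP[k0 kn] symM Mk q0 MN.
(* The vanishing diagonal term brings [N] into the form required by [Smx_shift_rank1]. *)
pose N : 'M[R]_n := 1%:M^T *m diag_mx 0 *m 1%:M + q%:M + (- (q * th)) *: (y^T *m y).
have symN : N^T = N.
  by rewrite /N !linearD /= linear0 mulmx0 mul0mx trmx0 tr_scalar_mx linearZ /= trmx_mul trmxK.
have NE x : dot (x *m N) x = q * (dot x x - th * dot x y ^+ 2).
  rewrite /N linear0 mulmx0 mul0mx add0r mulmxDr dotDl mul_mx_scalar dotZl.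
  rewrite -scalemxAr dotZl mulmxA mulmx_tr mul_scalar_mx dotZl (dotC y x); ring.
have := mcone_le kn symM symN Mk _ (leqnn k).
move=> H.
have {H} : 0 <= Smx k N.
  apply: le_trans (Mk _ (leqnn _)) (H _) => x.
  by rewrite NE.
case: k k0 kn {Mk} => // k _ kn.
rewrite /N Smx_shift_rank1 ?trmx1 ?mulmx1 //.
have -> : coords (0 : 'rV[R]_n) = nseq n 0.
  rewrite /coords -[in RHS](size_enum_ord n); elim: (enum _) => //= a s ->.
  by rewrite mxE.
have c'E i : coords' (0 : 'rV[R]_n) i = nseq n.-1 0.
  rewrite -(size_coords' (0 : 'rV[R]_n) i).
  by apply/all_pred1P/allP => x /mapP[a _ ->]; rewrite mxE /=.
rewrite (eq_bigr (fun i => y 0 i ^+ 2 * ('C(n.-1, k)%:R * q ^+ k))) => [|i _]; last first.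
  by rewrite ?trmx1 ?mulmx1 c'E elsym_nseq0.
rewrite elsym_nseq0 -mulr_suml.
have -> : \sum_i y 0 i ^+ 2 = dot y y by apply: eq_bigr => i _; rewrite expr2.
set c := 'C(n.-1, k)%:R; have c0 : 0 < c :> R by rewrite ltr0n bin_gt0; lia.
have cE : n%:R * c = k.+1%:R * 'C(n, k.+1)%:R.
  by rewrite /c -!natrM mul_bin_diag.
move=> H; have : 0 <= k.+1%:R * ('C(n, k.+1)%:R * q ^+ k.+1 + - (q * th) * (dot y y * (c * q ^+ k))).
  by rewrite mulr_ge0.
have -> : k.+1%:R * ('C(n, k.+1)%:R * q ^+ k.+1 + - (q * th) * (dot y y * (c * q ^+ k))) =
   (n%:R * c * q ^+ k.+1 - th * dot y y * k.+1%:R * (c * q ^+ k.+1)).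
  by rewrite cE exprS; ring.
rewrite -mulrA -mulrBl pmulr_lge0 ?subr_ge0 // mulr_gt0 // exprn_gt0 //.
Qed.

End MatrixCone.

(** * Euclidean norm and differential calculus *)

Lemma continuous_subr_cst (R : realType) (V : normedModType R) (c : V) :
  continuous (fun y : V => y - c).
Proof. by move=> x; apply: cvgB; [exact: cvg_id|exact: cvg_cst]. Qed.

Section Enorm.
Context (R : realType) (n : nat).
Implicit Types x y z : 'rV[R]_n.

Lemma enormE x : enorm x = Num.sqrt (dot x x).
Proof. by congr Num.sqrt; apply: eq_bigr => i _; rewrite expr2. Qed.

Lemma enorm_sqr x : enorm x ^+ 2 = dot x x.
Proof. by rewrite enormE sqr_sqrtr // dot_ge0. Qed.

Lemma enorm_ge0 x : 0 <= enorm x.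
Proof. exact: sqrtr_ge0. Qed.

Lemma enorm0 : enorm (0 : 'rV[R]_n) = 0.
Proof. by rewrite enormE dot0r sqrtr0. Qed.

Lemma enormZ a x : enorm (a *: x) = `|a| * enorm x.
Proof. by rewrite !enormE dotZl dotZr mulrA -expr2 sqrtrM ?sqr_ge0 // sqrtr_sqr. Qed.

Lemma enormN x : enorm (- x) = enorm x.
Proof. by rewrite -scaleN1r enormZ normrN1 mul1r. Qed.

Lemma enormB x y : enorm (x - y) = enorm (y - x).
Proof. by rewrite -opprB enormN. Qed.

Lemma enorm_eq0 x : enorm x = 0 -> x = 0.
Proof. by move=> x0; apply: dot_eq0; rewrite -enorm_sqr x0 expr0n. Qed.

Lemma enorm_gt0 x : x != 0 -> 0 < enorm x.
Proof.
by move=> x0; rewrite lt0r enorm_ge0 andbT; apply: contra x0 => /eqP/enorm_eq0->.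
Qed.

Lemma cauchy_schwarz x y : dot x y <= enorm x * enorm y.
Proof.
have [x0|x0] := eqVneq (enorm x) 0.
  by rewrite x0 mul0r (enorm_eq0 x0) dotC dot0r.
have [y0|y0] := eqVneq (enorm y) 0; first by rewrite y0 mulr0 (enorm_eq0 y0) dot0r.
have px : 0 < enorm x by rewrite lt0r x0 enorm_ge0.
have py : 0 < enorm y by rewrite lt0r y0 enorm_ge0.
have := dot_ge0 (enorm y *: x - enorm x *: y).
rewrite dotBl !dotBr !dotZl !dotZr -!enorm_sqr (dotC y x).
have -> : enorm y * (enorm y * enorm x ^+ 2) - enorm y * (enorm x * dot x y) -
  (enorm x * (enorm y * dot x y) - enorm x * (enorm x * enorm y ^+ 2)) =
  2 * (enorm x * enorm y) * (enorm x * enorm y - dot x y) by ring.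
by rewrite pmulr_rge0 ?subr_ge0 // !mulr_gt0.
Qed.

Lemma cauchy_schwarz_norm x y : `|dot x y| <= enorm x * enorm y.
Proof.
rewrite ler_norml cauchy_schwarz andbT lerNl -dotNl.
by apply: le_trans (cauchy_schwarz _ _) _; rewrite enormN.
Qed.

Lemma ler_enormD x y : enorm (x + y) <= enorm x + enorm y.
Proof.
rewrite -(@ler_pXn2r _ 2) ?nnegrE ?addr_ge0 ?enorm_ge0 // enorm_sqr.
rewrite dotDl !dotDr -!enorm_sqr (dotC y x) sqrrD.
have := cauchy_schwarz x y; lra.
Qed.

Lemma ler_enormB x y z : enorm (x - z) <= enorm (x - y) + enorm (y - z).
Proof. by have := ler_enormD (x - y) (y - z); rewrite addrA subrK. Qed.

Lemma enorm_continuous : continuous (fun x : 'rV[R]_n => enorm x).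
Proof.
rewrite (_ : (fun _ => _) = fun x : 'rV[R]_n => Num.sqrt (dot x x)); last first.
  by apply/funext => x; exact: enormE.
move=> x; apply: (@continuous_comp _ _ _ (fun x : 'rV[R]_n => dot x x)).
  exact: dot_continuous.
exact: sqrt_continuous.
Qed.

Lemma norm_le_enorm x : `|x| <= enorm x.
Proof.
rewrite /Num.norm /= mx_normrE; apply: bigmax_le => [|[i j] _ /=]; first exact: enorm_ge0.
rewrite ord1 -(@ler_pXn2r _ 2) ?nnegrE ?enorm_ge0 // enorm_sqr real_normK ?num_real //.
exact: coord_le_dot.
Qed.

(** Neighbourhoods of row vectors come from the maximum norm; this restates them with Euclidean
    balls. *)
Lemma nbhs_enorm x (P : set 'rV[R]_n) :
  nbhs x P <-> exists2 e, 0 < e & forall y, enorm (y - x) < e -> P y.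
Proof.
split=> [/nbhs_ballP[e /= e0 eP]|[e e0 eP]].
  exists e => // y yx; apply: eP; rewrite -ball_normE /=.
  by apply: le_lt_trans (norm_le_enorm _) _; rewrite enormB.
have c : {for x, continuous (fun y : 'rV[R]_n => enorm (y - x))}.
  apply: (@continuous_comp _ _ _ (fun y : 'rV[R]_n => y - x)); last exact: enorm_continuous.
  exact: continuous_subr_cst.
have h : \forall r \near enorm (x - x), r < e.
  by apply: lt_nbhsl; rewrite subrr enorm0.
by apply: (@filterS _ (nbhs x) (nbhs_filter x) _ _ _ (c _ h)) => y; exact: eP.
Qed.

Lemma compact_eball c r : compact [set x : 'rV[R]_n | enorm (x - c) <= r].
Proof.
have cB := @compact_dot_le R n ((enorm c + `|r|) ^+ 2).
apply: (subclosed_compact _ cB).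
  apply: (preimage_closed (f := fun x : 'rV[R]_n => enorm (x - c)) (D := [set y | y <= r])).
    move=> x _; apply: (@continuous_comp _ _ _ (fun y : 'rV[R]_n => y - c)).
      exact: continuous_subr_cst.
    exact: enorm_continuous.
  exact: closed_le.
move=> x /= xr; rewrite -enorm_sqr ler_pXn2r ?nnegrE ?addr_ge0 ?enorm_ge0 //.
rewrite -[x](subrK c) addrC; apply: le_trans (ler_enormD _ _) _.
by rewrite lerD2l (le_trans xr) // ler_norm.
Qed.

End Enorm.

(** * Calculus along lines *)

Section Line.
Context (R : realType) (n : nat).
Implicit Types (f g : 'rV[R]_n -> R) (x y v : 'rV[R]_n).

Lemma is_derive_line f x v t l :
  is_derive (x + t *: v) v f l -> is_derive t 1 (fun s => f (x + s *: v)) l.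
Proof.
have E : (fun h => h^-1 *: (((fun s : R => f (x + s *: v)) \o shift t) (h *: 1) - f (x + t *: v)))
   = (fun h : R => h^-1 *: ((f \o shift (x + t *: v)) (h *: v) - f (x + t *: v))).
  apply/funext => h /=; congr (_ *: (f _ - _)).
  by rewrite [h *: 1]mulr1 scalerDl addrCA.
by move=> [dv <-]; apply: DeriveDef; rewrite /derivable /derive E.
Qed.

Lemma derive_grad f x v : differentiable f x -> is_derive x v f (dot (grad f x) v).
Proof.
move=> df; apply: DeriveDef; first exact: diff_derivable.
rewrite deriveE // [in LHS](row_sum_delta v) linear_sum /=; apply: eq_bigr => i _.
by rewrite linearZ /= !mxE /partial deriveE // mulrC.
Qed.

Lemma line_derive f x v t : differentiable f (x + t *: v) ->
  is_derive t 1 (fun s => f (x + s *: v)) (dot (grad f (x + t *: v)) v).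
Proof. by move=> df; apply: is_derive_line; exact: derive_grad. Qed.

Lemma line_derive2 f x v : (forall i, differentiable (partial i f) x) ->
  is_derive (0 : R) 1 (fun s => dot (grad f (x + s *: v)) v) (dot (v *m hess f x) v).
Proof.
move=> df.
have -> : (fun s => dot (grad f (x + s *: v)) v) =
    \sum_(i < n) (v 0 i *: (fun s => partial i f (x + s *: v))).
  apply/funext => s; rewrite fct_sumE; apply: eq_bigr => i _.
  by rewrite mxE mulrC.
have D i : is_derive (0 : R) 1 (v 0 i *: (fun s => partial i f (x + s *: v)))
    (v 0 i *: dot (grad (partial i f) x) v).
  apply: is_deriveZ; have := @line_derive (partial i f) x v 0; rewrite scale0r addr0.
  exact.
apply: is_derive_eq.
rewrite /dot; under [RHS]eq_bigr => j _ do rewrite mxE mulr_suml.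
rewrite [RHS]/=; apply: eq_bigr => i _; rewrite /GRing.scale /= mulr_sumr.
apply: eq_bigr => j _; rewrite !mxE; ring.
Qed.

(** [g'] is assumed differentiable at 0 alone. If [c] were positive, [g'] would be positive just to
    the right of its zero at 0, and the mean value theorem would lift [g] above [g 0]. *)
Lemma second_order_test (g g' : R -> R) (c : R) :
  (\forall t \near (0 : R), is_derive (t : R) (1 : R) g (g' t)) -> is_derive (0 : R) 1 g' c ->
  (\forall t \near (0 : R), g t <= g 0) -> c <= 0.
Proof.
move=> [e1 /= e10 H1] dg' [e2 /= e20 H2].
rewrite leNgt; apply/negP => c0.
pose e := Num.min e1 e2; have e0 : 0 < e by rewrite lt_min e10.
have in_e (t : R) : `|t| < e -> is_derive t 1 g (g' t) /\ g t <= g 0.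
  rewrite lt_min => /andP[t1 t2]; split; [apply: H1|apply: H2];
    by rewrite /= sub0r normrN.
have g'0 : g' 0 = 0.
  have d0 : is_derive (0 : R) 1 g 0.
    apply: (@derive1_at_max _ _ (- e) e).
    - lra.
    - move=> t; rewrite in_itv /= -ltr_norml => te; have [dt _] := in_e t te.
      exact: (@ex_derive _ _ _ _ _ _ _ dt).
    - by rewrite in_itv /= oppr_lt0 e0.
    - by move=> t; rewrite in_itv /= -ltr_norml => te; have [] := in_e t te.
  have z : `|0 : R| < e by rewrite normr0.
  have [d1 _] := in_e 0 z.
  by rewrite -(@derive_val _ _ _ _ _ _ _ d1) (@derive_val _ _ _ _ _ _ _ d0).
have lim : (fun h : R => h^-1 *: ((g' \o shift 0) (h *: 1) - g' 0)) @ 0^' --> c.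
  rewrite -(@derive_val _ _ _ _ _ _ _ dg'); exact: (@ex_derive _ _ _ _ _ _ _ dg').
have := lim _ (lt_nbhsr c0) => -[e3 /= e30 H3].
have pos (h : R) : 0 < h -> h < e3 -> 0 < g' h.
  move=> h0 h3; have := H3 h; rewrite /= sub0r normrN gtr0_norm // => /(_ h3).
  rewrite gt_eqF // => /(_ isT); rewrite g'0 subr0 addr0 /GRing.scale /= mulr1.
  by rewrite pmulr_rgt0 // invr_gt0.
pose t := Num.min e e3 / 2.
have m0 : 0 < Num.min e e3 by rewrite lt_min e0.
have t0 : 0 < t by rewrite divr_gt0.
have tm : t < Num.min e e3 by rewrite ltr_pdivrMr // ltr_pMr // ltr1n.
have [te t3] : t < e /\ t < e3 by move: tm; rewrite lt_min => /andP.
have cont : {within `[0, t], continuous g}.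
  apply: continuous_in_subspaceT => s; rewrite inE /= in_itv /= => /andP[s0 st].
  have [ds _] : is_derive s 1 g (g' s) /\ g s <= g 0.
    by apply: in_e; rewrite ger0_norm // (le_lt_trans st).
  by apply: differentiable_continuous; apply/derivable1_diffP; exact: (@ex_derive _ _ _ _ _ _ _ ds).
have [|s] := @MVT R g g' 0 t t0 _ cont.
  move=> s; rewrite in_itv /= => /andP[s0 st].
  by have [] := in_e s; rewrite ?gtr0_norm // (lt_trans st).
rewrite in_itv /= => /andP[s0 st] E.
have gs : 0 < g' s by apply: pos => //; exact: lt_trans t3.
have [_ gt] : is_derive t 1 g (g' t) /\ g t <= g 0 by apply: in_e; rewrite gtr0_norm.
have : 0 < g t - g 0 by rewrite E subr0 mulr_gt0.
by rewrite subr_gt0 ltNge gt.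
Qed.

End Line.

Section Calculus.
Context (R : realType) (n : nat).
Implicit Types (f g : 'rV[R]_n -> R) (x y v w : 'rV[R]_n).

Lemma segment_mvt f x v : (forall t, 0 <= t <= 1 -> differentiable f (x + t *: v)) ->
  exists2 t, 0 <= t <= 1 & f (x + v) - f x = dot (grad f (x + t *: v)) v.
Proof.
move=> df; pose g t := f (x + t *: v).
have dg (t : R) : 0 <= t <= 1 -> is_derive t 1 g (dot (grad f (x + t *: v)) v).
  by move=> t01; apply: line_derive; exact: df.
have cont : {within `[0, 1], continuous g}.
  apply: continuous_in_subspaceT => t; rewrite inE /= in_itv /= => t01.
  apply: differentiable_continuous; apply/derivable1_diffP.
  exact: (@ex_derive _ _ _ _ _ _ _ (dg t t01)).
have [|t] := @MVT_segment R g (fun t => dot (grad f (x + t *: v)) v) 0 1 ler01 _ cont.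
  by move=> t; rewrite in_itv /= => /andP[/ltW t0 /ltW t1]; apply: dg; rewrite t0.
rewrite in_itv /= => t01; rewrite /g scale1r scale0r addr0 subr0 mulr1 => E.
by exists t.
Qed.

Lemma segment_lipschitz f x y G : (forall t, 0 <= t <= 1 -> differentiable f (x + t *: (y - x))) ->
  (forall t, 0 <= t <= 1 -> enorm (grad f (x + t *: (y - x))) <= G) ->
  `|f y - f x| <= G * enorm (y - x).
Proof.
move=> df Gf; have [t t01] := segment_mvt df.
have -> : x + (y - x) = y by rewrite addrC subrK.
move=> ->.
apply: le_trans (cauchy_schwarz_norm _ _) _.
by rewrite ler_wpM2r ?enorm_ge0 // Gf.
Qed.

Lemma differentiable_taylor f x e : differentiable f x -> 0 < e ->
  exists2 d, 0 < d & forall w, enorm w < d ->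
    `|f (x + w) - f x - dot (grad f x) w| <= e * enorm w.
Proof.
move=> df e0; have dfE w : 'd f x w = dot (grad f x) w.
  by rewrite -deriveE // (@derive_val _ _ _ _ _ _ _ (derive_grad w df)).
have /eqaddoP/(_ e e0) := diff_locally df.
move=> /nbhs_enorm[d d0 H]; exists d => // w wd.
have := H w; rewrite subr0 => /(_ wd) /=.
rewrite !fctE /= -dfE => h; rewrite [x + w]addrC.
have -> : f (w + x) - f x - 'd f x w = f (w + x) - (f x + 'd f x w) by rewrite opprD addrA.
apply: le_trans h _; apply: ler_wpM2l; [exact: ltW|exact: norm_le_enorm].
Qed.

Lemma enorm_delta (i : 'I_n) : enorm (delta_mx 0 i : 'rV[R]_n) = 1.
Proof.
rewrite enormE /dot (bigD1 i) //= mxE !eqxx mulr1 big1 ?addr0 ?sqrtr1 // => j ji.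
by rewrite mxE (negbTE ji) andbF mulr0.
Qed.

Lemma dot_delta v (i : 'I_n) : dot v (delta_mx 0 i) = v 0 i.
Proof.
rewrite /dot (bigD1 i) //= mxE !eqxx mulr1 big1 ?addr0 // => j ji.
by rewrite mxE (negbTE ji) andbF mulr0.
Qed.

(* The second difference of [f], as an increment of [s |-> f (x+s e_i+h e_j) - f (x+s e_i)]. *)
Lemma second_difference f x (i j : 'I_n) d e h
    (a := h *: delta_mx 0 i : 'rV[R]_n) (b := h *: delta_mx 0 j : 'rV[R]_n) :
  0 < d -> 0 < e -> (forall w, enorm w < d -> differentiable f (x + w)) ->
  (forall w, enorm w < d ->
     `|partial i f (x + w) - partial i f x - dot (grad (partial i f) x) w| <= e * enorm w) ->
  0 < h -> 2 * h < d ->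
  `|f (x + a + b) - f (x + a) - (f (x + b) - f x) - h ^+ 2 * partial j (partial i f) x|
    <= 3 * e * h ^+ 2.
Proof.
move=> d0 e0 df H h0 hd.
have na t : 0 <= t <= 1 -> enorm (t *: a) <= h.
  move=> /andP[t0 t1]; rewrite !enormZ enorm_delta mulr1 (ger0_norm t0) (gtr0_norm h0).
  by rewrite ler_piMl // ltW.
have nb : enorm b = h by rewrite enormZ enorm_delta mulr1 gtr0_norm.
have nab t : 0 <= t <= 1 -> enorm (t *: a + b) <= 2 * h.
  by move=> t01; apply: le_trans (ler_enormD _ _) _; rewrite nb mulr_natl mulr2n lerD2r na.
have hd' : h < d by lra.
pose g := fun s => f (x + b + s *: a) - f (x + s *: a).
have dg (t : R) : 0 <= t <= 1 -> is_derive t 1 g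
    (h * (partial i f (x + (t *: a + b)) - partial i f (x + t *: a))).
  move=> t01.
  have d1 : is_derive t 1 (fun s => f (x + b + s *: a)) (dot (grad f (x + b + t *: a)) a).
    apply: line_derive; rewrite -addrA [b + _]addrC.
    by apply: df; apply: le_lt_trans (nab _ t01) _.
  have d2 : is_derive t 1 (fun s => f (x + s *: a)) (dot (grad f (x + t *: a)) a).
    by apply: line_derive; apply: df; apply: le_lt_trans (na _ t01) _.
  apply: is_derive_eq; rewrite !dotZr !dot_delta !mxE mulrBr.
  by rewrite -addrA [b + _]addrC.
have cont : {within `[0, 1], continuous g}.
  apply: continuous_in_subspaceT => t; rewrite inE /= in_itv /= => t01.
  apply: differentiable_continuous; apply/derivable1_diffP.
  exact: (@ex_derive _ _ _ _ _ _ _ (dg t t01)).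
have [|t] := @MVT_segment R g
    (fun t => h * (partial i f (x + (t *: a + b)) - partial i f (x + t *: a))) 0 1 ler01 _ cont.
  by move=> t; rewrite in_itv /= => /andP[/ltW t0 /ltW t1]; apply: dg; rewrite t0.
rewrite in_itv /= => t01; rewrite /g scale1r !scale0r !addr0 subr0 mulr1 => E.
have -> : f (x + a + b) - f (x + a) - (f (x + b) - f x) =
    f (x + b + a) - f (x + a) - (f (x + b) - f x) by rewrite [x + a + b]addrAC.
rewrite E.
have := H _ (le_lt_trans (nab _ t01) hd); have := H _ (le_lt_trans (na _ t01) hd').
have -> : dot (grad (partial i f) x) (t *: a + b) =
    dot (grad (partial i f) x) (t *: a) + h * partial j (partial i f) x.
  by rewrite dotDr; congr (_ + _); rewrite /b dotZr dot_delta mxE.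
set A := partial i f (x + t *: a); set B := partial i f (x + (t *: a + b)).
set C := partial i f x; set D := dot _ _; set P := partial j _ _ => h1 h2.
have {}h1 : `|A - C - D| <= e * h by apply: le_trans h1 _; rewrite ler_pM2l // na.
have {}h2 : `|B - C - (D + h * P)| <= e * (2 * h) by apply: le_trans h2 _; rewrite ler_pM2l // nab.
have -> : h * (B - A) - h ^+ 2 * P = h * ((B - C - (D + h * P)) - (A - C - D)) by ring.
rewrite normrM (gtr0_norm h0).
have : `|(B - C - (D + h * P)) - (A - C - D)| <= 3 * e * h.
  by apply: le_trans (ler_normB _ _) _; lra.
move=> h3; have := ler_wpM2l (ltW h0) h3.
by have -> : 3 * e * h ^+ 2 = h * (3 * e * h) by ring.
Qed.

(** The second difference of step [h] is symmetric in the two directions and approximates [h^2]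
    times either mixed derivative with an error of order [e h^2]. *)
Lemma hess_sym f x d : 0 < d -> (forall w, enorm w < d -> differentiable f (x + w)) ->
  (forall i, differentiable (partial i f) x) -> (hess f x)^T = hess f x.
Proof.
move=> d0 df d2f; apply/matrixP => i j; rewrite !mxE.
apply/eqP; rewrite eq_sym -subr_eq0 -normr_le0; apply/ler_addgt0Pr => e e0; rewrite add0r.
have e6 : 0 < e / 6 by rewrite divr_gt0.
have [d1 d10 H1] := differentiable_taylor (d2f i) e6.
have [d2 d20 H2] := differentiable_taylor (d2f j) e6.
pose m := Num.min d (Num.min d1 d2).
have m0 : 0 < m by rewrite !lt_min d0 d10.
pose h := m / 3; have h0 : 0 < h by rewrite divr_gt0.
have hm : 2 * h < m by rewrite /h; lra.
have [md [m1 m2]] : m <= d /\ m <= d1 /\ m <= d2.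
  by rewrite /m !ge_min !lexx /= !orbT.
have S1 := @second_difference f x i j m (e / 6) h m0 e6 _ _ h0 hm.
have S2 := @second_difference f x j i m (e / 6) h m0 e6 _ _ h0 hm.
have {}S1 := S1 (fun w wm => df w (lt_le_trans wm md)) (fun w wm => H1 w (lt_le_trans wm m1)).
have {}S2 := S2 (fun w wm => df w (lt_le_trans wm md)) (fun w wm => H2 w (lt_le_trans wm m2)).
move: S1 S2 => /=; set a := h *: _; set b := h *: _.
set P := partial j _ _; set Q := partial i _ _.
have -> : x + b + a = x + a + b by rewrite addrAC.
set X := f (x + a + b); set Y := f (x + a); set Z := f (x + b); set W := f x => S1 S2.
have : `|h ^+ 2 * (P - Q)| <= e * h ^+ 2.
  have -> : h ^+ 2 * (P - Q) = (X - Z - (Y - W) - h ^+ 2 * Q) - (X - Y - (Z - W) - h ^+ 2 * P).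
    by ring.
  have -> : e * h ^+ 2 = 3 * (e / 6) * h ^+ 2 + 3 * (e / 6) * h ^+ 2 by field.
  exact: le_trans (ler_normB _ _) (lerD S2 S1).
have h2 : 0 < h ^+ 2 by rewrite exprn_gt0.
rewrite normrM (gtr0_norm h2) mulrC (ler_pM2r h2) => PQ.
by move: PQ; clearbody P Q; rewrite distrC.
Qed.

End Calculus.

Lemma is_derive_quadratic (R : realType) (a0 a1 a2 t : R) :
  is_derive t 1 (fun s : R => a0 + a1 * s + a2 * s ^+ 2) (a1 + 2 * a2 * t).
Proof.
pose p : {poly R} := a0%:P + a1 *: 'X + a2 *: 'X^2.
have -> : (fun s : R => a0 + a1 * s + a2 * s ^+ 2) = horner p.
  by apply/funext => s; rewrite /p !hornerE.
have -> : a1 + 2 * a2 * t = p^`().[t].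
  rewrite /p !derivD derivC !derivZ derivX derivXn !hornerE /= mulr_natl; ring.
exact: is_derive_poly.
Qed.

Lemma is_derive_affine (R : realType) (a0 a1 t : R) :
  is_derive t 1 (fun s : R => a0 + a1 * s) a1.
Proof.
have := is_derive_quadratic a0 a1 0 t.
have -> : (fun s : R => a0 + a1 * s + 0 * s ^+ 2) = (fun s => a0 + a1 * s).
  by apply/funext => s; rewrite mul0r addr0.
by rewrite mulr0 mul0r addr0.
Qed.

(** * Second derivatives of the barrier *)

Section Barrier.
Context (R : realType) (n : nat).
Implicit Types (x y v : 'rV[R]_n).

(** [d2] is [delta^2] in the doubling argument; [d2 = 0] gives the power [|y|^(2 b)] of the case
    [2 k > n]. *)
Definition barrier (b d2 : R) y : R := powR (dot y y + d2) b.

Lemma dot_line y v (t : R) : dot (y + t *: v) (y + t *: v) =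
  dot y y + 2 * dot y v * t + dot v v * t ^+ 2.
Proof. by rewrite dotDl !dotDr !dotZl !dotZr (dotC v y); ring. Qed.

(** The Hessian is [q (1 - th y^T y)], the form expected by [mcone_add_barrier] and
    [barrier_not_above]. Only the second derivative matters later, so the first one stays
    existential. *)
Lemma barrier_line b d2 y v : 0 < dot y y + d2 ->
  let q := 2 * b * powR (dot y y + d2) (b - 1) in
  let th := 2 * (1 - b) / (dot y y + d2) in
  exists g' : R -> R,
    (\forall t \near (0 : R), is_derive (t : R) (1 : R) (fun s : R => barrier b d2 (y + s *: v)) (g' t)) /\
    is_derive (0 : R) (1 : R) g' (q * (dot v v - th * dot v y ^+ 2)).
Proof.
set r0 := dot y y + d2 => r0p q th.
pose r (t : R) := r0 + 2 * dot y v * t + dot v v * t ^+ 2.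
have rE s : dot (y + s *: v) (y + s *: v) + d2 = r s.
  by rewrite dot_line /r /r0; ring.
have dr (t : R) : is_derive t 1 r (2 * dot y v + 2 * dot v v * t).
  have := is_derive_quadratic r0 (2 * dot y v) (dot v v) t; exact.
have r_pos : \forall t \near (0 : R), 0 < r t.
  have cr : {for 0, continuous r}.
    apply: differentiable_continuous; apply/derivable1_diffP.
    exact: (@ex_derive _ _ _ _ _ _ _ (dr 0)).
  have h : \forall z \near r 0, 0 < z.
    by apply: lt_nbhsr; rewrite /r mulr0 expr0n mulr0 !addr0.
  exact: (cr _ h).
have dpow a (t : R) : 0 < r t ->
    is_derive t 1 (fun s => powR (r s) a) (a * powR (r t) (a - 1) * (2 * dot y v + 2 * dot v v * t)).
  by move=> rt; exact: (@is_derive1_comp _ (@powR R ^~ a) r t _ _ (is_derive1_powR a rt) (dr t)).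
exists (fun t => b * powR (r t) (b - 1) * (2 * dot y v + 2 * dot v v * t)); split.
  apply: filterS r_pos => t rt.
  have -> : (fun s : R => barrier b d2 (y + s *: v)) = (fun s => powR (r s) b).
    by apply/funext => s; rewrite /barrier rE.
  exact: dpow.
have r00 : r 0 = r0 by rewrite /r mulr0 expr0n mulr0 !addr0.
have d1 := dpow (b - 1) 0 _; rewrite r00 in d1.
have -> : (fun t => b * powR (r t) (b - 1) * (2 * dot y v + 2 * dot v v * t)) =
    (b *: (fun t => powR (r t) (b - 1))) * (fun t => 2 * dot y v + 2 * dot v v * t).
  by apply/funext => t.
have d2' := is_deriveM (is_deriveZ b (d1 r0p)) (is_derive_affine (2 * dot y v) (2 * dot v v) 0).
apply: (is_derive_eq d2').
have -> : powR r0 (b - 1 - 1) = powR r0 (b - 1) / r0.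
  rewrite powRB; last by rewrite (gt_eqF r0p) implybT.
  by rewrite powRr1 // ltW.
have -> : q * (dot v v - th * dot v y ^+ 2) = b * powR (r 0) (b - 1) * (2 * dot v v) +
    (2 * dot y v + 2 * dot v v * 0) *
    (b * ((b - 1) * (powR r0 (b - 1) / r0) * (2 * dot y v + 2 * dot v v * 0))).
  by rewrite r00 /q /th (dotC v y); field; rewrite gt_eqF.
by [].
Qed.

End Barrier.

(** * Oscillation decay by doubling of variables *)

Section Doubling.
Context (R : realType) (n : nat).
Implicit Types (x y z v e xi eta : 'rV[R]_n) (u : 'rV[R]_n -> R).

Lemma near_line v d : 0 < d -> \forall t \near (0 : R), enorm (t *: v) < d.
Proof.
move=> d0; have v0 := enorm_ge0 v; have v1 : 0 < enorm v + 1 by lra.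
exists (d / (enorm v + 1)) => /=; first by rewrite divr_gt0.
move=> t /=; rewrite sub0r normrN enormZ ltr_pdivlMr // => h.
by apply: le_lt_trans h; rewrite ler_wpM2l // lerDl.
Qed.

Lemma second_order_test_combo (f1 f2 f3 f1' f2' f3' : R -> R) (c1 c2 c3 L r m B A c a0 a1 a2 : R) :
  (\forall t \near (0 : R), is_derive (t : R) (1 : R) f1 (f1' t)) ->
  (\forall t \near (0 : R), is_derive (t : R) (1 : R) f2 (f2' t)) ->
  (\forall t \near (0 : R), is_derive (t : R) (1 : R) f3 (f3' t)) ->
  is_derive (0 : R) 1 f1' c1 -> is_derive (0 : R) 1 f2' c2 -> is_derive (0 : R) 1 f3' c3 ->
  let g (t : R) := f1 t - f2 t - (L * (r + t * m) - B * (r + t * m) ^+ 2)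
     + (A * f3 t - c * (a0 + a1 * t + a2 * t ^+ 2)) in
  (\forall t \near (0 : R), g t <= g 0) ->
  c1 - c2 + 2 * B * m ^+ 2 + A * c3 - 2 * c * a2 <= 0.
Proof.
move=> n1 n2 n3 d1 d2 d3 g gmax.
pose q1 (s : R) := (L * r - B * r ^+ 2) + (L * m - 2 * B * r * m) * s + (- (B * m ^+ 2)) * s ^+ 2.
pose q2 (s : R) := a0 + a1 * s + a2 * s ^+ 2.
pose q1' (s : R) := (L * m - 2 * B * r * m) + 2 * (- (B * m ^+ 2)) * s.
pose q2' (s : R) := a1 + 2 * a2 * s.
have gE : g = f1 - f2 - q1 + (A *: f3 - c *: q2).
  by apply/funext => s; rewrite /g /q1 /q2 !fctE /GRing.scale /=; ring.
have combine (t : R) (h1 h2 h3 p1 p2 : R -> R) b1 b2 b3 b4 b5 :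
    is_derive t 1 h1 b1 -> is_derive t 1 h2 b2 -> is_derive t 1 h3 b3 ->
    is_derive t 1 p1 b4 -> is_derive t 1 p2 b5 ->
    is_derive t 1 (h1 - h2 - p1 + (A *: h3 - c *: p2)) (b1 - b2 - b4 + (A * b3 - c * b5)).
  move=> e1 e2 e3 e4 e5.
  exact: (is_deriveD (is_deriveB (is_deriveB e1 e2) e4) (is_deriveB (is_deriveZ A e3) (is_deriveZ c e5))).
pose g' := f1' - f2' - q1' + (A *: f3' - c *: q2').
have near_g' : \forall t \near (0 : R), is_derive (t : R) (1 : R) g (g' t).
  apply: filterS3 n1 n2 n3 => t h1 h2 h3; rewrite gE.
  by apply: combine => //; exact: is_derive_quadratic.
have dg' : is_derive (0 : R) 1 g' (c1 - c2 - 2 * (- (B * m ^+ 2)) + (A * c3 - c * (2 * a2))).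
  by apply: combine => //; exact: is_derive_affine.
clearbody g g'.
have := second_order_test near_g' dg' gmax.
by congr (_ <= _); ring.
Qed.

(** [r + t * m] is the distance between the two moving points; this is its true value near [t = 0]
    when [xi - eta] is [m] times the unit vector along [x - y]. *)
Lemma doubling_test u x y xi eta m r L B A c b d2 : 0 < dot y y + d2 ->
  (\forall t \near (0 : R), differentiable u (x + t *: xi)) ->
  (\forall t \near (0 : R), differentiable u (y + t *: eta)) ->
  (forall i, differentiable (partial i u) x) ->
  (forall i, differentiable (partial i u) y) ->
  let g (t : R) := u (x + t *: xi) - u (y + t *: eta) - (L * (r + t * m) - B * (r + t * m) ^+ 2)
     + (A * barrier b d2 (y + t *: eta) - c * dot (y + t *: eta) (y + t *: eta)) in
  (\forall t \near (0 : R), g t <= g 0) ->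
  dot (xi *m hess u x) xi - dot (eta *m hess u y) eta + 2 * B * m ^+ 2 +
   A * (2 * b * powR (dot y y + d2) (b - 1) *
        (dot eta eta - 2 * (1 - b) / (dot y y + d2) * dot eta y ^+ 2)) - 2 * c * dot eta eta <= 0.
Proof.
move=> rp dx dy d2x d2y g gmax.
have [w' [dw d2w]] := @barrier_line R n b d2 y eta rp.
apply: (@second_order_test_combo (fun t => u (x + t *: xi)) (fun t => u (y + t *: eta))
  (fun t => barrier b d2 (y + t *: eta)) (fun t => dot (grad u (x + t *: xi)) xi)
  (fun t => dot (grad u (y + t *: eta)) eta) w' _ _ _ L r m B A c (dot y y) (2 * dot y eta)
  (dot eta eta)).
- by apply: filterS dx => t; exact: line_derive.
- by apply: filterS dy => t; exact: line_derive.
- exact: dw.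
- exact: line_derive2.
- exact: line_derive2.
- apply: filterS gmax => t; rewrite /g /= !dot_line !scale0r !addr0.
  by rewrite mulr0 expr0n mulr0 !addr0.
Qed.

Lemma Smx_conj (P M : 'M[R]_n) j : P *m P^T = 1%:M -> Smx j (P^T *m M *m P) = Smx j M :> R.
Proof. by move=> PP; rewrite /Smx (@det_conj R n). Qed.

Definition reflection e : 'M[R]_n := 1%:M - 2 *: (e^T *m e).

Lemma reflection_sym e : (reflection e)^T = reflection e.
Proof. by rewrite /reflection linearB /= trmx1 linearZ /= trmx_mul trmxK. Qed.

Lemma mul_reflection v e : v *m reflection e = v - (2 * dot v e) *: e.
Proof.
by rewrite mulmxBr mulmx1 -scalemxAr mulmxA mulmx_tr mul_scalar_mx scalerA.
Qed.

Lemma reflection_orth e : dot e e = 1 -> reflection e *m (reflection e)^T = 1%:M.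
Proof.
move=> e1; rewrite reflection_sym /reflection; set W := e^T *m e.
have WW : W *m W = W.
  by rewrite /W -mulmxA [e *m (_ *m _)]mulmxA mulmx_tr e1 mul1mx.
rewrite mulmxBl mul1mx mulmxBr mulmx1 -!scalemxAl -!scalemxAr WW.
rewrite opprB scalerA; have -> : 2 * 2 = 2 + 2 :> R by ring.
by rewrite [(2 + 2) *: W]scalerDl addrK subrK.
Qed.

Lemma sym_scalar_rank1 (M : 'M[R]_n) a b' v : M^T = M ->
  (M + a%:M + b' *: (v^T *m v))^T = M + a%:M + b' *: (v^T *m v).
Proof.
by move=> symM; rewrite [LHS]linearD /= linearD /= symM tr_scalar_mx linearZ /= trmx_mul trmxK.
Qed.

(* [M] and [N] stand for [D^2 u x] and [D^2 u y], [e] for the direction of [x - y], and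
   [q (1 - th y^T y)] for the Hessian of the barrier at [y]. *)
Lemma reflected_barrier_bound k (M N : 'M[R]_n) e p q th y b :
  (0 < k <= n)%N -> M^T = M -> N^T = N -> mcone k M -> dot e e = 1 ->
  0 <= p -> dot (e *m M) e <= - p -> 0 <= q -> 0 <= b -> 0 <= th ->
  th * dot y y * k%:R <= (1 - b) * n%:R ->
  (forall eta, let xi := eta *m reflection e in
    dot (xi *m M) xi + 4 * p * dot eta e ^+ 2 - perturb_eps R n * p * dot eta eta +
      q * (dot eta eta - th * dot eta y ^+ 2) <= dot (eta *m N) eta) ->
  b * q ^+ k <= Smx k N.
Proof.
move=> kn symM symN Mk e1 p0 eM q0 b0 th0 thy H.
have [k0 kn'] := andP kn.
have RR := reflection_orth e1; have Rs := reflection_sym e.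
pose M' : 'M[R]_n := (reflection e)^T *m M *m reflection e.
have symM' : M'^T = M' by rewrite /M' !trmx_mul trmxK symM mulmxA.
have M'k : mcone k M' by move=> j jk; rewrite Smx_conj //; exact: Mk.
have M'E eta : dot (eta *m M') eta = dot (eta *m reflection e *m M) (eta *m reflection e).
  by rewrite /M' -!dotE trmx_mul Rs !mulmxA.
have eR : e *m reflection e = - e.
  by rewrite mul_reflection e1 mulr1 scaler_nat mulr2n opprD addrA subrr sub0r.
have eM' : dot (e *m M') e <= - p by rewrite M'E eR mulNmx dotNl dotNr opprK.
have Xk := mcone_perturb kn' symM' M'k e1 p0 eM'.
set X := _ + _ in Xk.
have symX : X^T = X by exact: sym_scalar_rank1.
have [Yk Yb] := mcone_add_barrier kn symX Xk q0 b0 th0 thy.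
apply: le_trans Yb _; apply: (mcone_le kn') => //.
  exact: sym_scalar_rank1.
move=> eta; apply: le_trans (H eta); rewrite /= -M'E.
have sq v : dot (eta *m (v^T *m v)) eta = dot eta v ^+ 2.
  by rewrite mulmxA mulmx_tr mul_scalar_mx dotZl (dotC v) expr2.
rewrite !mulmxDr !dotDl -!scalemxAr !dotZl !sq !mul_mx_scalar !dotZl.
set a := dot (eta *m M') eta; lra.
Qed.

End Doubling.

(** The doubled variables are stored as [p = (x - y, y)], so that the constraints on the distance
    and on [y] form a product of two balls. *)
Lemma continuous_pair_fun (R : realType) (V : normedModType R) (u w phi : V -> R) (p : V * V) :
  {for p.2 + p.1, continuous u} -> {for p.2, continuous u} ->
  {for p.1, continuous phi} -> {for p.2, continuous w} ->
  {for p, continuous (fun p : V * V => u (p.2 + p.1) - u p.2 - phi p.1 + w p.2)}.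
Proof.
move=> c1 c2 c3 c4.
have f1 : {for p, continuous (fun q : V * V => q.1)} by exact: cvg_fst.
have f2 : {for p, continuous (fun q : V * V => q.2)} by exact: cvg_snd.
have f3 : {for p, continuous (fun q : V * V => q.2 + q.1)} by exact: continuousD.
have g1 := continuous_comp f3 c1; have g2 := continuous_comp f2 c2.
have g3 := continuous_comp f1 c3; have g4 := continuous_comp f2 c4.
exact: (continuousD (continuousB (continuousB g1 g2) g3) g4).
Qed.

Lemma powR_subadd (R : realType) (a c b : R) : 0 <= a -> 0 <= c -> 0 <= b <= 1 ->
  powR (a + c) b <= powR a b + powR c b.
Proof.
move=> a0 c0 /andP[b0 b1].
have [/eqP|ac] := eqVneq (a + c) 0.
  by rewrite paddr_eq0 // => /andP[/eqP-> /eqP->]; rewrite addr0 lerDl powR_ge0.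
have acp : 0 < a + c by rewrite lt0r ac addr_ge0.
have h t : 0 <= t -> t <= a + c -> t / (a + c) * powR (a + c) b <= powR t b.
  move=> t0 tac; have -> : powR t b = powR (t / (a + c)) b * powR (a + c) b.
    by rewrite -(powRM _ (divr_ge0 t0 (ltW acp)) (ltW acp)) divfK.
  apply: ler_wpM2r; first exact: powR_ge0.
  have [->|tn0] := eqVneq t 0; first by rewrite mul0r powR_ge0.
  have tp : 0 < t by rewrite lt0r tn0.
  by apply: ger1_powR => //; rewrite divr_gt0 //= ler_pdivrMr // mul1r.
have -> : powR (a + c) b = a / (a + c) * powR (a + c) b + c / (a + c) * powR (a + c) b.
  by rewrite -mulrDl -mulrDl divff // mul1r.
by apply: lerD; apply: h => //; rewrite ?lerDl ?lerDr.
Qed.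

(** * The doubling estimate on one ball *)

Section DoublingEstimate.
Context (R : realType) (n : nat).
Implicit Types (x y z v e xi eta : 'rV[R]_n) (u : 'rV[R]_n -> R).

(** Pointwise facts near the origin, phrased with [Smx] so that no eigenvalues need to be chosen;
    [F] stands for an upper bound of [f]. *)
Record local_solution k (s F d2 r1 : R) u : Prop := LocalSolution {
  sol_diff : forall x, enorm x < r1 -> differentiable u x;
  sol_diff2 : forall x, enorm x < r1 -> forall i, differentiable (partial i u) x;
  sol_sym : forall x, enorm x < r1 -> (hess u x)^T = hess u x;
  sol_cone : forall x, enorm x < r1 -> mcone k (hess u x);
  sol_rhs : forall x, enorm x < r1 ->
    Smx k (hess u x) <= (F * powR (dot x x + d2) s) ^+ k }.

(** As [s + 1 - b >= 0] and [r <= 2], [r^s <= 2^(s+1-b) r^(b-1)]. [A] is defined by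
    [2 b^2 A = (F + 1) 2^(s+1-b)], where the added 1 gives strictness, and the factor [b] outside
    the power suffices because [b^k <= b]. *)
Lemma barrier_beats_rhs k (s F b r : R) (A := (F + 1) * powR 2 (s + 1 - b) / (2 * b ^+ 2)) :
  (0 < k)%N -> 0 <= F -> 0 < b < 1 -> b <= s + 1 -> 0 < r <= 2 ->
  (F * powR r s) ^+ k < b * (A * (2 * b * powR r (b - 1))) ^+ k.
Proof.
move=> k0 F0 /andP[b0 b1] bs /andP[r0 r2].
have p0 : 0 < powR r (b - 1) by exact: powR_gt0.
have rs : powR r s <= powR 2 (s + 1 - b) * powR r (b - 1).
  have -> : s = (s + 1 - b) + (b - 1) by ring.
  rewrite powRD; last by rewrite (gt_eqF r0) implybT.
  have -> : s + 1 - b + (b - 1) + 1 - b = s + 1 - b by ring.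
  apply: ler_wpM2r; first exact: ltW.
  by apply: ge0_ler_powR; rewrite ?nnegrE ?subr_ge0 // ltW.
have t0 : 0 < powR 2 (s + 1 - b) :> R by exact: powR_gt0.
have E : b * (A * (2 * b * powR r (b - 1))) = (F + 1) * (powR 2 (s + 1 - b) * powR r (b - 1)).
  by rewrite /A; field; rewrite gt_eqF.
have lt : F * powR r s < b * (A * (2 * b * powR r (b - 1))).
  rewrite E; apply: (@le_lt_trans _ _ (F * (powR 2 (s + 1 - b) * powR r (b - 1)))).
    exact: ler_wpM2l.
  by rewrite ltr_pM2r ?ltrDl // mulr_gt0.
have ge0 : 0 <= F * powR r s by rewrite mulr_ge0 // powR_ge0.
have lt' : (F * powR r s) ^+ k < (b * (A * (2 * b * powR r (b - 1)))) ^+ k.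
  by rewrite ltr_pXn2r ?nnegrE // (le_trans ge0) // ltW.
have A0 : 0 < A.
  apply: divr_gt0; first by apply: mulr_gt0 => //; lra.
  by apply: mulr_gt0 => //; exact: exprn_gt0.
apply: lt_le_trans lt' _; rewrite exprMn; apply: ler_wpM2r.
  by apply/exprn_ge0/ltW; do 3! [apply: mulr_gt0 => //].
by case: k k0 => // k _; rewrite exprS ler_piMr ?exprn_ile1 ?ltW.
Qed.

(** The first and last error terms are scale invariant multiples of [om], small once [x] and [y] lie
    in a much smaller ball. The middle term is a power of [rho] that does not see [d2]. *)
Lemma doubling_estimate k (s F d2 r1 b rho om : R) u
  (A := (F + 1) * powR 2 (s + 1 - b) / (2 * b ^+ 2)) (ep := perturb_eps R n) :
  (0 < k <= n)%N -> (2 * k <= n)%N -> 0 <= F -> 0 < b < 1 -> b <= s + 1 ->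
  0 < d2 <= 1 -> 0 < rho <= 1 -> rho < r1 -> 0 < om ->
  local_solution k s F d2 r1 u ->
  (forall x y, enorm x <= rho -> enorm y <= rho -> u x - u y <= om) ->
  forall x y, enorm y <= rho / 2 -> enorm (x - y) <= rho / 4 ->
  u x - u y <= (4 + ep^-1) * om / rho * enorm (x - y) + A * powR (rho ^+ 2) b
     + 4 * om / rho ^+ 2 * enorm y ^+ 2.
Proof.
move=> kn kn2 F0 b01 bs /andP[d20 d21] /andP[rho0 rho1] rhor om0 sol osc x1 y1 y1r zr.
have [b0 b1] := andP b01.
have ep0 : 0 < ep by rewrite invr_gt0 !mulr_gt0 // ltr0n expn_gt0.
set L := (4 + ep^-1) * om / rho; pose c := 4 * om / rho ^+ 2.
pose B := c / ep; pose wb := powR (rho ^+ 2 + d2) b.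
have c0 : 0 < c by rewrite divr_gt0 ?mulr_gt0 ?exprn_gt0.
have B0 : 0 < B by rewrite divr_gt0.
have A0 : 0 < A.
  apply: divr_gt0; last by apply: mulr_gt0 => //; exact: exprn_gt0.
  by apply: mulr_gt0; [lra|exact: powR_gt0].
(* These values of [L], [B] and [c] make the test function nonpositive where [|x - y| = rho / 4]
   or [|y| = rho / 2], which forces a positive maximum to be interior. *)
have LB : L * (rho / 4) - B * (rho / 4) ^+ 2 = om.
  by rewrite /L /B /c; field; rewrite !gt_eqF.
have LB' : B * (rho / 4) <= L.
  rewrite -subr_ge0 (_ : L - _ = 4 * om / rho); first by rewrite divr_ge0 ?mulr_ge0 ?ltW.
  by rewrite /L /B /c; field; rewrite !gt_eqF.
have cB : 2 * c = ep * (2 * B) by rewrite /B; field; rewrite gt_eqF.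
have cR : c * (rho / 2) ^+ 2 = om by rewrite /c; field; rewrite gt_eqF.
clearbody B.
pose phi z := L * enorm z - B * enorm z ^+ 2.
pose w y := A * (barrier b d2 y - wb) - c * dot y y.
pose Phi (p : 'rV[R]_n * 'rV[R]_n) := u (p.2 + p.1) - u p.2 - phi p.1 + w p.2.
pose K := [set z : 'rV[R]_n | enorm (z - 0) <= rho / 4] `*`
          [set y : 'rV[R]_n | enorm (y - 0) <= rho / 2].
have KP p : K p <-> enorm p.1 <= rho / 4 /\ enorm p.2 <= rho / 2.
  by rewrite /K /= !subr0.
have dot_le y : enorm y <= rho / 2 -> dot y y <= rho ^+ 2.
  move=> yr; rewrite -enorm_sqr ler_pXn2r ?nnegrE ?enorm_ge0 ?(ltW rho0) //.
  by move: yr rho0; clear; lra.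
have wle y : enorm y <= rho / 2 -> A * (barrier b d2 y - wb) <= 0.
  move=> yr; rewrite pmulr_rle0 // subr_le0; apply: ge0_ler_powR; first exact: ltW.
  - by rewrite nnegrE addr_ge0 ?dot_ge0 ?ltW.
  - by rewrite nnegrE addr_ge0 ?sqr_ge0 ?ltW.
  - by rewrite lerD2r dot_le.
have phige z : enorm z <= rho / 4 -> 0 <= phi z.
  move=> zr'; have -> : phi z = enorm z * (L - B * enorm z) by rewrite /phi; ring.
  rewrite mulr_ge0 ?enorm_ge0 // subr_ge0; apply: le_trans LB'.
  by rewrite ler_pM2l.
have inball p : K p -> enorm p.2 <= rho /\ enorm (p.2 + p.1) <= rho.
  move=> /KP[h1 h2]; have := ler_enormD p.2 p.1.
  by move: h1 h2 rho0; clear => *; split; lra.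
suff PhiN : Phi (x1 - y1, y1) <= 0.
  have xE : y1 + (x1 - y1) = x1 by rewrite addrC subrK.
  move: PhiN; rewrite /Phi /phi /w /= xE -enorm_sqr -/c.
  have b_lo : powR d2 b <= barrier b d2 y1.
    apply: ge0_ler_powR; rewrite ?nnegrE ?(ltW b0) ?(ltW d20) //.
      by rewrite addr_ge0 ?dot_ge0 ?ltW.
    by rewrite lerDr dot_ge0.
  (* Uniformity in [d2]: by subadditivity of the power, [wb] exceeds the barrier at [y1] by at most
     [(rho^2)^b]. *)
  have wb_hi : wb <= powR (rho ^+ 2) b + powR d2 b.
    by apply: powR_subadd; rewrite ?sqr_ge0 ?ltW // (ltW b0) ltW.
  have h1 : A * (wb - barrier b d2 y1) <= A * powR (rho ^+ 2) b.
    by rewrite ler_pM2l //; move: b_lo wb_hi; clear; lra.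
  have h2 : 0 <= B * enorm (x1 - y1) ^+ 2 by rewrite mulr_ge0 ?sqr_ge0 ?ltW.
  by move: h1 h2; clear; lra.
have K0 : K !=set0 by exists (x1 - y1, y1); apply/KP.
have cK : compact K by apply: compact_setX; exact: compact_eball.
have cu y : enorm y <= rho -> {for y, continuous u}.
  move=> yr; apply: differentiable_continuous; apply: (sol_diff sol).
  exact: le_lt_trans rhor.
have cphi : continuous phi.
  move=> z; have ce : {for z, continuous (fun z : 'rV[R]_n => enorm z)} by exact: enorm_continuous.
  have cc (a : R) : {for z, continuous (fun _ : 'rV[R]_n => a)} by exact: cst_continuous.
  exact: (continuousB (continuousM (cc L) ce) (continuousM (cc B) (continuousM ce ce))).
have cw : continuous w.
  move=> y; have cc (a : R) : {for y, continuous (fun _ : 'rV[R]_n => a)} by exact: cst_continuous.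
  have cd : {for y, continuous (fun y : 'rV[R]_n => dot y y)} by exact: dot_continuous.
  have cp : {for dot y y + d2, continuous (@powR R ^~ b)}.
    apply: differentiable_continuous; apply/derivable1_diffP.
    apply: (@ex_derive _ _ _ _ _ _ _ (is_derive1_powR b _)).
    by have := dot_ge0 y; move: d20; clear; lra.
  have cb : {for y, continuous (barrier b d2)}.
    exact: (continuous_comp (continuousD cd (cc d2)) cp).
  exact: (continuousB (continuousM (cc A) (continuousB cb (cc wb))) (continuousM (cc c) cd)).
have cPhi : {within K, continuous Phi}.
  apply: continuous_in_subspaceT => p /set_mem/inball[h1 h2].
  by apply: continuous_pair_fun; [exact: cu|exact: cu|exact: cphi|exact: cw].
have [[z y] /set_mem Kp pmax] := compact_EVT_max K0 cK cPhi.
have Kin : K (x1 - y1, y1) by apply/KP.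
apply: le_trans (pmax _ (mem_set Kin)) _; rewrite leNgt; apply/negP => Pos.
have [zr' yr'] := proj1 (KP _) Kp; rewrite /= in zr' yr'.
have [yb xb] := inball _ Kp; rewrite /= in yb xb.
have wy0 : w y <= 0.
  by rewrite /w; have := wle y yr'; have := mulr_ge0 (ltW c0) (dot_ge0 y); clear; lra.
have ox := osc _ _ xb yb.
(* A positive maximum avoids [z = 0], the singularity of the norm, since there [Phi] equals
   [w y <= 0]. *)
have z0 : 0 < enorm z.
  rewrite lt0r enorm_ge0 andbT; apply/negP => /eqP z0.
  by move: Pos; rewrite /Phi /phi /= z0 (enorm_eq0 z0) addr0; move: wy0; clear; lra.
have zlt : enorm z < rho / 4.
  rewrite lt_neqAle zr' andbT; apply/negP => /eqP zE.
  by move: Pos; rewrite /Phi /phi /= zE LB; move: wy0 ox; clear; lra.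
have ylt : enorm y < rho / 2.
  rewrite lt_neqAle yr' andbT; apply/negP => /eqP yE.
  have : w y <= - om by rewrite /w -enorm_sqr yE cR; have := wle y yr'; clear; lra.
  by move: Pos; rewrite /Phi /=; have := phige z zr'; move: ox; clear; lra.
have rp : 0 < dot y y + d2 by have := dot_ge0 y; move: d20; clear; lra.
set r := enorm z in z0 zlt *.
pose e := r^-1 *: z.
have e1 : dot e e = 1.
  by rewrite dotZl dotZr -enorm_sqr -/r; field; rewrite gt_eqF.
have zE : z = r *: e by rewrite scalerA mulfV ?scale1r // gt_eqF.
clearbody e.
have near_diff x v : enorm x <= rho -> \forall t \near (0 : R), differentiable u (x + t *: v).
  move=> xr; have rr : 0 < r1 - rho by rewrite subr_gt0.
  apply: filterS (near_line v rr) => t tv; apply: (sol_diff sol).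
  by apply: le_lt_trans (ler_enormD _ _) _; move: xr tv; clear; lra.
have test xi eta m : xi - eta = m *: e ->
  dot (xi *m hess u (y + z)) xi - dot (eta *m hess u y) eta + 2 * B * m ^+ 2 +
   A * (2 * b * powR (dot y y + d2) (b - 1) *
        (dot eta eta - 2 * (1 - b) / (dot y y + d2) * dot eta y ^+ 2)) - 2 * c * dot eta eta <= 0.
  move=> xe; apply: (@doubling_test R n u (y + z) y xi eta m r L B A c b d2 rp).
  - exact: near_diff.
  - exact: near_diff.
  - by apply: (sol_diff2 sol); exact: le_lt_trans rhor.
  - by apply: (sol_diff2 sol); exact: le_lt_trans rhor.
  have n1 : 0 < rho / 2 - enorm y by rewrite subr_gt0.
  have n2 : 0 < Num.min r (rho / 4 - r) by rewrite lt_min z0 subr_gt0.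
  apply: filterS2 (near_line eta n1) (near_line (xi - eta) n2) => t t1.
  rewrite lt_min => /andP[t2 t3].
  have e_norm : enorm e = 1 by rewrite enormE e1 sqrtr1.
  have zt : z + t *: (xi - eta) = (r + t * m) *: e.
    by rewrite xe scalerA scalerDl -zE.
  have tm : enorm (t *: (xi - eta)) = `|t * m|.
    by rewrite xe scalerA enormZ e_norm mulr1.
  rewrite tm in t2 t3.
  have [tm1 tm2] : - r < t * m /\ t * m < r by move: t2; rewrite ltr_norml => /andP.
  have zn : enorm (z + t *: (xi - eta)) = r + t * m.
    by rewrite zt enormZ e_norm mulr1 gtr0_norm //; move: tm1; clear; lra.
  have Kt : K (z + t *: (xi - eta), y + t *: eta).
    apply/KP; split=> /=.
      by rewrite zn; have := ler_norm (t * m); move: t3; clear; lra.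
    by apply: le_trans (ler_enormD _ _) _; move: t1; clear; lra.
  have := pmax _ (mem_set Kt).
  rewrite /Phi /w /phi /= zn -/r.
  have -> : y + t *: eta + (z + t *: (xi - eta)) = y + z + t *: xi.
    by rewrite scalerBr addrACA [t *: eta + _]addrC subrK.
  by rewrite !scale0r !addr0 mul0r addr0; clear; lra.
have xb1 : enorm (y + z) < r1 by exact: le_lt_trans rhor.
have yb1 : enorm y < r1 by exact: le_lt_trans rhor.
move: (sol_sym sol xb1) (sol_sym sol yb1) (sol_cone sol xb1) (sol_rhs sol yb1) test.
move: (hess u (y + z)) (hess u y) => M N symM symN coneM rhsN test.
(* Moving [x] alone along [e], with [y] fixed, yields the negative curvature required for
   [p = 2 B]. *)
have eM : dot (e *m M) e <= - (2 * B).
  have := test e 0 1; rewrite subr0 scale1r => /(_ erefl).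
  rewrite (dotC 0 y) (dot0r (0 *m N)) (dot0r 0) (dot0r y) => h.
  by rewrite -subr_le0; apply: le_trans h; rewrite le_eqVlt; apply/orP; left; apply/eqP; ring.
have q0 : 0 <= A * (2 * b * powR (dot y y + d2) (b - 1)).
  by apply: mulr_ge0; [exact: ltW|rewrite !mulr_ge0 ?powR_ge0 ?ltW].
have th0 : 0 <= 2 * (1 - b) / (dot y y + d2).
  by rewrite divr_ge0 ?ltW // mulr_gt0 // subr_gt0.
(* The condition [2 k <= n] enters here, through [th |y|^2 <= 2 (1 - b)]. *)
have thy : 2 * (1 - b) / (dot y y + d2) * dot y y * k%:R <= (1 - b) * n%:R.
  have h1 : 2 * k%:R <= n%:R :> R by rewrite -natrM ler_nat.
  have h2 : dot y y / (dot y y + d2) <= 1 by rewrite ler_pdivrMr // mul1r lerDl ltW.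
  have -> : 2 * (1 - b) / (dot y y + d2) * dot y y * k%:R =
     ((1 - b) * (2 * k%:R)) * (dot y y / (dot y y + d2)) by field; rewrite gt_eqF.
  apply: (@le_trans _ _ ((1 - b) * (2 * k%:R))); last by rewrite ler_wpM2l // subr_ge0 ltW.
  by rewrite ler_piMr // !mulr_ge0 // subr_ge0 ltW.
have lower : b * (A * (2 * b * powR (dot y y + d2) (b - 1))) ^+ k <= Smx k N.
  apply: (@reflected_barrier_bound R n k M N e (2 * B) _ (2 * (1 - b) / (dot y y + d2)) y b kn
    symM symN coneM e1 _ eM q0 (ltW b0) th0 thy).
    exact: (mulr_ge0 (ler0n _ 2) (ltW B0)).
  (* With [m = - 2 <eta, e>] the term [2 B m^2] is [4 (2 B) <eta, e>^2], and [cB] rewrites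
     [2 c |eta|^2] as [ep (2 B) |eta|^2]: both have the form required for [p = 2 B]. *)
  move=> eta; cbv zeta; set xi := eta *m reflection e; have xiE : xi - eta = - (2 * dot eta e) *: e.
    by rewrite /xi mul_reflection scaleNr addrAC subrr sub0r.
  have := test xi eta _ xiE; rewrite cB -/ep.
  move: (2 * b * powR _ _) (dot eta eta - _ * _ ^+ 2) (dot (xi *m M) xi) (dot (eta *m N) eta).
  move: (dot eta eta) (dot eta e) => a3 a4 W q' a1 a2 h; rewrite -subr_le0; apply: le_trans h.
  by rewrite le_eqVlt; apply/orP; left; apply/eqP; ring.
have r2 : 0 < dot y y + d2 <= 2.
  rewrite rp /=; have := dot_le y yr'; have : rho ^+ 2 <= 1 by rewrite exprn_ile1 // ltW.
  by move: (dot y y) (rho ^+ 2) d21 => a1 a2; clear; lra.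
have k0 : (0 < k)%N by case/andP: kn.
have := le_lt_trans (le_trans lower rhsN) (barrier_beats_rhs k0 F0 b01 bs r2).
by rewrite ltxx.
Qed.

End DoublingEstimate.

(** * Hoelder continuity at the origin *)

Section Origin.
Context (R : realType) (n : nat).
Implicit Types (x y z v : 'rV[R]_n) (u : 'rV[R]_n -> R).

Lemma expr_small (k e : R) : 0 < k < 1 -> 0 < e -> exists j : nat, k ^+ j < e.
Proof.
move=> /andP[k0 k1] e0.
have : (fun j : nat => k ^+ j) @ \oo --> (0 : R).
  by apply: cvg_expr; rewrite gtr0_norm.
move=> /cvgrPdist_lt /(_ e e0)[N _ H]; exists N.
by have := H N (leqnn N); rewrite /= sub0r normrN gtr0_norm // exprn_gt0.
Qed.

(** For [x != 0] take the least [j] with [kap^(j+1) r < |x|]. Then [|x| <= kap^j r], so the decay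
    hypothesis applies, and [kap^j <= |x| / (kap r)] converts it into a power of [|x|]. *)
Lemma holder_of_decay u (kap W a r : R) : 0 < kap < 1 -> 0 < a -> 0 <= W -> 0 < r ->
  (forall (j : nat) x, enorm x <= kap ^+ j * r -> `|u x - u 0| <= W * powR (kap ^+ j) a) ->
  forall x, enorm x <= r -> `|u x - u 0| <= W * (powR (kap * r) a)^-1 * powR (enorm x) a.
Proof.
move=> k01 a0 W0 r0 H x xr; have [k0 k1] := andP k01.
have [->|x0] := eqVneq x 0.
  by rewrite subrr normr0 !mulr_ge0 ?invr_ge0 ?powR_ge0.
have xp := enorm_gt0 x0.
have [j0 hj0] := @expr_small kap (enorm x / (kap * r)) k01 (divr_gt0 xp (mulr_gt0 k0 r0)).
have ex : exists j, kap ^+ j * (kap * r) < enorm x.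
  by exists j0; rewrite -ltr_pdivlMr // mulr_gt0.
have [j hj jmin] := ex_minnP ex.
have xj : enorm x <= kap ^+ j * r.
  case: j hj jmin => [|j] hj jmin; first by rewrite expr0 mul1r.
  rewrite leNgt; apply/negP => h.
  have hj' : kap ^+ j * (kap * r) < enorm x by apply: le_lt_trans h; rewrite exprSr mulrA.
  by have := jmin j hj'; rewrite ltnn.
apply: le_trans (H j x xj) _; rewrite -mulrA; apply: ler_wpM2l => //.
have kr0 : 0 < kap * r by exact: mulr_gt0.
have kj0 : 0 < kap ^+ j by exact: exprn_gt0.
rewrite mulrC ler_pdivlMr ?powR_gt0 //.
rewrite -(powRM _ (ltW kj0) (ltW kr0)).
apply: ge0_ler_powR; rewrite ?nnegrE ?enorm_ge0 ?ltW //.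
exact: mulr_gt0.
Qed.

Lemma holder_origin_small k (s F r1 M : R) : (0 < k <= n)%N -> (2 * k <= n)%N -> -1 < s ->
  0 <= F -> 0 < r1 -> 0 <= M ->
  exists a C r : R, [/\ 0 < a, 0 <= C, 0 < r < r1 &
  forall d2 u, 0 < d2 <= 1 -> local_solution k s F d2 r1 u ->
    (forall x, enorm x < r1 -> `|u x| <= M) ->
    forall x, enorm x <= r -> `|u x - u 0| <= C * powR (enorm x) a].
Proof.
move=> kn kn2 s1 F0 r10 M0.
pose b : R := Num.min (1 / 2) (s + 1).
have b0 : 0 < b by rewrite lt_min; apply/andP; split; lra.
have bs : b <= s + 1 by rewrite /b ge_min lexx orbT.
have b1 : b < 1 by rewrite gt_min; apply/orP; left; lra.
pose ep := perturb_eps R n.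
have ep0 : 0 < ep by rewrite invr_gt0 !mulr_gt0 // ltr0n expn_gt0.
pose l := 4 + ep^-1; have l4 : 4 < l by rewrite ltrDl invr_gt0.
have l0 : 0 < l by lra.
(* With this ratio the scale invariant errors are at most [om / 4] and [om / 8], and [4 A <= W]
   makes the barrier error at most [om / 4]. Their sum is below [3 / 4 * om], and [a] is chosen with
   [kap^a >= 3 / 4]; the bound [a <= 2 b] lets the barrier error decay at the same rate. *)
pose kap := (8 * l)^-1.
have lk : l * kap = 1 / 8 by rewrite /kap; field; apply: lt0r_neq0; lra.
have k0 : 0 < kap by rewrite invr_gt0; lra.
have k32 : kap <= 1 / 32 by nra.
have k1 : kap < 1 by lra.
pose A := (F + 1) * powR 2 (s + 1 - b) / (2 * b ^+ 2).
have A0 : 0 <= A.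
  by rewrite divr_ge0 ?mulr_ge0 ?powR_ge0 ?sqr_ge0 //; lra.
pose a := Num.min (2 * b) (ln (3 / 4) / ln kap).
have lnk : ln kap < 0 by rewrite ln_lt0 // k0.
have ln34 : ln (3 / 4) < 0 :> R by rewrite ln_lt0 //; apply/andP; split; lra.
have a0 : 0 < a.
  by rewrite lt_min mulr_gt0 //= -mulrNN -invrN divr_gt0 // oppr_gt0.
have ka34 : 3 / 4 <= powR kap a.
  rewrite /powR gt_eqF // -[leLHS](@lnK R) ?posrE; last lra.
  rewrite ler_expR -ler_ndivlMr // ge_min lexx orbT //.
have ka2b : powR kap (2 * b) <= powR kap a.
  by apply: ger_powR; [rewrite k0 ltW|rewrite ge_min lexx].
pose r := Num.min 1 (r1 / 2).
have r0 : 0 < r by rewrite lt_min ltr01 divr_gt0.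
have rle1 : r <= 1 by rewrite ge_min lexx.
have rr1 : r < r1 by rewrite gt_min; apply/orP; right; lra.
pose W := 2 * M + 4 * A + 1.
have W0 : 0 < W by rewrite /W; lra.
exists a, (W * (powR (kap * r) a)^-1), r; split => //.
- by rewrite mulr_ge0 ?invr_ge0 ?powR_ge0 // ltW.
- by rewrite r0.
move=> d2 u d201 sol uM.
have osc (j : nat) : forall x y, enorm x <= kap ^+ j * r -> enorm y <= kap ^+ j * r ->
    u x - u y <= W * powR (kap ^+ j) a.
  elim: j => [|j IH] x y.
    rewrite expr0 mul1r powR1 mulr1 => xr yr.
    have /ler_normlP[x1 x2] := uM x (le_lt_trans xr rr1).
    have /ler_normlP[y1 y2] := uM y (le_lt_trans yr rr1).
    by rewrite /W; move: x1 x2 y1 y2 A0; clear; lra.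
  have kj0 : 0 < kap ^+ j by exact: exprn_gt0.
  have kj1 : kap ^+ j <= 1 by rewrite exprn_ile1 ?ltW.
  set rho := kap ^+ j * r in IH; rewrite exprS -mulrA -/rho => xr yr.
  have rho0 : 0 < rho by exact: mulr_gt0.
  have rhor : rho <= r by rewrite ler_piMl // ltW.
  set om := W * powR (kap ^+ j) a in IH.
  have om0 : 0 < om by rewrite mulr_gt0 // powR_gt0.
  have rho01 : 0 < rho <= 1 by rewrite rho0 (le_trans rhor).
  have b01 : 0 < b < 1 by rewrite b0.
  have kr : kap * rho <= rho / 32 by rewrite mulrC; apply: ler_wpM2l; [exact: ltW|move: k32; clear; lra].
  have yr' : enorm y <= rho / 2 by move: yr kr rho0; clear; lra.
  have xy : enorm (x - y) <= 2 * (kap * rho).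
    by have := ler_enormD x (- y); rewrite enormN; move: xr yr; clear; lra.
  have xyr : enorm (x - y) <= rho / 4 by move: xy kr rho0; clear; lra.
  have := doubling_estimate kn kn2 F0 b01 bs d201 rho01 (le_lt_trans rhor rr1) om0 sol IH yr' xyr.
  rewrite -/A -/ep -/l => h; apply: le_trans h _.
  have h1 : l * om / rho * enorm (x - y) <= om / 4.
    apply: (@le_trans _ _ (l * om / rho * (2 * (kap * rho)))).
      exact: (ler_wpM2l (divr_ge0 (mulr_ge0 (ltW l0) (ltW om0)) (ltW rho0)) xy).
    have -> : l * om / rho * (2 * (kap * rho)) = 2 * (l * kap) * om by field; rewrite gt_eqF.
    by rewrite lk; clear; lra.
  have h2 : 4 * om / rho ^+ 2 * enorm y ^+ 2 <= om / 8.
    apply: (@le_trans _ _ (4 * om / rho ^+ 2 * (kap * rho) ^+ 2)).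
      have c0 : 0 <= 4 * om / rho ^+ 2.
        by apply: divr_ge0; [apply: mulr_ge0; [exact: ler0n|exact: ltW]|exact: sqr_ge0].
      apply: (ler_wpM2l c0); rewrite !expr2.
      by apply: ler_pM => //; exact: enorm_ge0.
    have -> : 4 * om / rho ^+ 2 * (kap * rho) ^+ 2 = om * (4 * (kap * kap)).
      by field; rewrite gt_eqF.
    have : kap * kap <= 1 / 32 * (1 / 32) by apply: ler_pM => //; exact: ltW.
    by move=> hk; apply: ler_wpM2l; [exact: ltW|move: hk; clear; lra].
  have h3 : A * powR (rho ^+ 2) b <= om / 4.
    have e1 : powR (rho ^+ 2) b <= powR (kap ^+ j) a.
      rewrite -(powR_mulrn 2 (ltW rho0)) -powRrM.
      apply: (@le_trans _ _ (powR (kap ^+ j) (2 * b))).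
        apply: ge0_ler_powR; rewrite ?nnegrE.
        - by apply: mulr_ge0; [exact: ler0n|exact: ltW].
        - exact: ltW.
        - exact: ltW.
        - by rewrite /rho; apply: ler_piMr => //; exact: ltW.
      by apply: ger_powR; [rewrite kj0|rewrite ge_min lexx].
    apply: (@le_trans _ _ (A * powR (kap ^+ j) a)); first exact: ler_wpM2l.
    have : 4 * A * powR (kap ^+ j) a <= W * powR (kap ^+ j) a.
      by apply: ler_wpM2r; [exact: powR_ge0|rewrite /W; move: M0; clear; lra].
    by rewrite -/om; clear; lra.
  have -> : W * powR (kap * kap ^+ j) a = om * powR kap a.
    by rewrite (powRM _ (ltW k0) (ltW kj0)) /om; ring.
  have : om * (3 / 4) <= om * powR kap a by apply: ler_wpM2l => //; exact: ltW.
  by move: (l * om / rho * _) (4 * om / rho ^+ 2 * _) (A * _) h1 h2 h3 (om * powR kap a) om0; clear => *; lra.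
have [k01 W0'] : 0 < kap < 1 /\ 0 <= W by rewrite k0 k1 ltW.
apply: (holder_of_decay k01 a0 W0' r0) => j x xr.
have z0 : enorm (0 : 'rV[R]_n) <= kap ^+ j * r.
  by rewrite enorm0 mulr_ge0 ?exprn_ge0 ?ltW.
by rewrite ler_norml lerNl opprB !osc.
Qed.

Lemma barrier0_continuous b z : 0 < b -> {for z, continuous (@barrier R n b 0)}.
Proof.
move=> b0; have [->|z0] := eqVneq z 0.
  move=> B /nbhs_ballP[e /= e0 eB].
  change (nbhs (0 : 'rV[R]_n) (@barrier R n b 0 @^-1` B)); apply/nbhs_enorm.
  have b20 : 0 < (2 * b)^-1 by rewrite invr_gt0 mulr_gt0.
  exists (powR e (2 * b)^-1) => [|y]; first exact: powR_gt0.
  rewrite subr0 => ye; apply: eB; rewrite -ball_normE /=.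
  rewrite /barrier !addr0 dot0r powR0 ?gt_eqF // sub0r normrN ger0_norm ?powR_ge0 //.
  rewrite -enorm_sqr -powR_mulrn ?enorm_ge0 // -powRrM.
  have -> : e = powR (powR e (2 * b)^-1) (2 * b).
    by rewrite -powRrM mulVf ?powRr1 ?ltW // gt_eqF // mulr_gt0.
  apply: gt0_ltr_powR; rewrite ?nnegrE ?powR_ge0 ?enorm_ge0 ?mulr_gt0 //.
have zp : 0 < dot z z by exact: dot_gt0.
have cd : {for z, continuous (fun x : 'rV[R]_n => dot x x)} by exact: dot_continuous.
have cp : {for dot z z, continuous (@powR R ^~ b)}.
  by apply/differentiable_continuous/derivable1_diffP/derivable_powR; rewrite in_itv /= zp.
have -> : @barrier R n b 0 = (@powR R ^~ b) \o (fun x : 'rV[R]_n => dot x x).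
  by apply/funext => y; rewrite /barrier /= addr0.
exact: (continuous_comp cd cp).
Qed.

(** On the sphere of radius [rho] the comparison function equals [2 M + 1], more than the
    oscillation of [u]. A violation therefore produces an interior maximum [y != c] where [D^2 u]
    lies below [C] times the barrier Hessian with [th |y - c|^2 = 2 (1 - b)], which
    [barrier_not_above] excludes. *)
Lemma compare_power k (s F d2 r1 b M rho : R) u c : (0 < k <= n)%N -> 0 < b -> b < 1 ->
  n%:R < 2 * (1 - b) * k%:R :> R -> local_solution k s F d2 r1 u ->
  (forall x, enorm x < r1 -> `|u x| <= M) -> 0 < rho -> enorm c + rho < r1 ->
  forall x, enorm (x - c) <= rho ->
    u x - u c <= (2 * M + 1) / powR (rho ^+ 2) b * powR (enorm (x - c) ^+ 2) b.
Proof.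
move=> kn b0 b1 nk sol uM rho0 cr x1 x1r.
have inr x : enorm (x - c) <= rho -> enorm x < r1.
  by move=> xr; have := ler_enormD (x - c) c; rewrite subrK; lra.
set C := (2 * M + 1) / _.
have P0 : 0 < powR (rho ^+ 2) b by apply: powR_gt0; exact: exprn_gt0.
have M0 : 0 <= M by apply: le_trans (uM c _); [exact: normr_ge0|lra].
have C0 : 0 < C by apply: divr_gt0 => //; lra.
pose Phi x := u x - C * barrier b 0 (x - c).
pose K := [set x : 'rV[R]_n | enorm (x - c) <= rho].
suff : Phi x1 <= u c.
  by rewrite /Phi /barrier addr0 -enorm_sqr; lra.
have K0 : K !=set0 by exists x1.
have cK : compact K by exact: compact_eball.
have cPhi : {within K, continuous Phi}.
  apply: continuous_in_subspaceT => x /set_mem xK.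
  have cu : {for x, continuous u}.
    by apply: differentiable_continuous; apply: (sol_diff sol); exact: inr.
  have ce : {for x, continuous (fun x : 'rV[R]_n => x - c)} by exact: continuous_subr_cst.
  have cp : {for x - c, continuous (@barrier R n b 0)} by exact: barrier0_continuous.
  have cc (a : R) : {for x, continuous (fun _ : 'rV[R]_n => a)} by exact: cst_continuous.
  have cb := continuous_comp ce cp.
  exact: (continuousB cu (continuousM (cc C) cb)).
have [y /set_mem yK ymax] := compact_EVT_max K0 cK cPhi.
have x1K : K x1 by [].
apply: le_trans (ymax _ (mem_set x1K)) _; rewrite leNgt; apply/negP => Pos.
have yr1 : enorm y < r1 by exact: inr.
have z0 : 0 < enorm (y - c).
  rewrite lt0r enorm_ge0 andbT; apply/negP => /eqP z0.
  move: Pos; rewrite /Phi /barrier addr0 -enorm_sqr z0 expr0n powR0 ?gt_eqF // mulr0 subr0.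
  by have /eqP := enorm_eq0 z0; rewrite subr_eq0 => /eqP ->; rewrite ltxx.
have zlt : enorm (y - c) < rho.
  rewrite lt_neqAle yK andbT; apply/negP => /eqP zE.
  move: Pos; rewrite /Phi /barrier addr0 -enorm_sqr zE /C divfK ?gt_eqF //.
  have /ler_normlP[u1 u2] := uM y yr1; have cr1 : enorm c < r1 by lra.
  by have /ler_normlP[u3 u4] := uM c cr1; lra.
have zp : 0 < dot (y - c) (y - c) + 0 by rewrite addr0 -enorm_sqr exprn_gt0.
set q := 2 * b * powR (dot (y - c) (y - c) + 0) (b - 1).
have q0 : 0 < q by rewrite !mulr_gt0 // powR_gt0.
set th := 2 * (1 - b) / (dot (y - c) (y - c) + 0).
have test v : dot (v *m hess u y) v <= C * q * (dot v v - th * dot v (y - c) ^+ 2).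
  have [w' [dw d2w]] := @barrier_line R n b 0 (y - c) v zp.
  have nd : \forall t \near (0 : R), differentiable u (y + t *: v).
    have rr : 0 < r1 - enorm y by lra.
    apply: filterS (near_line v rr) => t tv; apply: (sol_diff sol).
    by apply: le_lt_trans (ler_enormD _ _) _; lra.
  suff : dot (v *m hess u y) v - 0 + 2 * 0 * 0 ^+ 2 +
      - C * (q * (dot v v - th * dot v (y - c) ^+ 2)) - 2 * 0 * 0 <= 0.
    by rewrite !(mulr0, mul0r, addr0, subr0) mulNr subr_le0 -(mulrA C q).
  apply: (@second_order_test_combo R (fun t => u (y + t *: v)) (cst 0)
    (fun t => barrier b 0 (y - c + t *: v)) (fun t => dot (grad u (y + t *: v)) v) (cst 0) w'
    _ _ _ 0 0 0 0 (- C) 0 0 0 0).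
  - by apply: filterS nd => t; exact: line_derive.
  - by near=> t; exact: is_derive_cst.
  - exact: dw.
  - by apply: line_derive2; exact: (sol_diff2 sol).
  have rr : 0 < rho - enorm (y - c) by lra.
  apply: filterS (near_line v rr) => t tv.
  have Kt : K (y + t *: v).
    rewrite /K /= addrAC; apply: le_trans (ler_enormD _ _) _; lra.
  have := ymax _ (mem_set Kt); rewrite /Phi /=.
  rewrite !scale0r !addr0 [y + _ - c]addrAC.
  move: (u (y + _)) (barrier _ _ _) (u y) (barrier _ _ _) => *; lra.
have := barrier_not_above kn (sol_sym sol yr1) (sol_cone sol yr1) (mulr_gt0 C0 q0) test.
have -> : th * dot (y - c) (y - c) = 2 * (1 - b).
  by rewrite /th addr0; rewrite addr0 in zp; field; rewrite gt_eqF.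
by rewrite leNgt nk.
Unshelve. all: by end_near. Qed.

Lemma holder_origin_large k (s F r1 M : R) : (0 < k <= n)%N -> (n < 2 * k)%N -> 0 < r1 -> 0 <= M ->
  exists a C r : R, [/\ 0 < a, 0 <= C, 0 < r < r1 &
  forall d2 u, 0 < d2 <= 1 -> local_solution k s F d2 r1 u ->
    (forall x, enorm x < r1 -> `|u x| <= M) ->
    forall x, enorm x <= r -> `|u x - u 0| <= C * powR (enorm x) a].
Proof.
move=> kn nk r10 M0; have k0 : 0 < k%:R :> R by rewrite ltr0n; case/andP: kn.
have nk' : n%:R < 2 * k%:R :> R by rewrite -natrM ltr_nat.
(* The requirement [n < 2 (1 - b) k] means [b < 1 - n / (2 k)]; [b] is half of that bound. *)
pose b : R := (1 - n%:R / (2 * k%:R)) / 2.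
have bk : 2 * b * (2 * k%:R) = 2 * k%:R - n%:R.
  by rewrite /b; field; apply: lt0r_neq0.
have n0 : 0 <= n%:R :> R by rewrite ler0n.
have b0 : 0 < b by rewrite -(pmulr_lgt0 _ (_ : 0 < 4 * k%:R)); [nra|rewrite mulr_gt0].
have b1 : b < 1 by nra.
have bn : n%:R < 2 * (1 - b) * k%:R :> R by nra.
pose rho := r1 / 4; have rho0 : 0 < rho by rewrite divr_gt0.
pose C := (2 * M + 1) / powR (rho ^+ 2) b.
exists (2 * b), C, rho; split.
- exact: mulr_gt0.
- by apply: divr_ge0; [lra|exact: powR_ge0].
- by rewrite rho0 /rho; lra.
move=> d2 u d201 sol uM x xr.
have powE : powR (enorm x) (2 * b) = powR (enorm x ^+ 2) b.
  by rewrite powRrM powR_mulrn ?enorm_ge0.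
rewrite powE ler_norml; apply/andP; split.
  (* [compare_power] is one-sided; the lower bound comes from centring the comparison function at
     [x] and evaluating at 0. *)
  rewrite lerNl opprB.
  have h := @compare_power k s F d2 r1 b M rho u x kn b0 b1 bn sol uM rho0 _ 0.
  rewrite sub0r enormN in h; apply: h => //; rewrite /rho in xr *; lra.
have h := @compare_power k s F d2 r1 b M rho u 0 kn b0 b1 bn sol uM rho0 _ x.
rewrite subr0 in h; apply: h => //; rewrite enorm0 /rho; lra.
Qed.

Lemma holder_origin k (s F r1 M : R) : (0 < k <= n)%N -> -1 < s -> 0 <= F -> 0 < r1 -> 0 <= M ->
  exists a C r : R, [/\ 0 < a, 0 <= C, 0 < r < r1 &
  forall d2 u, 0 < d2 <= 1 -> local_solution k s F d2 r1 u ->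
    (forall x, enorm x < r1 -> `|u x| <= M) ->
    forall x, enorm x <= r -> `|u x - u 0| <= C * powR (enorm x) a].
Proof.
move=> kn s1 F0 r10 M0; have [nk|nk] := leqP (2 * k) n.
  exact: holder_origin_small.
exact: holder_origin_large.
Qed.

End Origin.

(** * The global estimate *)

Section ContinuousBig.
Context (R : realType) (V : topologicalType) (I : Type).
Implicit Types (s : seq I) (P : pred I) (F : I -> V -> R).

Lemma continuous_bigsum s P F x : (forall i, {for x, continuous (F i)}) ->
  {for x, continuous (fun x => \sum_(i <- s | P i) F i x)}.
Proof.
move=> cF; elim: s => [|i s IH].
  have -> : (fun x => \sum_(i <- [::] | P i) F i x) = cst 0.
    by apply/funext => y; rewrite big_nil.
  exact: cst_continuous.
have -> : (fun x => \sum_(j <- i :: s | P j) F j x) =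
    if P i then F i + (fun x => \sum_(j <- s | P j) F j x)
    else fun x => \sum_(j <- s | P j) F j x.
  by apply/funext => y; rewrite big_cons; case: (P i).
by case: (P i); [exact: (continuousD (cF i) IH)|exact: IH].
Qed.

Lemma continuous_bigprod s P F x : (forall i, {for x, continuous (F i)}) ->
  {for x, continuous (fun x => \prod_(i <- s | P i) F i x)}.
Proof.
move=> cF; elim: s => [|i s IH].
  have -> : (fun x => \prod_(i <- [::] | P i) F i x) = cst 1.
    by apply/funext => y; rewrite big_nil.
  exact: cst_continuous.
have -> : (fun x => \prod_(j <- i :: s | P j) F j x) =
    if P i then F i * (fun x => \prod_(j <- s | P j) F j x)
    else fun x => \prod_(j <- s | P j) F j x.
  by apply/funext => y; rewrite big_cons; case: (P i).
by case: (P i); [exact: (continuousM (cF i) IH)|exact: IH].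
Qed.

End ContinuousBig.

(** * From conditions on eigenvalues to conditions on the Hessian *)

Section LocalSolution.
Context (R : realType) (n : nat).
Implicit Types (x y z v : 'rV[R]_n) (u : 'rV[R]_n -> R) (A : set 'rV[R]_n).

Lemma closure_enorm A x e : closure A x -> 0 < e -> exists2 y, A y & enorm (y - x) < e.
Proof.
move=> cA e0; have [] := cA [set y | enorm (y - x) < e].
  by apply/nbhs_enorm; exists e.
by move=> y [Ay ye]; exists y.
Qed.

Lemma open_enorm A x : open A -> A x -> exists2 e, 0 < e & forall y, enorm (y - x) < e -> A y.
Proof. by move=> oA Ax; apply/nbhs_enorm/open_nbhs_nbhs. Qed.

Lemma sigma_continuous m j : continuous (fun lam : 'rV[R]_m => sigma j lam).
Proof.
by move=> x; apply: continuous_bigsum => S; apply: continuous_bigprod => i; exact: coord_continuous.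
Qed.

Lemma sigma0 m (lam : 'rV[R]_m) : sigma 0 lam = 1.
Proof.
rewrite /sigma (big_pred1 finset.set0) => [|S]; last by rewrite cards_eq0.
by rewrite big_set0.
Qed.

Lemma closure_Gamma_sigma_ge0 m k j (lam : 'rV[R]_m) :
  closure (Gamma k) lam -> (j <= k)%N -> 0 <= sigma j lam.
Proof.
move=> lamG; case: j => [|j] jk; first by rewrite sigma0 ler01.
have cl : closed [set l : 'rV[R]_m | 0 <= sigma j.+1 l].
  apply: (preimage_closed (f := fun l : 'rV[R]_m => sigma j.+1 l) (D := [set y | 0 <= y])).
    by move=> l _; exact: sigma_continuous.
  exact: closed_ge.
apply: cl; apply: closure_subset lamG => l; move/(_ j.+1 jk); exact: ltW.
Qed.

Lemma isCkS_diff m A f : isCk m.+1 A f -> forall x, A x -> differentiable f x.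
Proof. by case. Qed.

Lemma isCkS_partial m A f i : isCk m.+1 A f -> isCk m A (partial i f).
Proof. by case=> _; exact. Qed.

(** The hypotheses quantify over all spectra of the Hessian; symmetry and the spectral theorem
    supply one at each point, which turns them into statements about [Smx]. *)
Lemma local_solutionI (k : nat) (s F delta r1 : R) A (g : 'rV[R]_n -> R) u :
  (forall x, enorm x < r1 -> A x) -> 0 < r1 -> isCk 3 A u -> k_admissible k A u ->
  (forall x, A x -> forall lam, eigs_spec (hess u x) lam ->
     sigma k lam = (powR (enorm x ^+ 2 + delta ^+ 2) s * g x) ^+ k) ->
  (forall x, A x -> 0 <= g x <= F) ->
  local_solution k s F (delta ^+ 2) r1 u.
Proof.
move=> rA r0 Cu adm eqn gF.
have du x : enorm x < r1 -> differentiable u x by move=> /rA; exact: isCkS_diff Cu x.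
have d2u x : enorm x < r1 -> forall i, differentiable (partial i u) x.
  by move=> /rA Ax i; exact: isCkS_diff (isCkS_partial i Cu) x Ax.
have sym x : enorm x < r1 -> (hess u x)^T = hess u x.
  move=> xr; have d0 : 0 < r1 - enorm x by rewrite subr_gt0.
  apply: (hess_sym d0) => [w wd|]; last exact: d2u.
  by apply: du; apply: le_lt_trans (ler_enormD _ _) _; rewrite -ltrBrDl.
split => // [x xr|x xr]; have [lam lamE] := spectral (sym x xr).
  move=> j jk; rewrite (Smx_eigs j lamE) -sigma_elsym.
  exact: closure_Gamma_sigma_ge0 (adm x (rA x xr) lam lamE) jk.
rewrite (Smx_eigs k lamE) -sigma_elsym (eqn x (rA x xr) lam lamE) -enorm_sqr mulrC.
have /andP[g0 gle] := gF x (rA x xr).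
apply: lerXn2r; rewrite ?nnegrE ?mulr_ge0 ?powR_ge0 //; first exact: le_trans gle.
by apply: ler_wpM2r => //; exact: powR_ge0.
Qed.

End LocalSolution.

(** * Local estimates and compactness *)

Section Global.
Context (R : realType) (n : nat).
Implicit Types (x y z v b : 'rV[R]_n) (u psi : 'rV[R]_n -> R) (A : set 'rV[R]_n).
Implicit Types (Q : ('rV[R]_n -> R) -> Prop).

Lemma compact_closure_bounded A B : (forall x, A x -> enorm x <= B) -> compact (closure A).
Proof.
move=> AB; have cB := @compact_eball R n 0 B.
apply: (subclosed_compact (@closed_closure _ _) cB) => x cx /=.
rewrite subr0; apply/ler_addgt0Pr => e e0.
have [y Ay yx] := closure_enorm cx e0.
have := ler_enormB x y 0; rewrite !subr0 enormB => h; apply: le_trans h _.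
by rewrite addrC lerD ?AB // ltW.
Qed.

(** [eta] and [C] are fixed before [u], so compactness yields one constant for the whole class [Q].
    A single parameter serves as Hoelder constant and as inverse radius, so that the local property
    [P] holds for all large values of it; pairs farther apart than that radius are covered by the
    bound [M]. *)
Lemma uniform_holder A Q al M : 0 < al -> 0 <= M -> compact (closure A) ->
  (forall b, closure A b -> exists eta C, 0 < eta /\ forall u y z, Q u -> A y -> A z ->
     enorm (y - b) < eta -> enorm (z - b) < eta -> `|u y - u z| <= C * powR (enorm (y - z)) al) ->
  (forall u, Q u -> forall y, A y -> `|u y| <= M) ->
  exists2 C, 0 <= C & forall u y z, Q u -> A y -> A z ->
     `|u y - u z| <= C * powR (enorm (y - z)) al.
Proof.
move=> al0 M0 cA loc QM.
pose P C x := forall u y z, Q u -> A y -> A z -> enorm (y - x) < C^-1 -> enorm (z - x) < C^-1 ->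
  `|u y - u z| <= C * powR (enorm (y - z)) al.
have cov : \forall C \near +oo, closure A `<=` P C.
  have /compact_near_coveringP := cA; apply => x /loc[eta [C0 [eta0 H]]].
  exists ([set x' | enorm (x' - x) < eta / 2], [set C | Num.max C0 (2 / eta) < C]).
    split; first by apply/nbhs_enorm; exists (eta / 2); rewrite ?divr_gt0.
    by exists (Num.max C0 (2 / eta)); split; rewrite ?num_real.
  move=> [x' C] /= [x'x]; rewrite gt_max => /andP[C0C eC] u y z Qu Ay Az yx zx.
  have Ci : C^-1 <= eta / 2.
    rewrite -[eta / 2]invrK lef_pV2 ?posrE ?invr_gt0 ?divr_gt0 //; last first.
      by apply: lt_trans eC; rewrite divr_gt0.
    by rewrite invf_div ltW.
  have h w : enorm (w - x') < C^-1 -> enorm (w - x) < eta.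
    by move=> wx; have := ler_enormB w x' x; lra.
  apply: le_trans (H u y z Qu Ay Az (h _ yx) (h _ zx)) _.
  by apply: ler_wpM2r; [exact: powR_ge0|exact: ltW].
have [C1 [_ HC]] := cov.
pose C := Num.max C1 1 + 1.
have C1C : C1 < C by rewrite ltr_pwDr // le_max lexx.
have C2 : 1 < C by rewrite ltr_pwDr // le_max lexx orbT.
have C0 : 0 < C by lra.
have D0 : 0 <= 2 * M * powR C al by rewrite !mulr_ge0 ?powR_ge0.
exists (C + 2 * M * powR C al) => [|u y z Qu Ay Az]; first by apply: addr_ge0 => //; exact: ltW.
have p0 : 0 <= powR (enorm (y - z)) al by exact: powR_ge0.
have [h|h] := ltP (enorm (z - y)) C^-1.
  have yy : enorm (y - y) < C^-1 by rewrite subrr enorm0 invr_gt0.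
  apply: le_trans (HC C C1C y (subset_closure Ay) u y z Qu Ay Az yy h) _.
  by apply: ler_wpM2r => //; rewrite lerDl.
apply: (@le_trans _ _ (2 * M)).
  by apply: le_trans (ler_normB _ _) _; have := QM u Qu y Ay; have := QM u Qu z Az; lra.
have e0 := enorm_ge0 (y - z).
have Ch : 1 <= powR C al * powR (enorm (y - z)) al.
  rewrite -(powRM _ (ltW C0) e0) -[leLHS](congr1 (fun g => g al) (@powR1 R)).
  apply: ge0_ler_powR; rewrite ?nnegrE //; [exact: ltW|by apply: mulr_ge0 => //; exact: ltW|].
  by rewrite mulrC -ler_pdivrMr // mul1r enormB.
apply: (@le_trans _ _ (2 * M * (powR C al * powR (enorm (y - z)) al))).
  by apply: ler_peMr => //; lra.
by rewrite mulrA; apply: ler_wpM2r => //; rewrite lerDr ltW.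
Qed.

Lemma segment_enorm x y c e t : enorm (x - c) < e -> enorm (y - c) < e -> 0 <= t <= 1 ->
  enorm (x + t *: (y - x) - c) < e.
Proof.
move=> xe ye /andP[t0 t1].
have -> : x + t *: (y - x) - c = (1 - t) *: (x - c) + t *: (y - c).
  by apply/matrixP => i j; rewrite !mxE; ring.
apply: le_lt_trans (ler_enormD _ _) _; rewrite !enormZ !ger0_norm ?subr_ge0 //.
pose m := Num.max (enorm (x - c)) (enorm (y - c)).
have me : m < e by rewrite gt_max xe.
apply: le_lt_trans me; have -> : m = (1 - t) * m + t * m by ring.
by apply: lerD; apply: ler_wpM2l; rewrite ?subr_ge0 ?le_max ?lexx ?orbT.
Qed.

Lemma le_powR_le1 (h al : R) : 0 <= h <= 1 -> al <= 1 -> 0 < al -> h <= powR h al.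
Proof.
move=> /andP[h0 h1] al1 al0; have [->|hn] := eqVneq h 0; first by rewrite powR_ge0.
by apply: ger1_powR => //; rewrite h1 lt0r hn h0.
Qed.

(* The bound [|x| |Du| <= K] is a Lipschitz bound [2 K / |b|] near [b != 0]. *)
Lemma grad_bound_away A K u b w : (forall x, A x -> enorm x * enorm (grad u x) <= K) ->
  b != 0 -> A w -> enorm (w - b) < enorm b / 2 -> enorm (grad u w) <= 2 * K / enorm b.
Proof.
move=> gK b0 Aw wb; have bp := enorm_gt0 b0.
have wb2 : enorm b / 2 <= enorm w.
  by have := ler_enormB b w 0; rewrite !subr0 (enormB b w); lra.
rewrite ler_pdivlMr //; have := gK w Aw; have := enorm_ge0 (grad u w); nra.
Qed.

Lemma holder_interior A K b al : open A -> A b -> b != 0 -> 0 < al <= 1 ->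
  exists eta C, 0 < eta /\ forall u y z, (forall x, A x -> differentiable u x) ->
    (forall x, A x -> enorm x * enorm (grad u x) <= K) ->
    enorm (y - b) < eta -> enorm (z - b) < eta -> `|u y - u z| <= C * powR (enorm (y - z)) al.
Proof.
move=> oA Ab b0 /andP[al0 al1]; have bp := enorm_gt0 b0.
have [e e0 eA] := open_enorm oA Ab.
pose eta := Num.min e (Num.min (enorm b / 2) (1 / 2)).
have h1 : eta <= e by rewrite ge_min lexx.
have h2 : eta <= enorm b / 2 by rewrite !ge_min lexx orbT.
have h3 : eta <= 1 / 2 by rewrite !ge_min lexx !orbT.
have eta0 : 0 < eta by rewrite !lt_min e0 !divr_gt0.
clearbody eta; exists eta, (2 * K / enorm b); split => // u y z du gK yb zb.
have seg t : 0 <= t <= 1 -> enorm (z + t *: (y - z) - b) < eta by exact: segment_enorm.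
have gB w : enorm (w - b) < eta -> enorm (grad u w) <= 2 * K / enorm b.
  by move=> wb; apply: (grad_bound_away gK b0); [apply: eA|]; lra.
have := @segment_lipschitz R n u z y (2 * K / enorm b).
move=> /(_ (fun t t01 => du _ (eA _ (lt_le_trans (seg t t01) h1)))).
move=> /(_ (fun t t01 => gB _ (seg t t01))) h; apply: le_trans h _.
have C0 : 0 <= 2 * K / enorm b by apply: le_trans (enorm_ge0 (grad u y)) (gB y yb).
apply: ler_wpM2l => //; apply: le_powR_le1 => //; rewrite enorm_ge0 /=.
by have := ler_enormB y b z; rewrite (enormB b z); lra.
Qed.

(* With [h = |y - z|] and [|z| <= |y|]: if [sqrt h <= |y|] use the gradient bound,
   otherwise the modulus of continuity at the origin. *)
Lemma holder_at_origin A K a C r : (forall x, enorm x <= r -> A x) -> 0 < r -> 0 < a -> 0 <= C ->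
  0 <= K ->
  exists eta D, 0 < eta /\ forall u y z, (forall x, A x -> differentiable u x) ->
    (forall x, A x -> enorm x * enorm (grad u x) <= K) ->
    (forall x, enorm x <= r -> `|u x - u 0| <= C * powR (enorm x) a) ->
    enorm (y - 0) < eta -> enorm (z - 0) < eta ->
    `|u y - u z| <= D * powR (enorm (y - z)) (Num.min a 1 / 2).
Proof.
move=> rA r0 a0 C0 K0.
(* The exponent is halved because the two regimes are separated at [|y| = sqrt h], and capped at
   1/2, the exponent that the gradient regime gives. *)
set al := _ / 2.
have al0 : 0 < al by rewrite divr_gt0 // lt_min a0 ltr01.
have al1 : al <= 1 / 2 by rewrite ler_pM2r ?invr_gt0 // ge_min lexx orbT.
have ala : al <= a / 2 by rewrite ler_pM2r ?invr_gt0 // ge_min lexx.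
pose eta := Num.min r (1 / 8).
have h1 : eta <= r by rewrite ge_min lexx.
have h2 : eta <= 1 / 8 by rewrite !ge_min lexx orbT.
have eta0 : 0 < eta by rewrite !lt_min r0 divr_gt0.
clearbody eta; exists eta, (2 * K + 2 * C); split => // u y z du gK uC.
rewrite !subr0.
wlog zy : y z / enorm z <= enorm y.
  move=> H ye ze; have [|/ltW] := leP (enorm z) (enorm y); first by move=> ?; exact: H.
  by move=> ?; rewrite distrC enormB; exact: H.
move=> ye ze; set h := enorm (y - z).
have h0 : 0 <= h by exact: enorm_ge0.
have h4 : h <= 1 / 4 by have := ler_enormB y 0 z; rewrite subr0 sub0r enormN -/h; lra.
have p0 : 0 <= powR h al by exact: powR_ge0.
have [hz|hn] := eqVneq h 0.
  have /eqP := enorm_eq0 hz; rewrite subr_eq0 => /eqP ->.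
  by rewrite subrr normr0 mulr_ge0 // addr_ge0 // mulr_ge0.
have hp : 0 < h <= 1 by rewrite lt0r hn h0 /=; lra.
pose q := Num.sqrt h; have q0 : 0 <= q by exact: sqrtr_ge0.
have qq : q * q = h by rewrite -expr2 sqr_sqrtr.
have qE : q = powR h (1 / 2) by rewrite mul1r powR12_sqrt.
have qh : q <= 1 / 2 by nra.
have qal : q <= powR h al by rewrite qE; exact: ger_powR.
have [qy|yq] := leP q (enorm y).
  have yp : 0 < enorm y by apply: lt_le_trans qy; rewrite sqrtr_gt0; case/andP: hp.
  have y0 : y != 0 by apply: contraTneq yp => ->; rewrite enorm0 ltxx.
  (* As [h = q * q] with [q <= 1 / 2] and [q <= |y|], the segment keeps a distance of at least
     [|y| / 2] from the origin, and the resulting bound [2 K h / |y|] is at most [2 K q]. *)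
  have hy : h <= enorm y / 2 by nra.
  have segr t : 0 <= t <= 1 -> enorm (z + t *: (y - z)) <= r.
    move=> t01; have := @segment_enorm z y 0 eta t; rewrite !subr0 => /(_ ze ye t01); lra.
  have segy t : 0 <= t <= 1 -> enorm y / 2 <= enorm (z + t *: (y - z)).
    move=> /andP[t0 t1].
    have e : enorm (z + t *: (y - z) - y) = (1 - t) * h.
      have -> : z + t *: (y - z) - y = (t - 1) *: (y - z).
        by apply/matrixP => i j; rewrite !mxE; ring.
      by rewrite enormZ ler0_norm ?subr_le0 // opprB.
    have := ler_enormB y (z + t *: (y - z)) 0; rewrite !subr0 [enorm (y - _)]enormB e.
    by move: (enorm (z + _)) => m; nra.
  have gB t : 0 <= t <= 1 -> enorm (grad u (z + t *: (y - z))) <= 2 * K / enorm y.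
    move=> t01; rewrite ler_pdivlMr //.
    have := gK _ (rA _ (segr t t01)); have := segy t t01.
    have := enorm_ge0 (grad u (z + t *: (y - z))).
    by move: (enorm (z + _)) (enorm (grad _ _)) => m g; nra.
  have := @segment_lipschitz R n u z y (2 * K / enorm y) (fun t t01 => du _ (rA _ (segr t t01))) gB.
  move=> hh; apply: le_trans hh _; rewrite -/h.
  apply: (@le_trans _ _ (2 * K * q)).
    rewrite mulrAC -mulrA; apply: ler_wpM2l; first by rewrite mulr_ge0.
    by rewrite ler_pdivrMr // -qq; apply: ler_wpM2l.
  apply: (@le_trans _ _ (2 * K * powR h al)); first by apply: ler_wpM2l; rewrite ?mulr_ge0.
  by apply: ler_wpM2r => //; rewrite lerDl mulr_ge0.
have pa w : enorm w <= enorm y -> powR (enorm w) a <= powR h al.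
  move=> wy; apply: (@le_trans _ _ (powR q a)).
    by apply: ge0_ler_powR; rewrite ?nnegrE ?enorm_ge0 ?(ltW a0) //; lra.
  rewrite qE -powRrM; apply: ger_powR => //; lra.
have uy : `|u y - u 0| <= C * powR h al.
  by apply: le_trans (uC y _) _; [lra|apply: ler_wpM2l => //; exact: pa].
have uz : `|u z - u 0| <= C * powR h al.
  by apply: le_trans (uC z _) _; [lra|apply: ler_wpM2l => //; exact: pa].
have -> : u y - u z = (u y - u 0) - (u z - u 0) by ring.
apply: le_trans (ler_normB _ _) _.
have Kp : 0 <= 2 * K * powR h al by apply: mulr_ge0 => //; exact: mulr_ge0.
rewrite mulrDl -[2 * C * _]mulrA; apply: le_trans (lerD uy uz) _; lra.
Qed.

End Global.

(** * Estimates near the boundary *)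

Section Boundary.
Context (R : realType) (n : nat).
Implicit Types (x y z v b : 'rV[R]_n) (u psi : 'rV[R]_n -> R) (A : set 'rV[R]_n).

Lemma grad_near psi b e : isCk 2 setT psi -> 0 < e ->
  exists2 d, 0 < d & forall w, enorm (w - b) < d -> enorm (grad psi w - grad psi b) < e.
Proof.
move=> C2 e0; pose g w := \sum_i (partial i psi w - partial i psi b) ^+ 2.
have cg : {for b, continuous g}.
  apply: continuous_bigsum => i.
  have cp : {for b, continuous (partial i psi)}.
    by apply: differentiable_continuous; exact: isCkS_diff (isCkS_partial i C2) b I.
  have cs : {for b, continuous (fun w => partial i psi w - partial i psi b)}.
    have cc : {for b, continuous (fun _ : 'rV[R]_n => partial i psi b)} by exact: cst_continuous.
    exact: (continuousB cp cc).
  have -> : (fun w => (partial i psi w - partial i psi b) ^+ 2) =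
      (fun w => partial i psi w - partial i psi b) * (fun w => partial i psi w - partial i psi b).
    by apply/funext => w; rewrite expr2.
  exact: (continuousM cs cs).
have gb : g b = 0 by rewrite /g big1 // => i _; rewrite subrr expr0n.
have /nbhs_enorm[d d0 H] : nbhs b [set w | `|g b - g w| < e ^+ 2].
  have := cg (ball (g b) (e ^+ 2)); apply.
  by apply: nbhsx_ballx; exact: exprn_gt0.
exists d => // w wd; have /= := H w wd; rewrite gb sub0r normrN => gw.
have ge : enorm (grad psi w - grad psi b) ^+ 2 = g w.
  rewrite enorm_sqr /dot; apply: eq_bigr => i _; rewrite !mxE expr2 //.
rewrite -(ltr_pXn2r (n := 2)) ?nnegrE ?enorm_ge0 ?(ltW e0) // ge.
by apply: le_lt_trans gw; exact: ler_norm.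
Qed.

(* Points of [A] near [b] can be pushed inwards along [- grad psi b]; at depth [2 h] the
   segment joining two points at distance [h] lies in [A]. *)
Lemma inner_path A psi b : isCk 2 setT psi -> (forall x, A x <-> psi x < 0) ->
  grad psi b != 0 ->
  exists nu d, [/\ 0 < d, enorm nu = 1 & forall y z t, A y -> A z -> enorm (y - b) < d ->
    enorm (z - b) < d -> 0 <= t <= 1 ->
    A (y + t *: (- (2 * enorm (y - z)) *: nu)) /\
    A (z - (2 * enorm (y - z)) *: nu + t *: (y - z))].
Proof.
move=> C2 Apsi g0; have gp := enorm_gt0 g0.
set g := grad psi b in g0 gp; pose c := enorm g.
have c8 : 0 < c / 8 by rewrite divr_gt0.
have [d0 d00 near] := grad_near b C2 c8.
pose nu := c^-1 *: g.
have cn : c != 0 by rewrite gt_eqF.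
have nu1 : enorm nu = 1 by rewrite enormZ gtr0_norm ?invr_gt0 // mulVf.
have gnu : dot g nu = c.
  by rewrite /nu dotC dotZl -enorm_sqr expr2 mulrA mulVf // mul1r.
clearbody nu.
have dpsi w : differentiable psi w by exact: isCkS_diff C2 w I.
(* This radius gives [h < d0 / 4], so every point reached below is within [d0 / 8 + 3 h < d0] of
   [b]. *)
exists nu, (d0 / 8); split; rewrite ?divr_gt0 // => y z t Ay Az yb zb t01.
set h := enorm (y - z); have h0 : 0 <= h by exact: enorm_ge0.
have hd : h < d0 / 4 by have := ler_enormB y b z; rewrite (enormB b z) -/h; lra.
have dpos w : enorm (w - b) < d0 -> 7 / 8 * c <= dot (grad psi w) nu.
  move=> wb; have := near w wb; rewrite -/g => we.
  have : `|dot (grad psi w - g) nu| <= c / 8.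
    by apply: le_trans (cauchy_schwarz_norm _ _) _; rewrite nu1 mulr1 ltW.
  by rewrite dotBl gnu => /ler_normlP[h1 h2]; lra.
have dbnd w v : enorm (w - b) < d0 -> dot (grad psi w) v <= 9 / 8 * c * enorm v.
  move=> wb; have := near w wb; rewrite -/g => we.
  apply: le_trans (cauchy_schwarz _ _) _; apply: ler_wpM2r; first exact: enorm_ge0.
  have := ler_enormD (grad psi w - g) g; rewrite subrK -/c; lra.
have push w tau : enorm (w - b) < d0 / 8 -> 0 <= tau <= 2 * h ->
    psi (w - tau *: nu) <= psi w - tau * (7 / 8 * c).
  move=> wb /andP[tau0 tauh].
  have [s /andP[s0 s1] e] := @segment_mvt R n psi w (- (tau *: nu)) (fun t _ => dpsi _).
  have -> : psi (w - tau *: nu) = psi w + (psi (w - tau *: nu) - psi w) by ring.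
  rewrite e dotNr dotZr; apply: lerD => //; rewrite lerN2; apply: ler_wpM2l => //.
  apply: dpos; have -> : w + s *: - (tau *: nu) - b = (w - b) + (- (s * tau)) *: nu.
    by apply/matrixP => i j; rewrite !mxE; ring.
  apply: le_lt_trans (ler_enormD _ _) _; rewrite enormZ nu1 mulr1 normrN ger0_norm ?mulr_ge0 //.
  have : s * tau <= tau by rewrite ler_piMl.
  by lra.
have [t0 t1] := andP t01; split; apply/Apsi.
  have -> : y + t *: (- (2 * h) *: nu) = y - (t * (2 * h)) *: nu.
    by apply/matrixP => i j; rewrite !mxE; ring.
  apply: le_lt_trans (push y (t * (2 * h)) yb _) _.
    by rewrite !mulr_ge0 //= ler_piMl // mulr_ge0.
  move/Apsi: Ay; have : 0 <= t * (2 * h) * (7 / 8 * c) by rewrite !mulr_ge0 // ltW.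
  by lra.
(* Going down by [2 h] lowers [psi] by at least [14/8 c h], while moving across by at most [h]
   raises it by at most [9/8 c h]. *)
set w := z - _; have wz : psi w <= psi z - 2 * h * (7 / 8 * c).
  by apply: push => //; rewrite mulr_ge0 //=.
have [s /andP[s0 s1] e] := @segment_mvt R n psi w (t *: (y - z)) (fun t _ => dpsi _).
have -> : psi (w + t *: (y - z)) = psi w + (psi (w + t *: (y - z)) - psi w) by ring.
rewrite e; have le9 : dot (grad psi (w + s *: (t *: (y - z)))) (t *: (y - z)) <= 9 / 8 * c * h.
  apply: le_trans (dbnd _ _ _) _.
    have -> : w + s *: (t *: (y - z)) - b = (z - b) + ((- (2 * h)) *: nu + (s * t) *: (y - z)).
      by apply/matrixP => i j; rewrite !mxE; ring.
    apply: le_lt_trans (ler_enormD _ _) _.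
    have := ler_enormD (- (2 * h) *: nu) ((s * t) *: (y - z)).
    rewrite !enormZ nu1 mulr1 normrN ger0_norm ?mulr_ge0 // ger0_norm ?mulr_ge0 // -/h => hh.
    have : s * t * h <= h by rewrite ler_piMl // -[leRHS]mulr1 ler_pM.
    by lra.
  apply: ler_wpM2l; first by rewrite mulr_ge0 // ltW.
  by rewrite enormZ ger0_norm // ler_piMl.
have : 0 <= h * c by rewrite mulr_ge0 // ltW.
by move/Apsi: Az; move: wz le9; move: (dot _ _) => *; nra.
Qed.

(** The segment from [z] to [y] may leave [A]. The detour inwards by [2 h], across by [h] and
    outwards by [2 h] has length [5 h] and stays within [8 eta <= |b| / 2] of [b], where [G] bounds
    the gradient. *)
Lemma holder_boundary A K b al psi : isCk 2 setT psi -> (forall x, A x <-> psi x < 0) ->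
  grad psi b != 0 -> b != 0 -> 0 < al <= 1 ->
  exists eta C, 0 < eta /\ forall u y z, (forall x, A x -> differentiable u x) ->
    (forall x, A x -> enorm x * enorm (grad u x) <= K) -> A y -> A z ->
    enorm (y - b) < eta -> enorm (z - b) < eta -> `|u y - u z| <= C * powR (enorm (y - z)) al.
Proof.
move=> C2 Apsi g0 b0 /andP[al0 al1]; have bp := enorm_gt0 b0.
have [nu [d [d0 nu1 path]]] := inner_path C2 Apsi g0.
pose eta := Num.min d (Num.min (enorm b / 16) (1 / 2)).
have h1 : eta <= d by rewrite ge_min lexx.
have h2 : eta <= enorm b / 16 by rewrite !ge_min lexx orbT.
have h3 : eta <= 1 / 2 by rewrite !ge_min lexx !orbT.
have eta0 : 0 < eta by rewrite !lt_min d0 !divr_gt0.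
clearbody eta; pose G := 2 * K / enorm b.
exists eta, (5 * G); split => // u y z du gK Ay Az yb zb.
set h := enorm (y - z); have h0 : 0 <= h by exact: enorm_ge0.
have hd : h < 2 * eta by have := ler_enormB y b z; rewrite (enormB b z) -/h; lra.
have gB w : A w -> enorm (w - b) < 8 * eta -> enorm (grad u w) <= G.
  by move=> Aw wb; apply: (grad_bound_away gK b0) => //; lra.
have G0 : 0 <= G by apply: le_trans (enorm_ge0 (grad u y)) (gB y Ay _); lra.
have step x v : (forall t, 0 <= t <= 1 -> A (x + t *: v)) -> enorm (x - b) + enorm v < 8 * eta ->
    forall w, w = x + v -> `|u w - u x| <= G * enorm v.
  move=> Axv xb w wE; have ev : v = w - x by rewrite wE addrC addKr.
  rewrite ev in Axv xb *; apply: (@segment_lipschitz R n u x w G) => t t01.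
    by apply: du; exact: Axv.
  apply: gB; first exact: Axv.
  have -> : x + t *: (w - x) - b = (x - b) + t *: (w - x) by rewrite addrAC.
  apply: le_lt_trans (ler_enormD _ _) _; have [t0 t1] := andP t01.
  rewrite enormZ ger0_norm //.
  have : t * enorm (w - x) <= enorm (w - x) by rewrite ler_piMl // enorm_ge0.
  by lra.
set y' := y - (2 * h) *: nu; set z' := z - (2 * h) *: nu.
have vE : enorm ((- (2 * h)) *: nu) = 2 * h.
  by rewrite enormZ nu1 mulr1 normrN ger0_norm // mulr_ge0.
have yb' : enorm (y - b) < d by lra.
have zb' : enorm (z - b) < d by lra.
have hzy : enorm (z - y) = h by rewrite enormB.
have s1 : `|u y' - u y| <= G * (2 * h).
  rewrite -vE; apply: (step y) => [t t01||]; rewrite ?vE; [|lra|].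
    by have [] := path y z t Ay Az yb' zb' t01.
  by rewrite /y' scaleNr.
have s2 : `|u z' - u z| <= G * (2 * h).
  rewrite -vE; apply: (step z) => [t t01||]; rewrite ?vE; [|lra|].
    by have [] := path z y t Az Ay zb' yb' t01; rewrite hzy.
  by rewrite /z' scaleNr.
have s3 : `|u y' - u z'| <= G * h.
  apply: (step z') => [t t01||]; rewrite -/h.
  - by have [] := path y z t Ay Az yb' zb' t01.
  - have -> : z' - b = (z - b) + (- (2 * h)) *: nu by rewrite /z' scaleNr addrAC.
    by have := ler_enormD (z - b) (- (2 * h) *: nu); rewrite vE; lra.
  by rewrite /y' /z' [RHS]addrC addrA subrK.
have -> : u y - u z = - (u y' - u y) + (u y' - u z') + (u z' - u z) by ring.
have le5 : `|- (u y' - u y) + (u y' - u z') + (u z' - u z)| <= 5 * G * h.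
  apply: le_trans (ler_normD _ _) _.
  have := ler_normD (- (u y' - u y)) (u y' - u z'); rewrite normrN => hh.
  have GE : G * (2 * h) = 2 * (G * h) by ring.
  by rewrite GE in s1 s2; rewrite -mulrA; move: (G * h) s1 s2 s3 hh => Gh *; lra.
apply: le_trans le5 _; apply: ler_wpM2l; first by rewrite mulr_ge0.
by apply: le_powR_le1 => //; rewrite h0 /=; lra.
Qed.

End Boundary.

(** * Passage to the closure *)

Section Closure.
Context (R : realType) (n : nat).
Implicit Types (x y z b : 'rV[R]_n) (u psi : 'rV[R]_n -> R) (A : set 'rV[R]_n).

Lemma isCkW m A f : isCk m.+1 A f -> @isCk R n m A f.
Proof.
elim: m f => [|m IH] f [df pf].
  by move=> x Ax; apply: differentiable_continuous; exact: df.
by split => // i; exact/IH/pf.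
Qed.

Lemma closure_approx A u y e : {within closure A, continuous u} -> closure A y -> 0 < e ->
  exists y', [/\ A y', enorm (y' - y) < e & `|u y' - u y| < e].
Proof.
move=> /subspace_continuousP cu cy e0.
have : (u @ within (closure A) (nbhs y)) (ball (u y) e) by apply: (cu y cy); exact: nbhsx_ballx.
move=> /nbhs_enorm[d d0 H].
have m0 : 0 < Num.min d e by rewrite lt_min d0.
have [y' Ay' yy'] := closure_enorm cy m0; move: yy'; rewrite lt_min => /andP[yd ye].
exists y'; split => //; have := H y' yd (subset_closure Ay').
by rewrite -ball_normE /= distrC.
Qed.

Lemma bounded_closure A u M : {within closure A, continuous u} ->
  (forall x, A x -> `|u x| <= M) -> forall x, closure A x -> `|u x| <= M.
Proof.
move=> cu uM x cx; apply/ler_addgt0Pr => e e0.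
have [y [Ay _ ye]] := closure_approx cu cx e0.
have := uM y Ay; have := ler_normB (u y) (u y - u x).
by rewrite opprB addrC subrK; lra.
Qed.

Lemma holder_closure A u C al : 0 < al <= 1 -> 0 <= C -> {within closure A, continuous u} ->
  (forall y z, A y -> A z -> `|u y - u z| <= C * powR (enorm (y - z)) al) ->
  forall y z, closure A y -> closure A z -> `|u y - u z| <= C * powR (enorm (y - z)) al.
Proof.
move=> /andP[al0 al1] C0 cu uC y z cy cz; apply/ler_addgt0Pr => e e0.
have C1 : 0 < 4 * (C + 1) by rewrite mulr_gt0 // ltr_wpDl.
(* [d] makes each of the two errors in [u] at most [e / 4]; [q] is chosen so that the change of the
   Hoelder term, at most [C (2 d)^al] by subadditivity, is at most [e / 4] too. *)
pose q := powR (e / (4 * (C + 1))) al^-1; pose d := Num.min (e / 4) (q / 2).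
have q0 : 0 < q by rewrite powR_gt0 // divr_gt0.
have d0 : 0 < d by rewrite lt_min !divr_gt0.
have de : d <= e / 4 by rewrite ge_min lexx.
have dq : 2 * d <= q.
  by have : d <= q / 2 by [rewrite ge_min lexx orbT]; lra.
have [y' [Ay yd uy]] := closure_approx cu cy d0.
have [z' [Az zd uz]] := closure_approx cu cz d0.
have h0 := enorm_ge0 (y - z).
have hE : enorm (y' - z') <= enorm (y - z) + 2 * d.
  by have := ler_enormB y' y z'; have := ler_enormB y z z'; rewrite (enormB z z'); lra.
have Cq : C * powR (2 * d) al <= e / 4.
  apply: (@le_trans _ _ (C * (e / (4 * (C + 1))))).
    apply: ler_wpM2l => //; apply: (@le_trans _ _ (powR q al)).
      apply: ge0_ler_powR; rewrite ?nnegrE ?(ltW al0) ?(ltW q0) //; lra.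
    by rewrite /q -powRrM mulVf ?gt_eqF // powRr1 // ltW // divr_gt0.
  rewrite mulrA ler_pdivrMr //; have -> : e / 4 * (4 * (C + 1)) = C * e + e by field.
  by rewrite lerDl ltW.
have step : C * powR (enorm (y' - z')) al <= C * powR (enorm (y - z)) al + e / 4.
  apply: (@le_trans _ _ (C * (powR (enorm (y - z)) al + powR (2 * d) al))); last first.
    by rewrite mulrDr lerD2l.
  apply: ler_wpM2l => //; apply: (@le_trans _ _ (powR (enorm (y - z) + 2 * d) al)).
    apply: ge0_ler_powR; rewrite ?nnegrE ?enorm_ge0 ?(ltW al0) //; lra.
  by apply: powR_subadd; rewrite ?(ltW al0) //; lra.
have tri : `|u y - u z| <= `|u y' - u y| + (`|u y' - u z'| + `|u z' - u z|).
  rewrite [`|u y' - u y|]distrC -{1}[u y](subrK (u y')) -addrA.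
  apply: le_trans (ler_normD _ _) _; rewrite lerD2l -{1}[u y'](subrK (u z')) -addrA.
  exact: ler_normD.
apply: le_trans tri _; have := le_trans (uC y' z' Ay Az) step.
move: de uy uz e0; move: (`|_|) (`|_|) (`|_|) (C * _) => n1 n2 n3 m.
by clear; lra.
Qed.

End Closure.

Theorem theorem3p3 (R : realType) (n k : nat) (hk : (1 <= k <= n)%N)
  (s : R) (hs : -1 < s)
  (Omega : set 'rV[R]_n) (hOmega : C3_strictly_k1_convex k Omega)
  (h0 : Omega 0)
  (f : 'rV[R]_n -> R -> R) (hf : nonneg_lipschitz Omega f)
  (M K : R) :
  exists alpha : R, 0 < alpha < 1 /\
  exists C : R,
  forall (delta : R), 0 < delta < 1 ->
  forall (u phi : 'rV[R]_n -> R),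
    isCk 3 Omega u -> isC1_closure Omega u ->
    k_admissible k Omega u ->
    (forall x, Omega x -> forall lam, eigs_spec (hess u x) lam ->
       sigma k lam = (powR (enorm x ^+ 2 + delta ^+ 2) s * f x (u x)) ^+ k) ->
    (forall x, boundary Omega x -> u x = phi x) ->
    C11_on_boundary Omega phi ->
    (forall x, Omega x -> `|u x| <= M) ->
    (forall x, Omega x -> enorm x * enorm (grad u x) <= K) ->
    forall x y z, closure Omega x -> closure Omega y -> closure Omega z -> y != z ->
      `|u x| + `|u y - u z| / powR (enorm (y - z)) alpha <= C.
Proof.
have half : (0 : R) < (1 / 2 : R) < 1 by apply/andP; split; lra.
(* Evaluating the two bounds at the origin, a point of [Omega], shows that no solution exists for
   negative [M] or [K]. *)
have [M0|M0] := leP 0 M; last first.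
  exists (1 / 2); split => //; exists 0 => delta _ u phi _ _ _ _ _ _ uM.
  by have := le_lt_trans (uM 0 h0) M0; rewrite normr_lt0.
have [K0|K0] := leP 0 K; last first.
  exists (1 / 2); split => //; exists 0 => delta _ u phi _ _ _ _ _ _ _ uK.
  by have := le_lt_trans (uK 0 h0) K0; rewrite enorm0 mul0r ltxx.
have [[oA [_ [_ [B AB]]]] [psi [[C3psi [Apsi [_ gpsi]]] _]]] := hOmega.
have [f0 [L fL]] := hf; have c0 := subset_closure h0.
have [r1 r10 rA] := open_enorm oA h0.
have {}rA x : enorm x < r1 -> Omega x by move=> xr; apply: rA; rewrite subr0.
(* A bound for [f x (u x)] obtained from the Lipschitz condition between [(x, u x)] and [(0, 0)]. *)
pose F := f 0 0 + `|L| * (B + M).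
have B0 : 0 <= B by apply: le_trans (AB 0 h0); exact: enorm_ge0.
have F0 : 0 <= F.
  by apply: addr_ge0; [exact: f0|apply: mulr_ge0 => //; exact: addr_ge0].
have fF u x : (forall y, Omega y -> `|u y| <= M) -> Omega x -> 0 <= f x (u x) <= F.
  move=> uM Ax; have cx := subset_closure Ax; rewrite f0 //=.
  have := fL x 0 (u x) 0 cx c0; rewrite !subr0 => /ler_normlP[_ fx].
  have : L * (enorm x + `|u x|) <= `|L| * (B + M).
    have x0 : 0 <= enorm x + `|u x| by apply: addr_ge0; [exact: enorm_ge0|exact: normr_ge0].
    apply: le_trans (ler_wpM2r x0 (ler_norm L)) _.
    by apply: ler_wpM2l; [exact: normr_ge0|apply: lerD; [exact: AB|exact: uM]].
  by rewrite /F; move: fx; clear => *; lra.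
have [a [C0 [r [a0 C00 /andP[r0 rr1] origin]]]] := holder_origin hk hs F0 r10 M0.
pose al := Num.min a 1 / 2.
have al0 : 0 < al by rewrite divr_gt0 // lt_min a0 ltr01.
have al12 : al <= 1 / 2 by rewrite ler_pM2r ?invr_gt0 // ge_min lexx orbT.
have al1 : al < 1 by lra.
have al01 : 0 < al <= 1 by rewrite al0 ltW.
(* [delta] does not occur in [Q]: the equation enters only through the estimate at the origin, whose
   constants are already uniform in [delta]. *)
pose Q u := [/\ forall x, Omega x -> differentiable u x,
  forall x, Omega x -> enorm x * enorm (grad u x) <= K,
  forall x, Omega x -> `|u x| <= M &
  forall x, enorm x <= r -> `|u x - u 0| <= C0 * powR (enorm x) a].
have loc b : closure Omega b -> exists eta C, 0 < eta /\ forall u y z, Q u -> Omega y -> Omega z ->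
    enorm (y - b) < eta -> enorm (z - b) < eta -> `|u y - u z| <= C * powR (enorm (y - z)) al.
  move=> cb; have [->|b0] := eqVneq b 0.
    have rA' x : enorm x <= r -> Omega x by move=> xr; apply: rA; exact: le_lt_trans rr1.
    have [eta [C [eta0 H]]] := holder_at_origin rA' r0 a0 C00 K0.
    by exists eta, C; split => // u y z [du uK _ uo] _ _; exact: H.
  have [Ab|nAb] := pselect (Omega b).
    have [eta [C [eta0 H]]] := @holder_interior R n Omega K b al oA Ab b0 al01.
    by exists eta, C; split => // u y z [du uK _ _] _ _; exact: H.
  have gb : grad psi b != 0 by apply: gpsi.
  have [eta [C [eta0 H]]] := @holder_boundary R n Omega K b al psi (isCkW C3psi) Apsi gb b0 al01.
  by exists eta, C; split => // u y z [du uK _ _]; exact: H.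
have QM u : Q u -> forall y, Omega y -> `|u y| <= M by case.
have [C Cge H] := uniform_holder al0 M0 (compact_closure_bounded AB) loc QM.
exists al; split; first by rewrite al0.
exists (M + C) => delta /andP[dl0 dl1] u phi Cu [_ [cu _]] adm eqn _ _ uM uK x y z cx cy cz yz.
have d2 : 0 < delta ^+ 2 <= 1 by rewrite exprn_gt0 // exprn_ile1 // ltW.
have Qu : Q u.
  split => //; first exact: isCkS_diff Cu.
  apply: (origin _ u d2) => [|w /rA]; last exact: uM.
  by apply: (local_solutionI rA r10 Cu adm eqn) => w; exact: fF.
apply: lerD; first exact: bounded_closure cu uM x cx.
have yz0 : 0 < enorm (y - z) by apply: enorm_gt0; rewrite subr_eq0.
rewrite ler_pdivrMr ?powR_gt0 //.
by apply: (holder_closure al01 Cge cu) => // y' z' Ay Az; exact: H.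
Qed.
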